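(* Let $\mu>0$, $b>0$, $\gamma\in\mathbb{R}$, let $\nu>0$ be non-integer, and suppose that neither $\gamma+\nu$ nor $\gamma-\nu$ belongs to $\{-1,-3,-5,\ldots\}$. Put $\chi=b^2/4$. Then, as $|a|\to\infty$ in $|\arg a|<\tfrac12\pi$, $$\sum_{n=1}^\infty \frac{(-1)^{n-1} n^\gamma }{(n^2+a^2)^\mu}\,K_\nu(nb/a)\sim \tilde R(a;\nu)+\tilde R(a;-\nu),$$ where, for $\kappa\in\{\nu,-\nu\}$ and $\omega_k(\kappa)=\gamma+\kappa+2k$, $$\tilde R(a;\kappa)=\frac{1}{2}a^{-\kappa-2\mu}\chi^{\kappa/2}\Gamma(-\kappa) \sum_{k=0}^\infty \frac{(-1)^k(\mu)_k}{k!}\{1-2^{1+\omega_k(\kappa)}\}\,\zeta(-\omega_k(\kappa))\,F_k^{(\mu)}(\kappa;\chi)\, a^{-2k},$$ $$F_k^{(\mu)}(\kappa;\chi)=\sum_{r=0}^k\frac{(-k)_r (-\chi)^r}{(1+\kappa)_r (1-\mu-k)_r\, r!}.$$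
   Context: $K_\nu$ is the modified Bessel function of the second kind, $\zeta$ the Riemann zeta function, $(x)_r=x(x+1)\cdots(x+r-1)$. Powers take principal values. Meaning of the expansion: for every integer $K\ge0$ and every $\delta\in(0,\frac12\pi)$, the left-hand side minus both sums on the right truncated to the terms $0\le k<K$ is $O(|a|^{\nu-2\mu-2K})$ as $|a|\to\infty$ uniformly in $|\arg a|\le\frac12\pi-\delta$. *)

(* Defs.v *)
From Stdlib Require Import Reals ZArith.
From Coquelicot Require Import Coquelicot.

Open Scope R_scope.

(** Principal argument, in (-PI, PI], of a nonzero complex number. *)
Definition Arg (z : C) : R :=
  if Rle_dec 0 (Im z) then acos (Re z / Cmod z) else - acos (Re z / Cmod z).

Definition Cln (z : C) : C := (ln (Cmod z), Arg z).

Definition Cexp (z : C) : C := (exp (Re z) * cos (Im z), exp (Re z) * sin (Im z)).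

(** Principal value of [z ^ s], for [z] nonzero. *)
Definition Cpower (z s : C) : C := Cexp (s * Cln z)%C.

(** [(x)_r = x (x+1) ... (x+r-1)] *)
Fixpoint poch (x : R) (r : nat) : R :=
  match r with
  | O => 1
  | S r' => poch x r' * (x + INR r')
  end.

Definition Euler_Gamma (x : R) : R :=
  RInt_gen (fun t => Rpower t (x - 1) * exp (- t))
           (at_right 0) (Rbar_locally p_infty).

(** The Gamma function at a real [x] other than 0, -1, -2, ...: Euler's integral,
    extended by [Gamma x = Gamma (x + m) / (x)_m], where [m] is such that
    [x + m > 0] ([m = 0] if [x > 0]). *)
Definition Gamma (x : R) : R :=
  let m := Z.to_nat (up (- x)) in Euler_Gamma (x + INR m) / poch x m.

(** [K_nu z], for [Re z > 0] (the integral need not converge elsewhere):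
    the integral of [exp (- z cosh t) cosh (nu t)] over [t >= 0]. *)
Definition BesselK (nu : R) (z : C) : C :=
  RInt_gen (V := C_R_CompleteNormedModule)
    (fun t => (Cexp (- z * RtoC (cosh t)) * RtoC (cosh (nu * t)))%C)
    (at_point 0) (Rbar_locally p_infty).

Definition analytic_at (f : C -> C) (s0 : C) : Prop :=
  exists (c : nat -> C) (r : R),
    0 < r /\
    forall s : C, Cmod (s - s0)%C < r ->
      is_series (fun n => (c n * (s - s0) ^ n)%C) (f s).

(** [zeta] is the analytic continuation to the complex plane without 1 of the sum
    of the [n ^ (- s)], [n >= 1]; the continuation is unique except that the value
    at 1 is left free. *)
Definition is_Riemann_zeta (zeta : C -> C) : Prop :=
  (forall s : C, 1 < Re s ->
     is_series (fun m => Cpower (RtoC (INR (S m))) (- s)%C) (zeta s)) /\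
  (forall s : C, s <> RtoC 1 -> analytic_at zeta s).

Definition omega (gamma kappa : R) (k : nat) : R := gamma + kappa + 2 * INR k.

Definition F (mu kappa chi : R) (k : nat) : R :=
  sum_f_R0 (fun r =>
    poch (- INR k) r * (- chi) ^ r /
    (poch (1 + kappa) r * poch (1 - mu - INR k) r * INR (fact r))) k.

Definition Csum_lt (f : nat -> C) (K : nat) : C :=
  match K with
  | O => RtoC 0
  | S K' => sum_n f K'
  end.

(** The formal series [R~ (a; kappa)], truncated to the terms [k < K]. *)
Definition Rtilde (zeta : C -> C) (mu b gamma : R) (K : nat) (a : C) (kappa : R) : C :=
  let chi := b ^ 2 / 4 in
  (RtoC (/ 2) * Cpower a (RtoC (- kappa - 2 * mu))
   * RtoC (Rpower chi (kappa / 2)) * RtoC (Gamma (- kappa))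
   * Csum_lt (fun k =>
       RtoC ((-1) ^ k * poch mu k / INR (fact k))
       * RtoC (1 - Rpower 2 (1 + omega gamma kappa k))
       * zeta (RtoC (- omega gamma kappa k))
       * RtoC (F mu kappa chi k)
       * / a ^ (2 * k)) K)%C.

(** The [n]-th summand of the alternating sum, for [n >= 1]. *)
Definition summand (mu b gamma nu : R) (a : C) (n : nat) : C :=
  (RtoC ((-1) ^ (n - 1) * Rpower (INR n) gamma)
   / Cpower (RtoC (INR n) ^ 2 + a ^ 2) (RtoC mu)
   * BesselK nu (RtoC (INR n * b) / a))%C.

(* Main.v *)
Require Import Defs.
From Stdlib Require Import Reals ZArith Lra Lia Psatz Classical IndefiniteDescription.
From Coquelicot Require Import Coquelicot.
Open Scope R_scope.

(** Write the summand as [a ^ (-2 mu) n ^ gamma f (n / a)] with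
    [f x = (1 + x ^ 2) ^ (- mu) K_nu (b x)]. At the origin [f] has an expansion in
    the powers [x ^ (2 m + nu)] and [x ^ (2 m - nu)]; the remainder after finitely
    many terms, and all its derivatives under [x d/dx], are dominated on the whole
    sector by powers of [|x|]. For the factor [(1 + x ^ 2) ^ (- mu)] and for
    [K_nu] this follows by integrating first-order differential equations from
    the origin: [(x d/dx + nu) K_nu = - x K_(nu - 1)] lowers [nu], and the
    constant of integration is the limit of [x ^ nu K_nu] at the origin.

    An alternating sum is transformed by [N] Euler steps into a sum of [N]-th
    differences, which converges absolutely for functions of polynomial growth
    once [N] is large. On [n ^ alpha] the transformed sum has the value
    [(1 - 2 ^ (1 + alpha)) zeta (- alpha)], by analytic continuation of [zeta] along
    a segment that avoids its pole; on the remainder it is bounded by the weight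
    of the remainder. *)

(** * Calculus of complex-valued functions of a real variable *)

(** Expanding the summand and adding term by term fails in the ordinary sense: the exponents omega_k
    tend to infinity, so the alternating sums of n^omega_k diverge. Hence all identities are stated
    between sums transformed with one common N; the original sum converges, and the transformation
    keeps its value. The remainder of f is small like (n/|a|)^A for n below |a|, but may grow like
    (n/|a|)^B beyond. This is why weights carry two exponents. The lower one, A = 2K - nu, is the
    exponent of the first omitted singular term and, with the prefactor a^(-2 mu), gives the error
    |a|^(nu - 2 mu - 2K); the upper one is never computed and is paid for by a larger N. The sector
    enters only through Re a >= sin(delta) |a|, which keeps n b / a inside the right half-plane and
    n^2 + a^2 away from 0. The conditions on gamma + nu and gamma - nu say that no omega_k equals
    -1, so zeta is never evaluated at 1. *)

Lemma C_ext (z w : C) : Re z = Re w -> Im z = Im w -> z = w.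
Proof. destruct z, w; simpl; intros -> ->; reflexivity. Qed.

Lemma Re_plus (z w : C) : Re (z + w)%C = Re z + Re w.
Proof. reflexivity. Qed.

Lemma Im_plus (z w : C) : Im (z + w)%C = Im z + Im w.
Proof. reflexivity. Qed.

Lemma Re_opp (z : C) : Re (- z)%C = - Re z.
Proof. reflexivity. Qed.

Lemma Im_opp (z : C) : Im (- z)%C = - Im z.
Proof. reflexivity. Qed.

Lemma Re_minus (z w : C) : Re (z - w)%C = Re z - Re w.
Proof. reflexivity. Qed.

Lemma Im_minus (z w : C) : Im (z - w)%C = Im z - Im w.
Proof. reflexivity. Qed.

Lemma Re_mult (z w : C) : Re (z * w)%C = Re z * Re w - Im z * Im w.
Proof. reflexivity. Qed.

Lemma Im_mult (z w : C) : Im (z * w)%C = Re z * Im w + Im z * Re w.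
Proof. reflexivity. Qed.

Lemma Re_Ci : Re Ci = 0.
Proof. reflexivity. Qed.

Lemma Im_Ci : Im Ci = 1.
Proof. reflexivity. Qed.

Global Hint Rewrite Re_plus Im_plus Re_opp Im_opp Re_minus Im_minus
  Re_mult Im_mult re_RtoC im_RtoC Re_Ci Im_Ci : reim.

Lemma im_le_Cmod (z : C) : Rabs (Im z) <= Cmod z.
Proof.
  eapply Rle_trans; [|apply Rmax_Cmod]. apply Rmax_r.
Qed.

Lemma Re_le_Cmod (z : C) : Re z <= Cmod z.
Proof. eapply Rle_trans; [apply Rle_abs|apply re_le_Cmod]. Qed.

Lemma Cmod_le_abs (z : C) : Cmod z <= Rabs (Re z) + Rabs (Im z).
Proof.
  replace z with (RtoC (Re z) + RtoC (Im z) * Ci)%C at 1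
    by (apply C_ext; autorewrite with reim; ring).
  eapply Rle_trans; [apply Cmod_triangle|].
  rewrite Cmod_mult, Cmod_Ci, !Cmod_R. lra.
Qed.

Lemma Cmod_minus_sym (z w : C) : Cmod (z - w)%C = Cmod (w - z)%C.
Proof.
  rewrite <- Cmod_opp. f_equal. ring.
Qed.

Lemma Cmod_minus_le (z w : C) : Cmod (z - w)%C <= Cmod z + Cmod w.
Proof.
  unfold Cminus. eapply Rle_trans; [apply Cmod_triangle|].
  rewrite Cmod_opp. lra.
Qed.

Lemma Cmod_sqr (z : C) : Cmod z * Cmod z = Re z * Re z + Im z * Im z.
Proof. generalize (Cmod2_alt z). simpl. lra. Qed.

Lemma Cmod_RtoC_pos (x : R) : 0 <= x -> Cmod (RtoC x) = x.
Proof. intros. rewrite Cmod_R. apply Rabs_pos_eq; lra. Qed.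

Lemma Re_pos_neq (z : C) : 0 < Re z -> z <> 0.
Proof. intros H E. rewrite E in H. simpl in H. lra. Qed.

Lemma RtoC_m1 : RtoC (-1) = (- RtoC 1)%C.
Proof. apply C_ext; simpl; ring. Qed.

Lemma RtoC_two : RtoC 2 = (1 + 1)%C.
Proof. apply C_ext; simpl; ring. Qed.

Lemma Cinv_eq_conj (z : C) : z <> 0 -> (/ z = RtoC (/ (Cmod z * Cmod z)) * Cconj z)%C.
Proof.
  intros Hz. assert (HM : 0 < Cmod z) by now apply Cmod_gt_0.
  assert (Hn : (z * Cconj z)%C = RtoC (Cmod z * Cmod z)) by (rewrite <- Cmod2_conj; f_equal; ring).
  assert (Hcz : Cconj z <> 0).
  { intros E. apply Hz. apply Cmod_eq_0. rewrite <- Cmod_conj, E. apply Cmod_0. }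
  rewrite RtoC_inv by nra. rewrite <- Hn. field. auto.
Qed.

Lemma RtoC_neq (x : R) : x <> 0 -> RtoC x <> 0.
Proof. intros H E. apply H. now apply RtoC_inj. Qed.

Lemma Csum_Sn (f : nat -> C) n : sum_n f (S n) = (sum_n f n + f (S n))%C.
Proof. exact (sum_Sn f n). Qed.

Lemma Csum_O (f : nat -> C) : sum_n f 0 = f 0%nat.
Proof. exact (sum_O f). Qed.

Lemma Cexp_0 : Cexp 0 = 1.
Proof.
  unfold Cexp; simpl. rewrite exp_0, cos_0, sin_0. apply C_ext; simpl; ring.
Qed.

Lemma Cexp_plus (z w : C) : Cexp (z + w)%C = (Cexp z * Cexp w)%C.
Proof.
  unfold Cexp. rewrite Re_plus, Im_plus, exp_plus, cos_plus, sin_plus.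
  apply C_ext; autorewrite with reim; simpl; ring.
Qed.

Lemma Cexp_RtoC (x : R) : Cexp (RtoC x) = RtoC (exp x).
Proof.
  unfold Cexp; simpl. rewrite cos_0, sin_0. apply C_ext; simpl; ring.
Qed.

Lemma Cmod_Cexp (z : C) : Cmod (Cexp z) = exp (Re z).
Proof.
  generalize (Cmod_sqr (Cexp z)). unfold Cexp at 3 4 5 6. simpl. intros H.
  generalize (sin2_cos2 (Im z)). unfold Rsqr. intros H1.
  apply Rsqr_inj. apply Cmod_ge_0. left; apply exp_pos.
  unfold Rsqr. rewrite H.
  transitivity (exp (Re z) * exp (Re z) * (sin (Im z) * sin (Im z) + cos (Im z) * cos (Im z))).
  ring. rewrite H1. ring.
Qed.

Lemma Cexp_neq_0 (z : C) : Cexp z <> 0.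
Proof.
  apply Cmod_gt_0. rewrite Cmod_Cexp. apply exp_pos.
Qed.

Lemma Cexp_opp (z : C) : Cexp (- z)%C = (/ Cexp z)%C.
Proof.
  assert (H := Cexp_neq_0 z).
  replace (Cexp (- z)) with (Cexp (-z) * Cexp z * / Cexp z)%C by (field; auto).
  rewrite <- Cexp_plus.
  replace (- z + z)%C with (RtoC 0) by ring. rewrite Cexp_0. ring.
Qed.

(** Taken by components, so that the real rules of differentiation and the real mean value theorem
    apply directly. *)
Definition Cder (f : R -> C) (t : R) (l : C) : Prop :=
  is_derive (fun u => Re (f u)) t (Re l) /\ is_derive (fun u => Im (f u)) t (Im l).

Lemma Cder_eq (f : R -> C) t l l' : Cder f t l -> l = l' -> Cder f t l'.
Proof. now intros H <-. Qed.

Lemma Cder_ext_loc (f g : R -> C) t l :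
  locally t (fun u => f u = g u) -> Cder f t l -> Cder g t l.
Proof.
  intros H [H1 H2]; split.
  - eapply is_derive_ext_loc; [|apply H1]. now refine (filter_imp _ _ _ H); intros u ->.
  - eapply is_derive_ext_loc; [|apply H2]. now refine (filter_imp _ _ _ H); intros u ->.
Qed.

Lemma Cder_ext_pos (f g : R -> C) t l :
  0 < t -> (forall u, 0 < u -> f u = g u) -> Cder f t l -> Cder g t l.
Proof.
  intros H H1. apply Cder_ext_loc.
  refine (filter_imp _ _ _ (open_gt 0 t H)); intros u Hu; now apply H1.
Qed.

Lemma Cder_ext (f g : R -> C) t l :
  (forall u, f u = g u) -> Cder f t l -> Cder g t l.
Proof.
  intros H1. apply Cder_ext_loc. now apply filter_forall.
Qed.

Lemma Cder_const (c : C) t : Cder (fun _ => c) t 0.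
Proof. split; apply @is_derive_const. Qed.

Lemma Cder_RtoC (f : R -> R) t l : is_derive f t l -> Cder (fun u => RtoC (f u)) t (RtoC l).
Proof. intros H; split; simpl; [exact H|apply @is_derive_const]. Qed.

Lemma Cder_id t : Cder (fun u => RtoC u) t 1.
Proof. exact (Cder_RtoC (fun u => u) t 1 (is_derive_id t)). Qed.

Lemma Cder_plus (f g : R -> C) t lf lg :
  Cder f t lf -> Cder g t lg -> Cder (fun u => f u + g u)%C t (lf + lg)%C.
Proof. intros [H1 H2] [H3 H4]; split; simpl; now apply @is_derive_plus. Qed.

Lemma Cder_opp (f : R -> C) t lf : Cder f t lf -> Cder (fun u => - f u)%C t (- lf)%C.
Proof. intros [H1 H2]; split; simpl; now apply @is_derive_opp. Qed.

Lemma Cder_minus (f g : R -> C) t lf lg :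
  Cder f t lf -> Cder g t lg -> Cder (fun u => f u - g u)%C t (lf - lg)%C.
Proof. intros. apply Cder_plus; auto. now apply Cder_opp. Qed.

Lemma Cder_mult (f g : R -> C) t lf lg :
  Cder f t lf -> Cder g t lg ->
  Cder (fun u => f u * g u)%C t (lf * g t + f t * lg)%C.
Proof.
  intros [H1 H2] [H3 H4]; split.
  - apply is_derive_ext with (f := fun u => Re (f u) * Re (g u) - Im (f u) * Im (g u)).
    reflexivity.
    autorewrite with reim.
    replace (_ + _) with ((Re lf * Re (g t) + Re (f t) * Re lg) - (Im lf * Im (g t) + Im (f t) * Im lg)) by ring.
    apply @is_derive_minus; apply @is_derive_mult; auto; intros; apply Rmult_comm.
  - apply is_derive_ext with (f := fun u => Re (f u) * Im (g u) + Im (f u) * Re (g u)).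
    reflexivity.
    autorewrite with reim.
    replace (_ + _) with ((Re lf * Im (g t) + Re (f t) * Im lg) + (Im lf * Re (g t) + Im (f t) * Re lg)) by ring.
    apply @is_derive_plus; apply @is_derive_mult; auto; intros; apply Rmult_comm.
Qed.

Lemma Cder_scal (c : C) (f : R -> C) t l :
  Cder f t l -> Cder (fun u => c * f u)%C t (c * l)%C.
Proof.
  intros H. eapply Cder_eq. apply Cder_mult. apply Cder_const. apply H. cbv beta. ring.
Qed.

Lemma Cder_comp (f : R -> C) (g : R -> R) t l lg :
  Cder f (g t) l -> is_derive g t lg -> Cder (fun u => f (g u)) t (RtoC lg * l)%C.
Proof.
  intros [H1 H2] H3; split; autorewrite with reim; rewrite !Rmult_0_l, ?Rminus_0_r, ?Rplus_0_r.
  - apply (is_derive_comp (fun u => Re (f u)) g); auto.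
  - apply (is_derive_comp (fun u => Im (f u)) g); auto.
Qed.

Lemma Cder_shift (f : R -> C) c t l :
  Cder f (t + c) l -> Cder (fun u => f (u + c)) t l.
Proof.
  intros H. eapply Cder_eq. apply (Cder_comp f (fun u => u + c)). exact H.
  auto_derive; auto. ring.
Qed.

Lemma Cder_Cexp (f : R -> C) t l :
  Cder f t l -> Cder (fun u => Cexp (f u)) t (l * Cexp (f t))%C.
Proof.
  assert (H : forall (g h : R -> R) (g' h' : R), is_derive g t g' -> is_derive h t h' ->
    is_derive (fun u => exp (g u) * cos (h u)) t (g' * (exp (g t) * cos (h t)) - h' * (exp (g t) * sin (h t)))
    /\ is_derive (fun u => exp (g u) * sin (h u)) t (g' * (exp (g t) * sin (h t)) + h' * (exp (g t) * cos (h t)))).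
  { intros g h g' h' Hg Hh.
    assert (Eg : Derive (fun x => g x) t = g') by (apply is_derive_unique; exact Hg).
    assert (Eh : Derive (fun x => h x) t = h') by (apply is_derive_unique; exact Hh).
    split; auto_derive.
    - split; [now exists g'|split; [now exists h'|auto]].
    - rewrite Eg, Eh; ring.
    - split; [now exists g'|split; [now exists h'|auto]].
    - rewrite Eg, Eh; ring. }
  intros [H1 H2]. destruct (H _ _ _ _ H1 H2) as [H3 H4].
  split; autorewrite with reim; [exact H3|exact H4].
Qed.

(* The growth of [f] is measured in the direction [conj (f b - f a)], which
   reduces the claim to the mean value theorem for a real function. *)
Lemma Cder_mean_value (f : R -> C) (f' : R -> C) (phi phi' : R -> R) a b :
  a <= b ->
  (forall t, a <= t <= b -> Cder f t (f' t)) ->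
  (forall t, a <= t <= b -> is_derive phi t (phi' t)) ->
  (forall t, a <= t <= b -> Cmod (f' t) <= phi' t) ->
  Cmod (f b - f a)%C <= phi b - phi a.
Proof.
  intros Hab Hf Hphi Hb.
  set (d := (f b - f a)%C).
  destruct (Req_dec (Cmod d) 0) as [Hd|Hd].
  { rewrite Hd.
    destruct (MVT_gen phi a b phi') as [c [Hc E]].
    - intros x Hx; apply Hphi. rewrite Rmin_left, Rmax_right in Hx by lra. lra.
    - intros x Hx. rewrite Rmin_left, Rmax_right in Hx by lra.
      apply derivable_continuous_pt. exists (phi' x). apply is_derive_Reals. now apply Hphi.
    - rewrite Rmin_left, Rmax_right in Hc by lra.
      rewrite E. apply Rmult_le_pos; [|lra].
      eapply Rle_trans; [apply Cmod_ge_0|apply Hb; lra]. }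
  set (g := fun t => Re d * Re (f t) + Im d * Im (f t) - Cmod d * phi t).
  set (g' := fun t => Re d * Re (f' t) + Im d * Im (f' t) - Cmod d * phi' t).
  assert (Hg : forall t, a <= t <= b -> is_derive g t (g' t)).
  { intros t Ht. destruct (Hf t Ht) as [H1 H2]. unfold g, g'.
    apply @is_derive_minus; [apply @is_derive_plus|]; apply @is_derive_scal; auto. }
  destruct (MVT_gen g a b g') as [c [Hc E]].
  - intros x Hx. rewrite Rmin_left, Rmax_right in Hx by lra. apply Hg; lra.
  - intros x Hx. rewrite Rmin_left, Rmax_right in Hx by lra.
    apply derivable_continuous_pt. exists (g' x). apply is_derive_Reals. now apply Hg.
  - rewrite Rmin_left, Rmax_right in Hc by lra.
    assert (Hneg : g' c <= 0).
    { unfold g'. specialize (Hb c Hc).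
      assert (Re d * Re (f' c) + Im d * Im (f' c) <= Cmod d * Cmod (f' c)).
      { replace (_ + _) with (Re (Cconj d * f' c)%C) by (destruct d, (f' c); simpl; ring).
        eapply Rle_trans; [apply Re_le_Cmod|]. rewrite Cmod_mult, Cmod_conj. lra. }
      assert (Cmod d * Cmod (f' c) <= Cmod d * phi' c).
      { apply Rmult_le_compat_l; auto. apply Cmod_ge_0. }
      lra. }
    assert (g b - g a <= 0) by (rewrite E; generalize (Rmult_le_compat_r (b - a) _ _ ltac:(lra) Hneg); lra).
    assert (Hdd : Re d * Re d + Im d * Im d <= Cmod d * (phi b - phi a)).
    { unfold g in H. replace (Re d) with (Re (f b) - Re (f a)) at 2 by reflexivity.
      replace (Im d) with (Im (f b) - Im (f a)) at 2 by reflexivity. lra. }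
    rewrite <- Cmod_sqr in Hdd.
    generalize (Cmod_ge_0 d); intros.
    apply Rmult_le_reg_l with (Cmod d); lra.
Qed.

Lemma Cder_bounded_diff (f f' : R -> C) M a b :
  a <= b ->
  (forall t, a <= t <= b -> Cder f t (f' t)) ->
  (forall t, a <= t <= b -> Cmod (f' t) <= M) ->
  Cmod (f b - f a)%C <= M * (b - a).
Proof.
  intros H H1 H2. replace (M * (b - a)) with (M * b - M * a) by ring.
  apply (Cder_mean_value f f' (fun x => M * x) (fun _ => M)); auto.
  intros. auto_derive; auto. ring.
Qed.

(** * Taylor remainders of the complex exponential *)

Definition exp_partial (w : C) (n : nat) : C := sum_n (fun k => RtoC (/ INR (fact k)) * w ^ k)%C n.

Lemma INR_fact_pos n : 0 < INR (fact n).
Proof. apply INR_fact_lt_0. Qed.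

Lemma Cder_pow_line (w : C) n t :
  Cder (fun u => (RtoC u * w) ^ S n)%C t (RtoC (INR (S n)) * w * (RtoC t * w) ^ n)%C.
Proof.
  induction n.
  - eapply Cder_ext. 2: eapply Cder_eq. 2: apply (Cder_mult (fun u => RtoC u) (fun _ => w)).
    2: apply Cder_id. 2: apply Cder_const.
    intros; simpl; ring. simpl. ring.
  - eapply Cder_ext. 2: eapply Cder_eq. 2: apply (Cder_mult (fun u => RtoC u * w)%C (fun u => (RtoC u * w)^S n)%C).
    2: apply (Cder_mult (fun u => RtoC u) (fun _ => w)).
    2: apply Cder_id. 2: apply Cder_const. 2: apply IHn.
    intros; simpl; ring.
    cbv beta. rewrite (S_INR (S n)), RtoC_plus, Cpow_S. cbv beta. ring.
Qed.

(** Along the segment from 0 to w, differentiation lowers the order of the Taylor remainder by one;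
    this drives the induction in the next bound. *)
Lemma Cexp_partial_der (w : C) n t :
  Cder (fun u => Cexp (RtoC u * w) - exp_partial (RtoC u * w) (S n))%C t
    (w * (Cexp (RtoC t * w) - exp_partial (RtoC t * w) n))%C.
Proof.
  assert (H : forall t, Cder (fun u => RtoC u * w)%C t w).
  { intros u. eapply Cder_eq. apply (Cder_mult (fun u => RtoC u) (fun _ => w)).
    apply Cder_id. apply Cder_const. cbv beta. ring. }
  replace (w * _)%C with (w * Cexp (RtoC t * w) - w * exp_partial (RtoC t * w) n)%C by ring.
  apply Cder_minus. apply Cder_Cexp. apply H.
  induction n.
  - unfold exp_partial. eapply Cder_ext. 2: eapply Cder_eq.
    2: { apply Cder_plus. apply (Cder_const (RtoC 1)). apply H. }
    intros u. rewrite Csum_Sn, Csum_O. simpl. 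
    rewrite Rinv_1. simpl. ring. rewrite Csum_O. simpl. rewrite Rinv_1. ring.
  - eapply Cder_ext. 2: eapply Cder_eq. 2: { apply Cder_plus. apply IHn.
     apply (Cder_scal (RtoC (/ INR (fact (S (S n))))) (fun u => (RtoC u * w)^(S (S n)))%C).
     apply Cder_pow_line. }
    intros u. unfold exp_partial. rewrite (Csum_Sn _ (S n)). reflexivity.
    unfold exp_partial. rewrite (Csum_Sn _ n).
    rewrite fact_simpl, mult_INR, Rinv_mult, RtoC_mult.
    assert (RtoC (/ INR (S (S n))) * RtoC (INR (S (S n))) = 1)%C.
    { rewrite <- RtoC_mult. rewrite Rinv_l; auto. apply not_0_INR; lia. }
    transitivity (w * sum_n (fun k : nat => RtoC (/ INR (fact k)) * (t * w) ^ k) n +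
       (RtoC (/ INR (S (S n))) * RtoC (INR (S (S n)))) * (RtoC (/ INR (fact (S n))) * w * (RtoC t * w) ^ S n))%C.
    ring. rewrite H0. ring.
Qed.

(** The bound is kept as a function of t, because the induction integrates the factor t^(n+1) of one
    order into that of the next. *)
Lemma Cexp_partial_bound_line (w : C) n t :
  0 <= t <= 1 ->
  Cmod (Cexp (RtoC t * w) - exp_partial (RtoC t * w) n)%C
  <= Cmod w ^ S n * exp (Cmod w) / INR (fact (S n)) * t ^ S n.
Proof.
  assert (Hx : forall t, 0 <= t <= 1 -> Cmod (Cexp (RtoC t * w)) <= exp (Cmod w)).
  { intros u Hu. rewrite Cmod_Cexp. rewrite re_scal_l.
    assert (u * Re w <= Cmod w).
    { generalize (re_le_Cmod w). generalize (Cmod_ge_0 w). unfold Rabs; destruct Rcase_abs; nra. }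
    destruct H. left; now apply exp_increasing. right; now f_equal. }
  revert t. induction n; intros t Ht.
  - generalize (Cder_mean_value (fun u => Cexp (RtoC u * w)) (fun u => w * Cexp (RtoC u * w))%C
      (fun u => Cmod w * exp (Cmod w) * u) (fun u => Cmod w * exp (Cmod w)) 0 t (proj1 Ht)).
    intros HH.
    assert (Cexp (RtoC 0 * w) = 1) as E.
    { replace (RtoC 0 * w)%C with (RtoC 0) by ring. apply Cexp_0. }
    cbv beta in HH. rewrite E in HH.
    unfold exp_partial. rewrite Csum_O. simpl. rewrite Rinv_1.
    replace (RtoC 1 * RtoC 1)%C with (RtoC 1) by ring.
    eapply Rle_trans; [apply HH|].
    + intros u Hu. apply Cder_Cexp.
      eapply Cder_eq. apply (Cder_mult (fun u => RtoC u) (fun _ => w)).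
      apply Cder_id. apply Cder_const. cbv beta. ring.
    + intros u Hu. auto_derive; auto. ring.
    + intros u Hu. rewrite Cmod_mult. apply Rmult_le_compat_l. apply Cmod_ge_0. apply Hx; lra.
    + right. field.
  - generalize (Cder_mean_value (fun u => Cexp (RtoC u * w) - exp_partial (RtoC u * w) (S n))%C
      (fun u => w * (Cexp (RtoC u * w) - exp_partial (RtoC u * w) n))%C
      (fun u => Cmod w ^ S (S n) * exp (Cmod w) / INR (fact (S (S n))) * u ^ S (S n))
      (fun u => Cmod w * (Cmod w ^ S n * exp (Cmod w) / INR (fact (S n)) * u ^ S n)) 0 t (proj1 Ht)).
    intros HH. cbv beta in HH.
    assert (forall m, exp_partial (RtoC 0 * w) m = 1) as E.
    { intros m. replace (RtoC 0 * w)%C with (RtoC 0) by ring. unfold exp_partial.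
      induction m. rewrite Csum_O. simpl. rewrite Rinv_1. ring.
      rewrite Csum_Sn, IHm. simpl. ring. }
    rewrite E in HH.
    replace (RtoC 0 * w)%C with (RtoC 0) in HH by ring. rewrite Cexp_0 in HH.
    replace (1 - 1)%C with (RtoC 0) in HH by ring.
    rewrite pow_i in HH by lia. 
    assert (E0 : forall z : C, (z - 0)%C = z) by (intros; ring). rewrite E0 in HH.
    rewrite Rmult_0_r, Rminus_0_r in HH.
    apply HH.
    + intros u Hu. apply Cexp_partial_der.
    + intros u Hu. assert (Hf := INR_fact_pos (S n)).
      assert (0 < INR (S (S n))) by (apply lt_0_INR; lia).
      rewrite (fact_simpl (S n)), mult_INR.
      evar_last. 
      apply (is_derive_scal (fun u => u ^ S (S n))). 
      apply (is_derive_pow (fun u => u) (S (S n)) u 1). apply @is_derive_id.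
      cbv beta. change (pred (S (S n))) with (S n). change (Cmod w ^ S (S n)) with (Cmod w * Cmod w ^ S n). field. lra.
    + intros u Hu. rewrite Cmod_mult. apply Rmult_le_compat_l. apply Cmod_ge_0. apply IHn; lra.
Qed.

Lemma Cexp_partial_bound (w : C) n :
  Cmod (Cexp w - exp_partial w n)%C <= Cmod w ^ S n * exp (Cmod w) / INR (fact (S n)).
Proof.
  generalize (Cexp_partial_bound_line w n 1 ltac:(lra)).
  rewrite Cmult_1_l, pow1, Rmult_1_r. auto.
Qed.

(** The case of order 1 with the factor 1/2 dropped. It is the estimate behind differentiation of
    [BesselK] under the integral sign. *)
Lemma Cexp_quadratic (w : C) :
  Cmod (Cexp w - 1 - w)%C <= Cmod w ^ 2 * exp (Cmod w).
Proof.
  eapply Rle_trans; [|eapply Rle_trans; [apply (Cexp_partial_bound w 1)|]].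
  - right. f_equal. unfold exp_partial. rewrite Csum_Sn, Csum_O.
    simpl. rewrite Rinv_1. ring.
  - simpl fact. assert (0 <= Cmod w ^ 2 * exp (Cmod w)).
    { apply Rmult_le_pos. apply pow2_ge_0. left; apply exp_pos. }
    simpl INR. lra.
Qed.

(** * Symbols and finite differences *)

Lemma Rpower_pos x y : 0 < Rpower x y.
Proof. apply exp_pos. Qed.

Lemma Rpower_1_l y : Rpower 1 y = 1.
Proof. unfold Rpower. rewrite ln_1, Rmult_0_r. apply exp_0. Qed.

Lemma is_derive_Rpower a t : 0 < t -> is_derive (fun u => Rpower u a) t (/ t * (a * Rpower t a)).
Proof. intros H. unfold Rpower. auto_derive; auto. field. lra. Qed.

Lemma Rpower_div_l x y a : 0 < x -> 0 < y -> Rpower (x / y) a = Rpower x a * Rpower y (- a).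
Proof.
  intros Hx Hy. unfold Rdiv. rewrite <- Rpower_mult_distr; auto.
  2: now apply Rinv_0_lt_compat.
  f_equal. unfold Rpower. f_equal. rewrite ln_Rinv; auto. ring.
Qed.

Lemma Rpower_exponent_le x a b : 0 < x -> (x <= 1 -> b <= a) -> (1 < x -> a <= b) ->
  Rpower x a <= Rpower x b.
Proof.
  intros Hx H1 H2. unfold Rpower.
  assert (a * ln x <= b * ln x).
  { destruct (Rle_lt_dec x 1).
    - assert (ln x <= 0). { rewrite <- ln_1. destruct r. left; now apply ln_increasing. right; now f_equal. }
      specialize (H1 r). nra.
    - assert (0 < ln x). { rewrite <- ln_1. now apply ln_increasing; lra. }
      specialize (H2 r). nra. }
  destruct H. left; now apply exp_increasing. right; now f_equal.
Qed.

(** The absolute value in the constant lets one statement serve increasing and decreasing powers. *)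
Lemma Rpower_doubling a t t' : 0 < t -> t <= t' <= 2 * t -> Rpower t' a <= Rpower 2 (Rabs a) * Rpower t a.
Proof.
  intros Ht Ht'. unfold Rpower. rewrite <- exp_plus.
  assert (a * ln t' <= Rabs a * ln 2 + a * ln t).
  { assert (ln t <= ln t') by (destruct (proj1 Ht'); [left; now apply ln_increasing|right; now f_equal]).
    assert (ln t' <= ln 2 + ln t).
    { rewrite <- ln_mult by lra. destruct (proj2 Ht'). left; apply ln_increasing; lra. right; now f_equal. }
    unfold Rabs; destruct Rcase_abs; nra. }
  destruct H. left; now apply exp_increasing. right; now f_equal.
Qed.

Section Symbols.

Context {P : Type}.
Implicit Types (dom : P -> Prop) (W : P -> R -> R) (g : P -> R -> C).

(** The parameter is a natural number in the treatment of zeta, where it indexes Taylor coefficients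
    in s, and the complex number a of the sector in the asymptotic expansion. *)
Definition dominated dom W g : Prop :=
  exists c, 0 <= c /\ forall p t, dom p -> 0 < t -> Cmod (g p t) <= c * W p t.

(* Order-[N] symbol estimates: [g] and its first [N] derivatives under [t d/dt]
   are dominated by the weight [W], uniformly in the parameter. *)
Fixpoint Sym dom W (N : nat) g : Prop :=
  dominated dom W g /\
  match N with
  | O => True
  | S M => exists g', (forall p t, dom p -> 0 < t -> Cder (g p) t (RtoC (/ t) * g' p t)%C)
                      /\ Sym dom W M g'
  end.

Lemma Sym_bound dom W N g : Sym dom W N g ->
  dominated dom W g.
Proof. destruct N; simpl; tauto. Qed.

Lemma Sym_S dom W N g g' :
  dominated dom W g ->
  (forall p t, dom p -> 0 < t -> Cder (g p) t (RtoC (/ t) * g' p t)%C) ->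
  Sym dom W N g' -> Sym dom W (S N) g.
Proof. intros H1 H2 H3. split; auto. now exists g'. Qed.

Lemma Sym_0 dom W g :
  dominated dom W g -> Sym dom W 0 g.
Proof. split; auto. Qed.

Lemma Sym_pred dom W N g : Sym dom W (S N) g -> Sym dom W N g.
Proof.
  revert g; induction N; intros g [H1 [g' [H2 H3]]].
  - split; auto.
  - split; auto. exists g'; split; auto.
Qed.

Lemma Sym_le_order dom W M N g : (M <= N)%nat -> Sym dom W N g -> Sym dom W M g.
Proof. intros H; induction H; auto. intros. apply IHle. now apply Sym_pred. Qed.

Lemma Sym_ext dom W N g h :
  (forall p t, dom p -> 0 < t -> g p t = h p t) -> Sym dom W N g -> Sym dom W N h.
Proof.
  intros E H.
  assert (B : dominated dom W h).
  { destruct (Sym_bound _ _ _ _ H) as [c [H0 H1]]. exists c; split; auto.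
    intros. rewrite <- E; auto. }
  destruct N; [now split|]. destruct H as [_ [g' [H2 H3]]].
  apply Sym_S with g'; auto.
  intros p t Hp Ht. apply Cder_ext_pos with (g p); auto.
Qed.

Lemma Sym_weight dom W W' c N g : 0 <= c ->
  (forall p t, dom p -> 0 < t -> W p t <= c * W' p t) -> Sym dom W N g -> Sym dom W' N g.
Proof.
  intros Hc HW. revert g.
  assert (B : forall g, dominated dom W g ->
    (dominated dom W' g)).
  { intros g [d [Hd H]]. exists (d * c). split. nra. intros.
    eapply Rle_trans; [apply H; auto|]. rewrite Rmult_assoc.
    apply Rmult_le_compat_l; auto. }
  induction N; intros g [H1 H2]; split; auto.
  destruct H2 as [g' [H2 H3]]. exists g'; auto.
Qed.

Lemma Sym_plus dom W N g h : Sym dom W N g -> Sym dom W N h ->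
  Sym dom W N (fun p t => g p t + h p t)%C.
Proof.
  assert (B : forall g h, dominated dom W g ->
    dominated dom W h ->
    (dominated dom W (fun p t => g p t + h p t)%C)).
  { intros g0 h0 [c [Hc H]] [d [Hd H']]. exists (c + d). split. lra. intros.
    eapply Rle_trans; [apply Cmod_triangle|].
    generalize (H p t H0 H1) (H' p t H0 H1). lra. }
  revert g h; induction N; intros g h [H1 H2] [H3 H4]; split; auto.
  destruct H2 as [g' [H2 H2']], H4 as [h' [H4 H4']].
  exists (fun p t => g' p t + h' p t)%C; split; auto.
  intros. eapply Cder_eq. apply Cder_plus; auto. ring.
Qed.

Lemma Sym_scal dom W N (k : C) g : Sym dom W N g -> Sym dom W N (fun p t => k * g p t)%C.
Proof.
  assert (B : forall g, dominated dom W g ->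
    (dominated dom W (fun p t => k * g p t)%C)).
  { intros g0 [c [Hc H]]. exists (Cmod k * c). split. apply Rmult_le_pos; auto. apply Cmod_ge_0.
    intros. rewrite Cmod_mult, Rmult_assoc. apply Rmult_le_compat_l; auto. apply Cmod_ge_0. }
  revert g; induction N; intros g [H1 H2]; split; auto.
  destruct H2 as [g' [H2 H2']].
  exists (fun p t => k * g' p t)%C; split; auto.
  intros. eapply Cder_eq. apply Cder_scal; auto. ring.
Qed.

Lemma Sym_opp dom W N g : Sym dom W N g -> Sym dom W N (fun p t => - g p t)%C.
Proof.
  intros H. apply Sym_ext with (fun p t => RtoC (-1) * g p t)%C. 2: now apply Sym_scal.
  intros. rewrite RtoC_m1. ring.
Qed.

Lemma Sym_minus dom W N g h : Sym dom W N g -> Sym dom W N h ->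
  Sym dom W N (fun p t => g p t - h p t)%C.
Proof. intros. apply Sym_plus; auto. now apply Sym_opp. Qed.

Lemma Sym_zero dom W N : (forall p t, dom p -> 0 < t -> 0 <= W p t) -> Sym dom W N (fun _ _ => RtoC 0).
Proof.
  intros HW. assert (B : dominated dom W (fun _ _ => RtoC 0)).
  { exists 0. split. lra. intros. rewrite Cmod_0. lra. }
  induction N; split; auto. exists (fun _ _ => RtoC 0). split; auto.
  intros. eapply Cder_eq. apply Cder_const. ring.
Qed.

(** The operator t d/dt is a derivation: by the product rule one order is spent on one factor, while
    the other factor is used at the lower order. *)
Lemma Sym_mult dom W1 W2 W3 c N g h : 0 <= c ->
  (forall p t, dom p -> 0 < t -> 0 <= W1 p t) ->
  (forall p t, dom p -> 0 < t -> W1 p t * W2 p t <= c * W3 p t) ->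
  Sym dom W1 N g -> Sym dom W2 N h -> Sym dom W3 N (fun p t => g p t * h p t)%C.
Proof.
  intros Hc HW1 HW.
  assert (B : forall g h, dominated dom W1 g ->
    dominated dom W2 h ->
    (dominated dom W3 (fun p t => g p t * h p t)%C)).
  { intros g0 h0 [c1 [Hc1 H]] [c2 [Hc2 H']]. exists (c1 * c2 * c).
    split. apply Rmult_le_pos; nra. intros p t Hp Ht.
    rewrite Cmod_mult. generalize (H p t Hp Ht) (H' p t Hp Ht) (HW p t Hp Ht) (HW1 p t Hp Ht)
     (Cmod_ge_0 (g0 p t)) (Cmod_ge_0 (h0 p t)). intros.
    apply Rle_trans with ((c1 * W1 p t) * (c2 * W2 p t)).
    apply Rmult_le_compat; auto.
    replace (c1 * W1 p t * (c2 * W2 p t)) with (c1 * c2 * (W1 p t * W2 p t)) by ring.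
    rewrite (Rmult_assoc (c1 * c2)). apply Rmult_le_compat_l; auto. nra. }
  revert g h; induction N; intros g h Hg Hh.
  - destruct Hg, Hh; split; auto.
  - assert (Hg' := Sym_pred _ _ _ _ Hg). assert (Hh' := Sym_pred _ _ _ _ Hh).
    destruct Hg as [H1 [g' [H2 H2']]], Hh as [H3 [h' [H4 H4']]].
    apply Sym_S with (fun p t => g' p t * h p t + g p t * h' p t)%C; auto.
    + intros. eapply Cder_eq. apply Cder_mult; auto. ring.
    + apply Sym_plus; auto.
Qed.

End Symbols.

(** * Finite differences of symbols *)

Definition Dl (g : R -> C) (t : R) : C := (g t - g (t + 1)%R)%C.

(** The innermost difference is taken first, which is the recursion of the Euler transformation
    below; [Dn_S] supplies the outer one. *)
Fixpoint Dn (N : nat) (g : R -> C) : R -> C :=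
  match N with O => g | S M => Dn M (Dl g) end.

Lemma Dn_ext N g h : (forall t, 0 < t -> g t = h t) -> forall t, 0 < t -> Dn N g t = Dn N h t.
Proof.
  revert g h; induction N; intros g h E t Ht; simpl; auto.
  apply IHN; auto. intros u Hu. unfold Dl. rewrite !E; auto; lra.
Qed.

Lemma Dn_S N g t : Dn (S N) g t = (Dn N g t - Dn N g (t + 1)%R)%C.
Proof.
  revert g t; induction N; intros g t; auto.
  change (Dn (S (S N)) g t) with (Dn (S N) (Dl g) t). rewrite IHN. reflexivity.
Qed.

Lemma Cder_Dn N g g' : (forall t, 0 < t -> Cder g t (g' t)) ->
  forall t, 0 < t -> Cder (Dn N g) t (Dn N g' t).
Proof.
  revert g g'; induction N; intros g g' H t Ht; simpl; auto.
  apply IHN; auto. intros u Hu. unfold Dl. apply Cder_minus; auto.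
  apply Cder_shift. apply H. lra.
Qed.

(** Each difference gains a factor 1/t. A difference over [t, t+1] is bounded by the derivative
    there, and for a symbol that derivative is 1/t times a symbol of one order less; the weight
    changes only by the factor [cd] on such an interval. *)
Lemma Sym_diff {P} (dom : P -> Prop) (W : P -> R -> R) cd : 0 <= cd ->
  (forall p t, dom p -> 0 < t -> 0 <= W p t) ->
  (forall p t t', dom p -> 1 <= t -> t <= t' <= t + 1 -> W p t' <= cd * W p t) ->
  forall N s g, Sym dom W N g ->
  exists c, 0 <= c /\ forall p t, dom p -> 1 <= t ->
    Cmod (Dn N (fun u => RtoC (Rpower u (- s)) * g p u)%C t) <= c * W p t * Rpower t (- s - INR N).
Proof.
  intros Hcd HW Hd. induction N; intros s g Hg.
  - destruct Hg as [[c [Hc H]] _]. exists c; split; auto. intros p t Hp Ht. simpl.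
    rewrite Cmod_mult, Cmod_RtoC_pos by (left; apply Rpower_pos).
    rewrite Rminus_0_r, Rmult_comm. apply Rmult_le_compat_r. left; apply Rpower_pos.
    apply H; auto; lra.
  - assert (Hg0 := Sym_pred _ _ _ _ Hg). destruct Hg as [_ [g' [Hder Hg']]].
    (* The derivative of u^(-s) g is u^(-s-1) (g' - s g): again of the form treated, with exponent s
       + 1. *)
    set (h := fun p t => (g' p t - RtoC s * g p t)%C).
    destruct (IHN (s + 1) h) as [c [Hc H]].
    { apply Sym_minus; auto. now apply Sym_scal. }
    set (e := - (s + 1) - INR N).
    exists (c * cd * Rpower 2 (Rabs e)). split.
    { apply Rmult_le_pos. nra. left; apply Rpower_pos. }
    intros p t Hp Ht. rewrite Dn_S, Cmod_minus_sym.
    replace (- s - INR (S N)) with e by (unfold e; rewrite S_INR; ring).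
    eapply Rle_trans. eapply Cder_bounded_diff with (f' := Dn N (fun u => RtoC (Rpower u (- (s + 1))) * h p u)%C)
      (M := c * cd * Rpower 2 (Rabs e) * W p t * Rpower t e).
    + lra.
    + intros u Hu. apply Cder_Dn; [|lra]. intros v Hv.
      eapply Cder_eq. apply Cder_mult. apply Cder_RtoC. now apply is_derive_Rpower. now apply Hder.
      unfold h. replace (- (s + 1)) with (- s + - (1)) by ring.
      rewrite Rpower_plus, (Rpower_Ropp v 1), Rpower_1, !RtoC_mult, RtoC_opp by auto. ring.
    + intros u Hu. eapply Rle_trans. apply H; auto; lra. fold e.
      generalize (Hd p t u Hp Ht Hu) (Rpower_doubling e t u ltac:(lra) ltac:(lra)) (HW p u Hp ltac:(lra))
        (Rpower_pos u e) (HW p t Hp ltac:(lra)). intros A1 A2 A3 A4 A5.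
      replace (c * cd * Rpower 2 (Rabs e) * W p t * Rpower t e) with
        (c * ((cd * W p t) * (Rpower 2 (Rabs e) * Rpower t e))) by ring.
      rewrite Rmult_assoc. apply Rmult_le_compat_l; auto. apply Rmult_le_compat; auto. lra.
    + right. ring.
Qed.

(** * Series and Euler transformation of alternating sums *)

(** Pins C as a normed module over itself, so that all statements on convergence share one
    instance. *)
Definition Cseries (f : nat -> C) (l : C) : Prop := @is_series C_AbsRing C_NormedModule f l.

Lemma Cseries_ext f g l : (forall n, f n = g n) -> Cseries f l -> Cseries g l.
Proof. intros H. apply is_series_ext. exact H. Qed.

Lemma Cseries_unique f l l' : Cseries f l -> Cseries f l' -> l = l'.
Proof.
  intros H H'. exact (filterlim_locally_unique (sum_n (f : nat -> C_NormedModule)) l l' H H').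
Qed.

Lemma Cseries_plus f g l l' : Cseries f l -> Cseries g l' -> Cseries (fun n => f n + g n)%C (l + l')%C.
Proof. intros H H'. exact (is_series_plus (V := C_NormedModule) f g l l' H H'). Qed.

Lemma Cseries_scal k f l : Cseries f l -> Cseries (fun n => k * f n)%C (k * l)%C.
Proof. intros H. exact (is_series_scal (V := C_NormedModule) k f l H). Qed.

Lemma Cseries_opp f l : Cseries f l -> Cseries (fun n => - f n)%C (- l)%C.
Proof. intros H. exact (is_series_opp (V := C_NormedModule) f l H). Qed.

Lemma Cseries_minus f g l l' : Cseries f l -> Cseries g l' -> Cseries (fun n => f n - g n)%C (l - l')%C.
Proof. intros. apply Cseries_plus; auto. now apply Cseries_opp. Qed.

Lemma Cseries_tail f l : Cseries f l -> Cseries (fun n => f (S n)) (l - f 0%nat)%C.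
Proof.
  intros H. apply (is_series_incr_1 (V := C_NormedModule) f).
  change (Cseries f ((l - f 0%nat) + f 0%nat)%C).
  now replace ((l - f 0%nat) + f 0%nat)%C with l by ring.
Qed.

Lemma Cseries_cons f l : Cseries (fun n => f (S n)) (l - f 0%nat)%C -> Cseries f l.
Proof. intros H. exact (is_series_decr_1 (V := C_NormedModule) f l H). Qed.

Lemma Csum_Cmod_le (f : nat -> C) n : Cmod (sum_n f n) <= sum_n (fun k => Cmod (f k)) n.
Proof.
  induction n.
  - rewrite Csum_O, sum_O. lra.
  - rewrite Csum_Sn, sum_Sn. eapply Rle_trans; [apply Cmod_triangle|].
    change plus with Rplus. lra.
Qed.

Lemma sum_n_le_R (u v : nat -> R) n : (forall k, u k <= v k) -> sum_n u n <= sum_n v n.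
Proof. intros H. apply sum_n_m_le. exact H. Qed.

Lemma sum_n_le_series (u : nat -> R) l n : (forall k, 0 <= u k) -> is_series u l -> sum_n u n <= l.
Proof.
  intros Hu H.
  assert (Hl : is_lim_seq (sum_n u) l) by exact H.
  refine (is_lim_seq_incr_compare (sum_n u) l Hl _ n).
  intros k. rewrite sum_Sn. change plus with Rplus. specialize (Hu (S k)). lra.
Qed.

Lemma Cseries_lim_Cmod f l : Cseries f l -> is_lim_seq (fun n => Cmod (sum_n f n)) (Cmod l).
Proof.
  intros H.
  apply is_lim_seq_ext with (fun n => @norm C_AbsRing C_NormedModule (sum_n f n)).
  reflexivity.
  eapply filterlim_comp. exact H.
  exact (@filterlim_norm C_AbsRing C_NormedModule l).
Qed.

Lemma Cseries_Cmod_le f (u : nat -> R) l s :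
  Cseries f l -> is_series u s -> (forall n, Cmod (f n) <= u n) -> Cmod l <= s.
Proof.
  intros H Hs Hle.
  assert (Hu : forall k, 0 <= u k) by (intros; eapply Rle_trans; [apply Cmod_ge_0|apply Hle]).
  apply (is_lim_seq_le (fun n => Cmod (sum_n f n)) (fun _ => s) (Cmod l) s).
  - intros n. eapply Rle_trans; [apply Csum_Cmod_le|].
    eapply Rle_trans; [apply sum_n_le_R; apply Hle|]. now apply sum_n_le_series.
  - now apply Cseries_lim_Cmod.
  - apply is_lim_seq_const.
Qed.

Lemma Cseries_abs f (u : nat -> R) s :
  is_series u s -> (forall n, Cmod (f n) <= u n) -> exists l, Cseries f l /\ Cmod l <= s.
Proof.
  intros Hs Hle.
  destruct (@ex_series_le C_AbsRing C_CompleteNormedModule f u) as [l Hl].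
  - intros n. exact (Hle n).
  - now exists s.
  - exists l. split. exact Hl. eapply Cseries_Cmod_le; eauto.
Qed.

(** For a power series converging at one point this gives Abel's geometric majorant at smaller
    radii. *)
Lemma Cseries_term_bounded f l : Cseries f l -> exists M, forall n, Cmod (f n) <= M.
Proof.
  intros H. assert (H1 := Cseries_lim_Cmod f l H).
  destruct (filterlim_bounded (V := R_NormedModule) (fun n => Cmod (sum_n f n))) as [M HM].
  { exists (Cmod l). exact H1. }
  exists (M + M). intros n.
  assert (forall k, Cmod (sum_n f k) <= M).
  { intros k. eapply Rle_trans. 2: apply (HM k). apply Rle_abs. }
  destruct n.
  - generalize (H0 0%nat). rewrite Csum_O. generalize (Cmod_ge_0 (f 0%nat)). lra.
  - replace (f (S n)) with (sum_n f (S n) - sum_n f n)%C by (rewrite Csum_Sn; ring).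
    eapply Rle_trans; [apply Cmod_minus_le|]. generalize (H0 n) (H0 (S n)). lra.
Qed.

Lemma is_lim_seq_Cseries f l : is_lim_seq (fun n => Cmod (sum_n f n - l)%C) 0 -> Cseries f l.
Proof.
  intros H. unfold Cseries, is_series.
  apply (filterlim_locally_ball_norm (K := C_AbsRing) (U := C_NormedModule)).
  intros eps. apply is_lim_seq_spec in H. destruct (H eps) as [N HN].
  exists N. intros n Hn. specialize (HN n Hn).
  unfold ball_norm.
  change (Cmod (sum_n f n - l)%C < eps).
  rewrite Rminus_0_r in HN. eapply Rle_lt_trans; [apply Rle_abs|]. exact HN.
Qed.

Lemma Cseries_is_lim_seq f l : Cseries f l -> is_lim_seq (fun n => Cmod (sum_n f n - l)%C) 0.
Proof.
  intros H. unfold Cseries, is_series in H.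
  apply is_lim_seq_spec. intros eps.
  destruct (proj1 (filterlim_locally_ball_norm (K := C_AbsRing) (U := C_NormedModule) (sum_n (f : nat -> C_NormedModule)) l) H eps) as [N HN]. exists N. intros n Hn. specialize (HN n Hn).
  unfold ball_norm in HN.
  rewrite Rminus_0_r, Rabs_pos_eq by apply Cmod_ge_0. exact HN.
Qed.

(** A majorant with sum exactly 1, so one constant bounds both the terms and the sum. It decays like
    (m+1)^(-2), whence the recurring requirement that exponents be at most -2. *)
Definition telescoping_weight (m : nat) : R := / ((INR m + 1) * (INR m + 2)).

Lemma telescoping_weight_pos m : 0 < telescoping_weight m.
Proof.
  apply Rinv_0_lt_compat. generalize (pos_INR m). nra.
Qed.

Lemma telescoping_series : is_series telescoping_weight 1.
Proof.
  assert (E : forall n, 1 - / INR (n + 2) = sum_n telescoping_weight n).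
  { induction n.
    - rewrite sum_O. unfold telescoping_weight. simpl. lra.
    - rewrite sum_Sn, <- IHn. change plus with Rplus. unfold telescoping_weight.
      rewrite !plus_INR, S_INR. simpl (INR 2). generalize (pos_INR n); intros. field. repeat split; lra. }
  change (is_lim_seq (sum_n telescoping_weight) 1).
  apply is_lim_seq_ext with (fun n => 1 - / INR (n + 2)). intros; now rewrite E.
  evar_last. apply is_lim_seq_minus'. apply is_lim_seq_const.
  apply (is_lim_seq_incr_n (fun n => / INR n) 2).
  apply is_lim_seq_inv with (l := p_infty). apply is_lim_seq_INR. discriminate.
  simpl. f_equal. ring.
Qed.

Lemma Rpower_le_telescoping e m : e <= -2 -> Rpower (INR m + 1) e <= 2 * telescoping_weight m.
Proof.
  intros He. assert (Hm := pos_INR m).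
  eapply Rle_trans. apply Rle_Rpower with (m := - 2); lra.
  replace (-2) with (- INR 2) by (simpl; ring).
  rewrite Rpower_Ropp, Rpower_pow by lra. unfold telescoping_weight.
  apply Rmult_le_reg_l with ((INR m + 1) ^ 2 * (INR m + 2)).
  apply Rmult_lt_0_compat. apply pow_lt; lra. lra.
  replace ((INR m + 1) ^ 2 * (INR m + 2) * / (INR m + 1) ^ 2) with (INR m + 2) by (field; lra).
  replace ((INR m + 1) ^ 2 * (INR m + 2) * (2 * / ((INR m + 1) * (INR m + 2)))) with (2 * (INR m + 1)) by (field; lra).
  lra.
Qed.

(** * Euler-transformed alternating sums *)

Definition alt_sign (m : nat) : C := RtoC ((-1) ^ m).

Lemma Cmod_alt_sign m : Cmod (alt_sign m) = 1.
Proof. unfold alt_sign. rewrite Cmod_R. apply pow_1_abs. Qed.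

(* Regularised value of [g 1 - g 2 + g 3 - ...] by [N] Euler transformations. *)
Fixpoint AltSum (N : nat) (g : R -> C) (l : C) : Prop :=
  match N with
  | O => Cseries (fun m => alt_sign m * g (INR m + 1)%R)%C l
  | S M => exists l', AltSum M (Dl g) l' /\ l = (RtoC (/ 2) * (g 1%R + l'))%C
  end.

Lemma AltSum_ext N g h l : (forall t, 0 < t -> g t = h t) -> AltSum N g l -> AltSum N h l.
Proof.
  revert g h l; induction N; intros g h l E H.
  - eapply Cseries_ext; [|exact H]. intros n. cbv beta. rewrite E; auto. generalize (pos_INR n). lra.
  - destruct H as [l' [H ->]]. exists l'; split.
    + eapply IHN; [|apply H]. intros. unfold Dl. rewrite !E; auto; lra.
    + rewrite E; auto; lra.
Qed.

Lemma AltSum_unique N g l l' : AltSum N g l -> AltSum N g l' -> l = l'.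
Proof.
  revert g l l'; induction N; intros g l l' H H'.
  - eapply Cseries_unique; eauto.
  - destruct H as [k [H ->]], H' as [k' [H' ->]]. now rewrite (IHN _ _ _ H H').
Qed.

Lemma AltSum_plus N g h l l' : AltSum N g l -> AltSum N h l' -> AltSum N (fun t => g t + h t)%C (l + l')%C.
Proof.
  revert g h l l'; induction N; intros g h l l' H H'.
  - eapply Cseries_ext; [|apply (Cseries_plus _ _ _ _ H H')]. intros; cbv beta; ring.
  - destruct H as [k [H ->]], H' as [k' [H' ->]]. exists (k + k')%C; split.
    eapply AltSum_ext; [|apply (IHN _ _ _ _ H H')]. intros; unfold Dl; ring. ring.
Qed.

Lemma AltSum_scal N c g l : AltSum N g l -> AltSum N (fun t => c * g t)%C (c * l)%C.
Proof.
  revert g l; induction N; intros g l H.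
  - eapply Cseries_ext; [|apply (Cseries_scal c _ _ H)]. intros; cbv beta; ring.
  - destruct H as [k [H ->]]. exists (c * k)%C; split.
    eapply AltSum_ext; [|apply (IHN _ _ H)]. intros; unfold Dl; ring. ring.
Qed.

(** Regularity of the transformation: a value reached with N steps is also the value with more
    steps. This lets sums that converge outright be compared with sums that need many steps. *)
Lemma AltSum_succ N g l : AltSum N g l -> AltSum (S N) g l.
Proof.
  revert g l; induction N; intros g l H.
  - exists (RtoC 2 * l - g 1%R)%C. split.
    + simpl in *. eapply Cseries_ext.
      (* The second summand l - g 1 is the value of the tail - g 2 + g 3 - ...; added to the
         original series term by term, it produces the alternating series of the differences. *)
      2: { replace (2 * l - g 1%R)%C with (l + (l - g 1%R))%C by ring.
        apply Cseries_plus. apply H. apply Cseries_tail in H. 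
        eapply Cseries_ext. 2: { replace (g 1%R) with (alt_sign 0 * g (INR 0 + 1)%R)%C. apply H.
          unfold alt_sign; simpl. rewrite Rplus_0_l. ring. }
        intros n. cbv beta. reflexivity. }
      intros n. unfold Dl. rewrite S_INR. unfold alt_sign. simpl pow. rewrite RtoC_mult.
      rewrite RtoC_m1. ring.
    + rewrite RtoC_inv by lra. field.
  - destruct H as [k [H ->]]. exists k; split; auto.
Qed.

Lemma AltSum_of_series N g l : AltSum 0 g l -> AltSum N g l.
Proof. intros H; induction N; auto. now apply AltSum_succ. Qed.

(** Each step takes the mean of a boundary value at 1 and the next transformed sum, so the bound X
    passes through all steps unchanged; only the last series has to converge absolutely. *)
Lemma AltSum_bound N g X :
  (forall j, (j < N)%nat -> Cmod (Dn j g 1) <= X) ->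
  (forall m, Cmod (Dn N g (INR m + 1)) <= X * telescoping_weight m) ->
  exists l, AltSum N g l /\ Cmod l <= X.
Proof.
  revert g; induction N; intros g H1 H2.
  - destruct (Cseries_abs (fun m => alt_sign m * g (INR m + 1)%R)%C (fun m => X * telescoping_weight m) X) as [l [Hl Hl']].
    + generalize (is_series_scal X _ _ telescoping_series). unfold scal; simpl; unfold mult; simpl.
      now rewrite Rmult_1_r.
    + intros n. rewrite Cmod_mult, Cmod_alt_sign, Rmult_1_l. apply H2.
    + now exists l.
  - destruct (IHN (Dl g)) as [l [Hl Hl']].
    + intros j Hj. apply (H1 (S j)). lia.
    + apply H2.
    + exists (RtoC (/ 2) * (g 1%R + l))%C. split. now exists l.
      rewrite Cmod_mult, Cmod_RtoC_pos by lra.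
      assert (Cmod (g 1) <= X) by (apply (H1 0%nat); lia).
      generalize (Cmod_triangle (g 1) l). lra.
Qed.

(** N differences turn growth of order t^(B - s) into t^(B - s - N), which is summable under the
    stated condition. The factor [w] isolates the dependence on the parameter, and the transformed
    sum inherits exactly this factor. *)
Lemma Sym_AltSum {P} (dom : P -> Prop) (W : P -> R -> R) cd (w : P -> R) B : 0 <= cd ->
  (forall p t, dom p -> 0 < t -> 0 <= W p t) ->
  (forall p t t', dom p -> 1 <= t -> t <= t' <= t + 1 -> W p t' <= cd * W p t) ->
  (forall p, dom p -> 0 <= w p) ->
  (forall p t, dom p -> 1 <= t -> W p t <= w p * Rpower t B) ->
  forall N s g, B - s - INR N <= -2 -> Sym dom W N g ->
  exists c, 0 <= c /\ forall p, dom p ->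
    exists l, AltSum N (fun u => RtoC (Rpower u (- s)) * g p u)%C l /\ Cmod l <= c * w p.
Proof.
  intros Hcd HW Hd Hw Hww N s g HN Hg.
  (* Only finitely many orders j occur, so their constants are added into a single one. *)
  assert (HD : forall M, (M <= N)%nat -> exists c, 0 <= c /\ forall j, (j <= M)%nat -> forall p t, dom p -> 1 <= t ->
    Cmod (Dn j (fun u => RtoC (Rpower u (- s)) * g p u)%C t) <= c * (w p * Rpower t (B - s - INR j))).
  { assert (HD1 : forall j, (j <= N)%nat -> exists c, 0 <= c /\ forall p t, dom p -> 1 <= t ->
    Cmod (Dn j (fun u => RtoC (Rpower u (- s)) * g p u)%C t) <= c * (w p * Rpower t (B - s - INR j))).
    { intros j Hj. destruct (Sym_diff dom W cd Hcd HW Hd j s g) as [c [Hc H]].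
      now apply Sym_le_order with N.
      exists c; split; auto. intros p t Hp Ht. eapply Rle_trans; [apply H; auto|].
      rewrite Rmult_assoc. apply Rmult_le_compat_l; auto.
      replace (B - s - INR j) with (B + (- s - INR j)) by ring. rewrite Rpower_plus, <- Rmult_assoc.
      apply Rmult_le_compat_r. left; apply Rpower_pos. auto. }
    induction M; intros HM.
    - destruct (HD1 0%nat HM) as [c [Hc H]]. exists c; split; auto. intros j Hj. replace j with 0%nat by lia. auto.
    - destruct (HD1 (S M) HM) as [c [Hc H]]. destruct IHM as [c' [Hc' H']]. lia.
      exists (c + c'). split. lra. intros j Hj p t Hp Ht.
      assert (0 <= w p * Rpower t (B - s - INR j)).
      { apply Rmult_le_pos; auto. left; apply Rpower_pos. }
      destruct (Nat.eq_dec j (S M)) as [->|].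
      + generalize (H p t Hp Ht). nra.
      + generalize (H' j ltac:(lia) p t Hp Ht). nra. }
  destruct (HD N (Nat.le_refl N)) as [c [Hc H]].
  exists (2 * c). split. lra. intros p Hp.
  apply AltSum_bound.
  - intros j Hj. eapply Rle_trans; [apply H; auto; [lia|lra]|].
    rewrite Rpower_1_l. specialize (Hw p Hp). nra.
  - intros m. assert (Hm := pos_INR m). eapply Rle_trans; [apply H; auto; lra|].
    assert (HT := Rpower_le_telescoping (B - s - INR N) m HN).
    specialize (Hw p Hp).
    replace (2 * c * w p * telescoping_weight m) with (c * (w p * (2 * telescoping_weight m))) by ring.
    apply Rmult_le_compat_l; auto. apply Rmult_le_compat_l; auto.
Qed.

(** * Power series *)

(** Equalities coming from the lemmas on sums are typed in a canonical structure; [ring] needs the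
    carrier restored. *)
Ltac Cring := match goal with |- @eq _ ?a ?b => change (@eq C a b) end; ring.
Ltac Rring := match goal with |- @eq _ ?a ?b => change (@eq R a b) end; ring.

Lemma Csum_shift (f : nat -> C) n : sum_n f (S n) = (f 0%nat + sum_n (fun k => f (S k)) n)%C.
Proof.
  induction n.
  - rewrite Csum_Sn, !Csum_O. reflexivity.
  - rewrite Csum_Sn, IHn, Csum_Sn. Cring.
Qed.

Lemma Csum_scal (c : C) (f : nat -> C) n : sum_n (fun k => c * f k)%C n = (c * sum_n f n)%C.
Proof.
  induction n. now rewrite !Csum_O. rewrite !Csum_Sn, IHn. Cring.
Qed.

Lemma Rsum_shift (f : nat -> R) n : f 0%nat + sum_n (fun k => f (S k)) n = sum_n f (S n).
Proof.
  induction n.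
  - rewrite sum_Sn, !sum_O. reflexivity.
  - rewrite (sum_Sn f), <- IHn, sum_Sn. change plus with Rplus. Rring.
Qed.

Lemma Rseries_scal (c : R) (u : nat -> R) (U : R) : is_series u U -> is_series (fun n => c * u n) (c * U).
Proof. intros H. exact (is_series_scal c u U H). Qed.

Lemma Rseries_tail (v : nat -> R) V : is_series v V -> is_series (fun k => v (S k)) (V - v 0%nat).
Proof.
  intros H. apply is_series_incr_1. assert (E : V - v 0%nat + v 0%nat = V) by ring.
  change (is_series v (V - v 0%nat + v 0%nat)). now rewrite E.
Qed.

Lemma Cseries_remainder_le (f : nat -> C) (v : nat -> R) (l : C) (V : R) n : Cseries f l -> is_series v V -> (forall k, Cmod (f k) <= v k) ->
  Cmod (l - sum_n f n)%C <= V - sum_n v n.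
Proof.
  revert f v l V; induction n; intros f v l V Hf Hv H.
  - rewrite Csum_O, sum_O. apply Cseries_Cmod_le with (fun k => f (S k)) (fun k => v (S k)).
    now apply Cseries_tail. now apply Rseries_tail. auto.
  - rewrite Csum_shift, <- Rsum_shift.
    generalize (IHn _ _ _ _ (Cseries_tail _ _ Hf) (Rseries_tail _ _ Hv) (fun k => H (S k))).
    intros HH. eapply Rle_trans; [|eapply Rle_trans; [apply HH|]].
    right; apply f_equal. set (s := sum_n _ n). clearbody s. change C in s. ring.
    right; Rring.
Qed.

(** The majorant in product form bounds the tail of row m by u m times a tail of v, uniformly in m;
    summing over the rows leaves U times that tail, which tends to 0. *)
Lemma Cseries_swap (a : nat -> nat -> C) (u v : nat -> R) (U V : R) (A l : nat -> C) :
  is_series u U -> is_series v V ->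
  (forall m k, Cmod (a m k) <= u m * v k) ->
  (forall m, Cseries (a m) (A m)) -> (forall k, Cseries (fun m => a m k) (l k)) ->
  (forall m, 0 <= u m) ->
  exists L, Cseries A L /\ Cseries l L.
Proof.
  intros Hu Hv Hle HA Hl Hu0.
  assert (HA' : forall m, Cmod (A m) <= V * u m).
  { intros m. rewrite Rmult_comm. apply Cseries_Cmod_le with (a m) (fun k => u m * v k); auto.
    now apply (Rseries_scal (u m) v V). }
  destruct (Cseries_abs A (fun m => V * u m) (V * U)) as [L [HL _]]; auto.
  { now apply (Rseries_scal V u U). }
  exists L; split; auto.
  apply is_lim_seq_Cseries.
  assert (Hpart : forall n, Cseries (fun m => sum_n (a m) n) (sum_n l n)).
  { induction n.
    - eapply Cseries_ext; [|rewrite Csum_O; apply (Hl 0%nat)]. intros; now rewrite Csum_O.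
    - eapply Cseries_ext; [|rewrite Csum_Sn; apply Cseries_plus; [apply IHn|apply (Hl (S n))]].
      intros; now rewrite Csum_Sn. }
  apply is_lim_seq_le_le with (fun _ => 0) (fun n => U * (V - sum_n v n)).
  - intros n. split. apply Cmod_ge_0. rewrite Cmod_minus_sym.
    apply Cseries_Cmod_le with (fun m => A m - sum_n (a m) n)%C (fun m => (V - sum_n v n) * u m).
    + apply Cseries_minus; auto.
    + rewrite Rmult_comm. now apply (Rseries_scal (V - sum_n v n) u U).
    + intros m. generalize (Cseries_remainder_le (a m) (fun k => u m * v k) (A m) (u m * V) n (HA m)
        (Rseries_scal (u m) v V Hv) (Hle m)).
      intros HH. eapply Rle_trans; [apply HH|]. right.
      assert (u m * sum_n v n = sum_n (fun k => u m * v k) n) as <-.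
      { clear. induction n. now rewrite !sum_O. rewrite !sum_Sn, <- IHn. change plus with Rplus. Rring. }
      ring.
  - apply is_lim_seq_const.
  - evar_last. apply is_lim_seq_mult'. apply is_lim_seq_const.
    apply is_lim_seq_minus'. apply is_lim_seq_const. apply Hv. f_equal. ring.
Qed.

Lemma Cexp_series w : Cseries (fun k => RtoC (/ INR (fact k)) * w ^ k)%C (Cexp w).
Proof.
  apply is_lim_seq_Cseries.
  apply is_lim_seq_le_le with (fun _ => 0) (fun n => exp (Cmod w) * (Cmod w ^ S n / INR (fact (S n)))).
  - intros n. split. apply Cmod_ge_0. rewrite Cmod_minus_sym.
    eapply Rle_trans. apply (Cexp_partial_bound w n). right. unfold Rdiv. ring.
  - apply is_lim_seq_const.
  - evar_last. apply is_lim_seq_mult'. apply is_lim_seq_const.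
    apply (is_lim_seq_incr_1 (fun n => Cmod w ^ n / INR (fact n))).
    apply is_lim_seq_Reals. apply cv_speed_pow_fact. f_equal. ring.
Qed.

Lemma Cseries_zero : Cseries (fun _ => RtoC 0) 0.
Proof.
  destruct (Cseries_abs (fun _ => RtoC 0) telescoping_weight 1 telescoping_series) as [l [H _]].
  - intros. rewrite Cmod_0. left; apply telescoping_weight_pos.
  - apply (Cseries_scal 0) in H. replace (0 * l)%C with (RtoC 0) in H by ring. eapply Cseries_ext; [|apply H].
    intros; cbv beta; ring.
Qed.

Lemma Cseries_finite (f : nat -> C) k : Cseries (fun m => if Nat.leb m k then f m else RtoC 0) (sum_n f k).
Proof.
  revert f; induction k; intros f.
  - apply Cseries_cons. rewrite Csum_O. cbn [Nat.leb].
    replace (f 0%nat - f 0%nat)%C with (RtoC 0) by ring. apply Cseries_zero.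
  - apply Cseries_cons. rewrite Csum_shift. cbn [Nat.leb].
    replace (f 0%nat + sum_n (fun k0 : nat => f (S k0)) k - f 0%nat)%C with (sum_n (fun k0 : nat => f (S k0)) k) by (set (s := sum_n _ k); clearbody s; change C in s; Cring).
    apply (IHk (fun j => f (S j))).
Qed.

Lemma Cseries_delay (f : nat -> C) l m : Cseries f l ->
  Cseries (fun k => if Nat.leb m k then f (k - m)%nat else RtoC 0) l.
Proof.
  intros H; induction m.
  - eapply Cseries_ext; [|apply H]. intros; cbn [Nat.leb]. f_equal. lia.
  - apply Cseries_cons. cbn [Nat.leb Nat.sub]. now replace (l - 0)%C with l by ring.
Qed.

Definition conv (a b : nat -> C) (n : nat) : C := sum_n (fun m => a m * b (n - m)%nat)%C n.

Lemma geom_series q : 0 <= q < 1 -> is_series (fun n => q ^ n) (/ (1 - q)).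
Proof. intros. apply is_series_geom. rewrite Rabs_pos_eq; lra. Qed.

(* Since [q^(2k) <= q^m q^k] for [m <= k], the terms of the product have a
   majorant of product form, so the double series may be rearranged. *)
Lemma Cseries_product (a b : nat -> C) A B M q : 0 <= q < 1 -> 0 <= M ->
  (forall k, Cmod (a k) <= M * (q * q) ^ k) -> (forall k, Cmod (b k) <= M * (q * q) ^ k) ->
  Cseries a A -> Cseries b B -> Cseries (conv a b) (A * B)%C.
Proof.
  intros Hq HM Ha Hb HA HB.
  destruct (Cseries_swap (fun m k => if Nat.leb m k then a m * b (k - m)%nat else RtoC 0)%C
    (fun m => M * q ^ m) (fun m => M * q ^ m) (M * / (1 - q)) (M * / (1 - q))
    (fun m => a m * B)%C (conv a b)) as [L [H1 H2]].
  - now apply (Rseries_scal M), geom_series.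
  - now apply (Rseries_scal M), geom_series.
  - intros m k. assert (H1 := pow_le q m (proj1 Hq)). assert (H2 := pow_le q k (proj1 Hq)).
    destruct (Nat.leb_spec m k).
    + rewrite Cmod_mult.
      apply Rle_trans with ((M * (q * q) ^ m) * (M * (q * q) ^ (k - m))).
      apply Rmult_le_compat; auto; apply Cmod_ge_0.
      replace (M * (q * q) ^ m * (M * (q * q) ^ (k - m))) with (M * M * (q * q) ^ (m + (k - m))) by (rewrite pow_add; ring).
      replace (m + (k - m))%nat with k by lia.
      rewrite Rpow_mult_distr.
      assert (q ^ k <= q ^ m). { replace k with (m + (k - m))%nat by lia. rewrite pow_add.
        assert (q ^ (k - m) <= 1) by (rewrite <- (pow1 (k - m)); apply pow_incr; lra). nra. }
      replace (M * q ^ m * (M * q ^ k)) with (M * M * (q ^ m * q ^ k)) by ring.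
      apply Rmult_le_compat_l; nra.
    + rewrite Cmod_0. apply Rmult_le_pos; nra.
  - intros m. eapply Cseries_ext; [|apply (Cseries_scal (a m)), (Cseries_delay b B m HB)].
    intros k. cbv beta. destruct (Nat.leb m k); ring.
  - intros k. eapply Cseries_ext; [|apply (Cseries_finite (fun m => a m * b (k - m)%nat)%C k)].
    intros m. reflexivity.
  - intros m. apply Rmult_le_pos; auto. apply pow_le; lra.
  - replace (A * B)%C with L; auto.
    apply (Cseries_unique (fun m => a m * B)%C); auto.
    eapply Cseries_ext; [|replace (A * B)%C with (B * A)%C by ring; apply (Cseries_scal B), HA].
    intros; cbv beta; ring.
Qed.

(** Vanishing is assumed only on a segment issuing from the centre. The terms are bounded at the
    midpoint; at e times that point all terms beyond the constant one add up to O(e), so the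
    constant term is 0. Dividing by the variable then lowers the index. *)
Lemma power_series_zero_step (d : nat -> C) (u : C) lam0 : 0 < lam0 -> u <> 0 ->
  (forall lam, 0 < lam < lam0 -> Cseries (fun k => d k * (RtoC lam * u) ^ k)%C 0) ->
  d 0%nat = 0 /\ (forall lam, 0 < lam < lam0 -> Cseries (fun k => d (S k) * (RtoC lam * u) ^ k)%C 0).
Proof.
  intros Hl Hu H.
  assert (H0 : d 0%nat = 0).
  { destruct (Cseries_term_bounded _ _ (H (lam0 / 2) ltac:(lra))) as [M HM].
    assert (HM0 : 0 <= M) by (eapply Rle_trans; [apply Cmod_ge_0|apply (HM 0%nat)]).
    apply Cmod_eq_0. apply Rle_antisym; [|apply Cmod_ge_0].
    apply le_epsilon. intros eps Heps. rewrite Rplus_0_l.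
    (* The bound 1/2 keeps the geometric factor 1/(1 - e) below 2; the other makes 2 M e at most
       eps. *)
    set (e := Rmin (1/2) (eps / (2 * (M + 1)))).
    assert (He : 0 < e). { apply Rmin_glb_lt. lra. apply Rdiv_lt_0_compat; lra. }
    assert (He1 : e <= 1/2) by apply Rmin_l.
    assert (He2 : 2 * M * e <= eps).
    { assert (e <= eps / (2 * (M + 1))) by apply Rmin_r.
      apply (Rmult_le_compat_l (2 * (M + 1))) in H0; [|lra].
      replace (2 * (M + 1) * (eps / (2 * (M + 1)))) with eps in H0 by (field; lra). nra. }
    assert (HS := H (e * (lam0 / 2)) ltac:(nra)).
    apply Cseries_tail in HS.
    replace (0 - d 0%nat * (RtoC (e * (lam0 / 2)) * u) ^ 0)%C with (- d 0%nat)%C in HS by (simpl; ring).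
    rewrite <- Cmod_opp.
    apply Rle_trans with (M * e * / (1 - e)).
    - apply (Cseries_Cmod_le _ (fun k => M * e * e ^ k) _ _ HS).
      + now apply (Rseries_scal (M * e)), geom_series; lra.
      + intros n. cbv beta.
        replace (d (S n) * (RtoC (e * (lam0 / 2)) * u) ^ S n)%C
          with (RtoC (e ^ S n) * (d (S n) * (RtoC (lam0 / 2) * u) ^ S n))%C
          by (rewrite RtoC_mult, !Cpow_mult_l, RtoC_pow; ring).
        rewrite Cmod_mult, Cmod_RtoC_pos by (apply pow_le; lra).
        replace (M * e * e ^ n) with (e ^ S n * M) by (simpl; ring).
        apply Rmult_le_compat_l; auto. apply pow_le; lra.
    - apply Rle_trans with (M * e * 2); [|lra].
      apply Rmult_le_compat_l. nra. replace 2 with (/ (1/2)) by field. apply Rinv_le_contravar; lra. }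
  split; auto. intros lam Hlam. assert (HS := Cseries_tail _ _ (H lam Hlam)).
  cbv beta in HS. rewrite H0 in HS.
  assert (Hz : (RtoC lam * u)%C <> 0) by (apply Cmult_neq_0; auto; apply RtoC_neq; lra).
  apply (Cseries_scal (/ (RtoC lam * u))%C) in HS.
  replace (/ (RtoC lam * u) * (0 - 0 * (RtoC lam * u) ^ 0))%C with (RtoC 0) in HS by ring.
  eapply Cseries_ext; [|apply HS]. intros n. cbv beta. rewrite Cpow_S. field. 
  split; auto. apply RtoC_neq; lra.
Qed.

Lemma power_series_zero (d : nat -> C) (u : C) lam0 : 0 < lam0 -> u <> 0 ->
  (forall lam, 0 < lam < lam0 -> Cseries (fun k => d k * (RtoC lam * u) ^ k)%C 0) ->
  forall n, d n = 0.
Proof.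
  intros Hl Hu H n. revert d H; induction n; intros d H;
    destruct (power_series_zero_step d u lam0 Hl Hu H) as [H1 H2]; auto.
  apply (IHn (fun k => d (S k))). auto.
Qed.

Lemma Dn_scal N c g t : Dn N (fun u => c * g u)%C t = (c * Dn N g t)%C.
Proof.
  revert t; induction N; intros t. reflexivity. rewrite !Dn_S, !IHN. ring.
Qed.

(** A regularised sum may be exchanged with a series in k: only after N differences is there a
    majorant in product form, and the boundary values split off by the Euler steps add up by the
    pointwise convergence at t = 1. *)
Lemma AltSum_series N (g : nat -> R -> C) (G : R -> C) (l : nat -> C) X q : 0 <= q < 1 -> 0 <= X ->
  (forall t, 0 < t -> Cseries (fun k => g k t) (G t)) ->
  (forall k, AltSum N (g k) (l k)) ->
  (forall k m, Cmod (Dn N (g k) (INR m + 1)) <= X * telescoping_weight m * q ^ k) ->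
  exists L, AltSum N G L /\ Cseries l L.
Proof.
  intros Hq HX. revert g G l; induction N; intros g G l HG Hl Hb.
  - destruct (Cseries_swap (fun m k => alt_sign m * g k (INR m + 1)%R)%C
      (fun m => X * telescoping_weight m) (fun k => q ^ k) (X * 1) (/ (1 - q))
      (fun m => alt_sign m * G (INR m + 1)%R)%C l) as [L [H1 H2]]; eauto.
    + apply (Rseries_scal X), telescoping_series.
    + now apply geom_series.
    + intros m k. rewrite Cmod_mult, Cmod_alt_sign, Rmult_1_l. apply Hb.
    + intros m. apply Cseries_scal, HG. generalize (pos_INR m); lra.
    + intros m. apply Rmult_le_pos; auto. left; apply telescoping_weight_pos.
  - destruct (IHN (fun k => Dl (g k)) (Dl G) (fun k => RtoC 2 * l k - g k 1%R)%C) as [L [H1 H2]].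
    + intros t Ht. apply Cseries_minus; apply HG; lra.
    + intros k. destruct (Hl k) as [l' [H1 H2]].
      replace (RtoC 2 * l k - g k 1%R)%C with l'; auto.
      rewrite H2, RtoC_inv by lra. field.
    + intros k m. apply Hb.
    + exists (RtoC (/ 2) * (G 1%R + L))%C. split. now exists L.
      eapply Cseries_ext; [|apply (Cseries_scal (RtoC (/2))), (Cseries_plus _ _ _ _ (HG 1 Rlt_0_1) H2)].
      intros k. cbv beta. rewrite RtoC_inv by lra. field.
Qed.

(** * The alternating zeta function *)

(** This is t^(-s) for t > 0, written with the real logarithm so that no argument function
    appears. *)
Definition npow (s : C) (t : R) : C := Cexp (- s * RtoC (ln t))%C.

Lemma npow_plus s h t : npow (s + h)%C t = (npow s t * Cexp (h * RtoC (- ln t)))%C.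
Proof. unfold npow. rewrite <- Cexp_plus. f_equal. rewrite RtoC_opp. ring. Qed.

Lemma npow_RtoC a t : npow (RtoC (- a)) t = RtoC (Rpower t a).
Proof.
  unfold npow. replace (- RtoC (- a) * RtoC (ln t))%C with (RtoC (a * ln t)).
  apply Cexp_RtoC. rewrite RtoC_opp, RtoC_mult. ring.
Qed.

Lemma Cmod_npow s t : Cmod (npow s t) = Rpower t (- Re s).
Proof. unfold npow. rewrite Cmod_Cexp. unfold Rpower. f_equal. rewrite re_scal_r. f_equal. Qed.

Lemma npow_mult s x y : 0 < x -> 0 < y -> npow s (x * y) = (npow s x * npow s y)%C.
Proof.
  intros Hx Hy. unfold npow. rewrite <- Cexp_plus, ln_mult, RtoC_plus by auto. f_equal. ring.
Qed.

Lemma Cpower_pos x s : 0 < x -> Cpower (RtoC x) s = Cexp (s * RtoC (ln x))%C.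
Proof.
  intros Hx. unfold Cpower. do 2 f_equal. unfold Cln.
  unfold Arg. rewrite im_RtoC, re_RtoC, Cmod_RtoC_pos by lra.
  replace (x / x) with 1 by (field; lra). rewrite acos_1. unfold RtoC at 1. f_equal. destruct Rle_dec; lra.
Qed.

Lemma pow_fact_le_exp x k : 0 <= x -> x ^ k / INR (fact k) <= exp x.
Proof.
  intros Hx. assert (H := is_exp_Reals x). unfold is_pseries in H.
  assert (Hp : forall j, 0 <= scal (pow_n x j) (/ INR (fact j))).
  { intros j. rewrite pow_n_pow. apply Rmult_le_pos. now apply pow_le.
    left; apply Rinv_0_lt_compat, INR_fact_pos. }
  apply Rle_trans with (sum_n (fun j => scal (pow_n x j) (/ INR (fact j))) k).
  - destruct k. rewrite sum_O. right. reflexivity.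
    rewrite sum_Sn. change plus with Rplus.
    assert (0 <= sum_n (fun j => scal (pow_n x j) (/ INR (fact j))) k).
    { clear - Hp. induction k. rewrite sum_O. apply Hp. rewrite sum_Sn. apply Rplus_le_le_0_compat; auto. }
    assert (x ^ S k / INR (fact (S k)) = scal (pow_n x (S k)) (/ INR (fact (S k)))).
    { rewrite <- pow_n_pow. reflexivity. }
    rewrite <- H1. lra.
  - apply (sum_n_le_series _ (exp x)); auto.
Qed.

(** The k-th Taylor coefficient at h = 0 of t^(-(s0 + h)). *)
Definition log_family (s0 : C) (k : nat) (t : R) : C :=
  (npow s0 t * (RtoC (/ INR (fact k)) * RtoC (- ln t) ^ k))%C.

Lemma log_family_series s0 h t : Cseries (fun k => h ^ k * log_family s0 k t)%C (npow (s0 + h)%C t).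
Proof.
  rewrite npow_plus. eapply Cseries_ext; [|apply (Cseries_scal (npow s0 t)), (Cexp_series (h * RtoC (- ln t))%C)].
  intros k. unfold log_family. cbv beta. rewrite Cpow_mult_l. ring.
Qed.

(** Differentiating (- ln t)^k / k! lowers k by one and gives 0 at k = 0. *)
Definition shift_family (g : nat -> R -> C) (k : nat) : R -> C :=
  match k with O => fun _ => RtoC 0 | S j => g j end.

Lemma Cder_npow s t : 0 < t -> Cder (npow s) t (RtoC (/ t) * (- s * npow s t))%C.
Proof.
  intros Ht. unfold npow. eapply Cder_eq. apply Cder_Cexp, Cder_scal, Cder_RtoC.
  apply (is_derive_ln t Ht). cbv beta. ring.
Qed.

Lemma Cder_Cpow (f : R -> C) t l n : Cder f t l ->
  Cder (fun u => f u ^ S n)%C t (RtoC (INR (S n)) * l * f t ^ n)%C.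
Proof.
  intros H. induction n.
  - eapply Cder_ext. 2: eapply Cder_eq. 2: apply H. intros; simpl; ring. simpl; ring.
  - eapply Cder_ext. 2: eapply Cder_eq. 2: apply (Cder_mult f (fun u => f u ^ S n)%C t l _ H IHn).
    intros; simpl; ring. cbv beta. rewrite (S_INR (S n)), RtoC_plus, (Cpow_S _ n). ring.
Qed.

Lemma Cder_log_family s0 k t : 0 < t ->
  Cder (log_family s0 k) t (RtoC (/ t) * (- s0 * log_family s0 k t - shift_family (log_family s0) k t))%C.
Proof.
  intros Ht. unfold log_family at 1. destruct k as [|k].
  - eapply Cder_ext. 2: eapply Cder_eq. 2: apply (Cder_npow s0 t Ht).
    intros u. simpl. rewrite Rinv_1. ring. simpl. unfold log_family. simpl. rewrite Rinv_1. ring.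
  - eapply Cder_eq. apply Cder_mult. apply (Cder_npow s0 t Ht). apply Cder_scal.
    apply (Cder_Cpow (fun u => RtoC (- ln u)) t (RtoC (- / t)) k).
    apply Cder_RtoC. apply (is_derive_opp (fun u => ln u)). now apply is_derive_ln.
    simpl shift_family. unfold log_family.
    rewrite fact_simpl, mult_INR, Rinv_mult, (RtoC_mult (/ INR (S k))).
    assert (E : (RtoC (/ INR (S k)) * RtoC (INR (S k)) = 1)%C).
    { rewrite <- RtoC_mult, Rinv_l; auto. apply not_0_INR; lia. }
    cbv beta. rewrite (RtoC_opp (/ t)).
    transitivity (RtoC (/ t) * (- s0 * (npow s0 t * (RtoC (/ INR (S k)) * RtoC (/ INR (fact k)) * RtoC (- ln t) ^ S k)))
      - RtoC (/ t) * ((RtoC (/ INR (S k)) * RtoC (INR (S k))) * (npow s0 t * (RtoC (/ INR (fact k)) * RtoC (- ln t) ^ k))))%C.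
    ring. rewrite E. ring.
Qed.

(** Independent of k: since |ln t|^k / k! <= exp |ln t| <= t + 1/t, all logarithmic powers together
    cost a single power of t in either direction. *)
Definition log_weight (s0 : C) (_ : nat) (t : R) : R := Rpower t (1 - Re s0) + Rpower t (- 1 - Re s0).

Lemma log_weight_pos s0 k t : 0 <= log_weight s0 k t.
Proof. unfold log_weight. generalize (Rpower_pos t (1 - Re s0)) (Rpower_pos t (-1 - Re s0)). lra. Qed.

Lemma Sym_shift_family s0 N g : Sym (fun _ => True) (log_weight s0) N g ->
  Sym (fun _ => True) (log_weight s0) N (shift_family g).
Proof.
  assert (B : forall g, dominated (fun _ => True) (log_weight s0) g ->
    (dominated (fun _ => True) (log_weight s0) (shift_family g))).
  { intros g0 [c [Hc H]]. exists c; split; auto. intros [|p] t _ Ht; simpl.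
    - rewrite Cmod_0. apply Rmult_le_pos; auto. apply log_weight_pos.
    - apply (H p t I Ht). }
  revert g; induction N; intros g [H1 H2]; split; auto.
  destruct H2 as [g' [H2 H3]]. exists (shift_family g'); split; auto.
  intros [|p] t _ Ht; simpl; auto. eapply Cder_eq. apply Cder_const. ring.
Qed.

(** The family is closed under t d/dt up to an index shift, and the weight does not see the index;
    so the zeroth-order bound gives all orders uniformly in k. *)
Lemma Sym_log_family s0 N : Sym (fun _ => True) (log_weight s0) N (log_family s0).
Proof.
  assert (B : dominated (fun _ => True) (log_weight s0) (log_family s0)).
  { exists 1. split. lra. intros k t _ Ht. unfold log_family.
    rewrite !Cmod_mult, Cmod_npow, Cmod_pow.
    rewrite (Cmod_RtoC_pos (/ INR (fact k))) by (left; apply Rinv_0_lt_compat, INR_fact_pos).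
    rewrite Cmod_R, Rabs_Ropp.
    assert (H1 := pow_fact_le_exp (Rabs (ln t)) k (Rabs_pos _)).
    assert (H2 : exp (Rabs (ln t)) <= t + / t).
    { unfold Rabs; destruct Rcase_abs. rewrite exp_Ropp, exp_ln; auto. lra.
      rewrite exp_ln; auto. generalize (Rinv_0_lt_compat t Ht). lra. }
    unfold log_weight, Rminus. replace (-1) with (- (1)) by lra. rewrite !Rpower_plus, (Rpower_Ropp t 1), Rpower_1 by auto.
    rewrite Rmult_1_l, <- Rmult_plus_distr_r, Rmult_comm.
    apply Rmult_le_compat_r. left; apply Rpower_pos. unfold Rdiv in H1. lra. }
  induction N; [now apply Sym_0|].
  apply Sym_S with (fun k t => - s0 * log_family s0 k t - shift_family (log_family s0) k t)%C; auto.
  - intros; now apply Cder_log_family.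
  - apply Sym_minus. now apply Sym_scal. now apply Sym_shift_family.
Qed.

(** Analyticity of the regularised sum in s. Its Taylor coefficients are the regularised sums of
    [log_family], bounded uniformly in k, so the radius of convergence is at least 1. *)
Lemma AltSum_npow_power_series s0 N : 1 - Re s0 - INR N <= -2 ->
  exists c : nat -> C, (exists X, 0 <= X /\ forall k, Cmod (c k) <= X) /\
    forall h, Cmod h < 1 -> exists L, AltSum N (npow (s0 + h)%C) L /\ Cseries (fun k => c k * h ^ k)%C L.
Proof.
  intros HN.
  set (cd := Rpower 2 (Rabs (1 - Re s0)) + Rpower 2 (Rabs (-1 - Re s0))).
  assert (Hcd : 0 <= cd). { unfold cd. generalize (Rpower_pos 2 (Rabs (1 - Re s0))) (Rpower_pos 2 (Rabs (-1 - Re s0))). lra. }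
  assert (Hd : forall (p : nat) t t', True -> 1 <= t -> t <= t' <= t + 1 -> log_weight s0 p t' <= cd * log_weight s0 p t).
  { intros p t t' _ Ht Ht'. unfold log_weight, cd.
    generalize (Rpower_doubling (1 - Re s0) t t' ltac:(lra) ltac:(lra)) (Rpower_doubling (-1 - Re s0) t t' ltac:(lra) ltac:(lra)).
    generalize (Rpower_pos 2 (Rabs (1 - Re s0))) (Rpower_pos 2 (Rabs (-1 - Re s0))) (Rpower_pos t (1 - Re s0)) (Rpower_pos t (-1 - Re s0)).
    nra. }
  assert (HW : forall p t, True -> 1 <= t -> log_weight s0 p t <= 2 * Rpower t (1 - Re s0)).
  { intros p t _ Ht. unfold log_weight. generalize (Rle_Rpower t (-1 - Re s0) (1 - Re s0) Ht ltac:(lra)). lra. }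
  (* The trivial factor t^(-0) fits the family into the lemmas on differences, applied with s =
     0. *)
  assert (E : forall k t, 0 < t -> (RtoC (Rpower t (- 0)) * log_family s0 k t)%C = log_family s0 k t).
  { intros. rewrite Ropp_0, Rpower_O by auto. ring. }
  destruct (Sym_AltSum (fun _ => True) (log_weight s0) cd (fun _ => 2) (1 - Re s0) Hcd
    (fun p t _ _ => log_weight_pos s0 p t) Hd ltac:(intros; lra) HW N 0 (log_family s0) ltac:(lra) (Sym_log_family s0 N))
    as [X [HX H1]].
  destruct (Sym_diff (fun _ => True) (log_weight s0) cd Hcd (fun p t _ _ => log_weight_pos s0 p t) Hd N 0
    (log_family s0) (Sym_log_family s0 N)) as [Y [HY H2]].
  assert (Hc : forall k, exists l, AltSum N (log_family s0 k) l /\ Cmod l <= X * 2).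
  { intros k. destruct (H1 k I) as [l [Hl Hl']]. exists l; split; auto.
    eapply AltSum_ext; [|apply Hl]. intros; now apply E. }
  apply (functional_choice (fun k l => AltSum N (log_family s0 k) l /\ Cmod l <= X * 2)) in Hc.
  destruct Hc as [c Hc]. exists c. split.
  { exists (X * 2). split. lra. intros; apply Hc. }
  intros h Hh.
  (* In 4 Y one factor 2 comes from the two powers of the weight, the other from the comparison with
     [telescoping_weight]. *)
  destruct (AltSum_series N (fun k t => h ^ k * log_family s0 k t)%C (npow (s0 + h)%C)
    (fun k => c k * h ^ k)%C (4 * Y) (Cmod h)) as [L [HL HL']]; eauto.
  - split; auto. apply Cmod_ge_0.
  - lra.
  - intros. apply log_family_series.
  - intros k. replace (c k * h ^ k)%C with (h ^ k * c k)%C by ring. apply AltSum_scal. apply Hc.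
  - intros k m. rewrite Dn_scal, Cmod_mult, Cmod_pow, Rmult_comm.
    apply Rmult_le_compat_r. apply pow_le, Cmod_ge_0.
    assert (Hm := pos_INR m).
    rewrite <- (Dn_ext N _ _ (fun t Ht => E k t Ht)) by lra.
    eapply Rle_trans; [apply (H2 k (INR m + 1) I); lra|].
    assert (HH := HW k (INR m + 1) I ltac:(lra)).
    apply Rle_trans with (Y * (2 * (Rpower (INR m + 1) (1 - Re s0) * Rpower (INR m + 1) (- 0 - INR N)))).
    { rewrite Rmult_assoc. apply Rmult_le_compat_l; auto. rewrite <- Rmult_assoc.
      apply Rmult_le_compat_r; auto. left; apply Rpower_pos. }
    rewrite <- Rpower_plus. 
    generalize (Rpower_le_telescoping (1 - Re s0 + (- 0 - INR N)) m ltac:(lra)). nra.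
Qed.

(** * The Dirichlet eta function and continuation to the left *)

(** The zeros stand at even indices because index n belongs to the integer n + 1: the even integers
    sit at the odd indices. *)
Lemma Cseries_interleave (f : nat -> C) l : Cseries f l ->
  Cseries (fun n => if Nat.even n then RtoC 0 else f (Nat.div2 n)) l.
Proof.
  intros H. set (g := fun n => if Nat.even n then RtoC 0 else f (Nat.div2 n)).
  assert (E : forall n, sum_n f (Nat.div2 n) = sum_n g (S n)).
  { induction n.
    - rewrite Csum_Sn, !Csum_O. unfold g. simpl. Cring.
    - rewrite Csum_Sn, <- IHn. destruct (Nat.Even_or_Odd n) as [[j ->]|[j ->]].
      + unfold g. replace (Nat.even (S (S (2 * j)))) with true by (cbn [Nat.even]; now rewrite Nat.even_even).
        rewrite Nat.div2_double, Nat.div2_succ_double. set (s := sum_n f j). clearbody s. change C in s. Cring.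
      + unfold g. replace (Nat.even (S (S (2 * j + 1)))) with false
          by (cbn [Nat.even]; now rewrite Nat.even_odd).
        replace (2 * j + 1)%nat with (S (2 * j)) by lia.
        rewrite Nat.div2_succ_double. replace (S (S (2 * j))) with (2 * S j)%nat by lia.
        rewrite Nat.div2_double, Nat.div2_succ_double, Csum_Sn. reflexivity. }
  apply is_lim_seq_Cseries. apply Cseries_is_lim_seq in H.
  apply is_lim_seq_incr_1. apply is_lim_seq_spec. apply is_lim_seq_spec in H.
  intros eps. destruct (H eps) as [N HN]. exists (2 * N)%nat. intros n Hn.
  rewrite <- E. apply HN. rewrite <- (Nat.div2_double N). now apply Nat.div2_le_mono.
Qed.

(** The factor 1 - 2^(1-s) that relates the Dirichlet eta function to zeta. *)
Definition eta_factor (s : C) : C := (1 - Cexp ((1 - s) * RtoC (ln 2)))%C.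

Lemma eta_factor_npow s : eta_factor s = (1 - RtoC 2 * npow s 2)%C.
Proof.
  unfold eta_factor, npow. replace ((1 - s) * RtoC (ln 2))%C with (RtoC (ln 2) + - s * RtoC (ln 2))%C by ring.
  rewrite Cexp_plus, Cexp_RtoC, exp_ln by lra. reflexivity.
Qed.

(** The alternating series is the full series minus twice its terms at even integers, and those
    terms form 2^(-s) times the full series. *)
Lemma AltSum_npow_of_series s Z : Cseries (fun m => npow s (INR m + 1)) Z ->
  AltSum 0 (npow s) (eta_factor s * Z)%C.
Proof.
  intros H. rewrite eta_factor_npow.
  replace ((1 - RtoC 2 * npow s 2) * Z)%C with (Z - RtoC 2 * npow s 2 * Z)%C by ring.
  eapply Cseries_ext; [|apply (Cseries_minus _ _ _ _ H (Cseries_interleave _ _ (Cseries_scal (RtoC 2 * npow s 2)%C _ _ H)))].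
  intros n. cbv beta. destruct (Nat.Even_or_Odd n) as [[j ->]|[j ->]]; unfold alt_sign.
  - rewrite Nat.even_even, pow_1_even. ring.
  - rewrite Nat.even_odd. replace (2 * j + 1)%nat with (S (2 * j)) by lia.
    rewrite pow_1_odd, Nat.div2_succ_double.
    replace (INR (S (2 * j)) + 1) with (2 * (INR j + 1)) by (rewrite S_INR, mult_INR; simpl; ring).
    rewrite npow_mult by (generalize (pos_INR j); lra).
    rewrite RtoC_m1.
    rewrite RtoC_two. ring.
Qed.

Lemma conv_pow (a b : nat -> C) h k : 
  conv (fun j => a j * h ^ j)%C (fun j => b j * h ^ j)%C k = (conv a b k * h ^ k)%C.
Proof.
  unfold conv. rewrite Cmult_comm, <- Csum_scal.
  apply sum_n_ext_loc. intros m Hm. cbv beta.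
  replace (h ^ k)%C with (h ^ m * h ^ (k - m))%C by (rewrite <- Cpow_add_r; f_equal; lia). Cring.
Qed.

Lemma Cpow_le_pow h q n : Cmod h <= q -> Cmod (h ^ n)%C <= q ^ n.
Proof. intros. rewrite Cmod_pow. apply pow_incr. split; auto. apply Cmod_ge_0. Qed.

(** Both sides of the identity to be continued are power series about s0. Their difference has one
    coefficient sequence for a whole disc, so vanishing on a segment inside will spread to the
    disc. *)
Lemma zeta_local_expansion zeta N (s0 : C) : is_Riemann_zeta zeta -> s0 <> RtoC 1 -> 1 - Re s0 - INR N <= -2 ->
  exists r (d : nat -> C), 0 < r /\ forall h, Cmod h < r ->
    exists L, AltSum N (npow (s0 + h)%C) L /\
      Cseries (fun k => d k * h ^ k)%C (eta_factor (s0 + h)%C * zeta (s0 + h)%C - L)%C.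
Proof.
  intros [_ Hz] Hs HN. destruct (Hz s0 Hs) as [c [r1 [Hr1 Hc]]].
  destruct (AltSum_npow_power_series s0 N HN) as [c' [_ Hc']].
  assert (Hc1 : forall h, Cmod h < r1 -> Cseries (fun k => c k * h ^ k)%C (zeta (s0 + h)%C)).
  { intros h Hh. assert (E : (s0 + h - s0)%C = h) by ring. rewrite <- E in Hh. assert (H := Hc _ Hh).
    rewrite E in H. exact H. }
  (* Strictly inside the disc for zeta, so the terms at this radius are bounded. *)
  set (rho := Rmin (r1 / 2) 1).
  assert (Hrho : 0 < rho) by (apply Rmin_glb_lt; lra).
  assert (Hrho1 : rho <= 1) by apply Rmin_r.
  assert (Hrho2 : rho <= r1 / 2) by apply Rmin_l.
  destruct (Cseries_term_bounded _ _ (Hc1 (RtoC rho) ltac:(rewrite Cmod_RtoC_pos; lra))) as [M HM].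
  set (E0 := Cexp ((1 - s0) * RtoC (ln 2))).
  (* The Taylor coefficients of [eta_factor] at s0. *)
  set (b := fun k => ((if Nat.leb k 0 then RtoC 1 else RtoC 0) - E0 * (RtoC (/ INR (fact k)) * RtoC (- ln 2) ^ k))%C).
  set (M' := Rmax M (1 + 2 * Cmod E0)).
  assert (HM1 : M <= M') by apply Rmax_l.
  assert (HM2 : 1 + 2 * Cmod E0 <= M') by apply Rmax_r.
  assert (HM0 : 0 <= M') by (generalize (Cmod_ge_0 E0); lra).
  assert (Hb : forall k, Cmod (b k) <= M').
  { intros k. eapply Rle_trans; [|apply HM2]. unfold b. eapply Rle_trans; [apply Cmod_minus_le|].
    apply Rplus_le_compat. destruct Nat.leb; rewrite ?Cmod_1, ?Cmod_0; lra.
    rewrite !Cmod_mult, Cmod_pow, (Cmod_RtoC_pos (/ _)) by (left; apply Rinv_0_lt_compat, INR_fact_pos).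
    assert (0 < ln 2) by (rewrite <- ln_1; apply ln_increasing; lra).
    rewrite Cmod_R, Rabs_Ropp, Rabs_pos_eq by lra.
    assert (H1 := pow_fact_le_exp (ln 2) k ltac:(lra)). rewrite exp_ln in H1 by lra. unfold Rdiv in H1.
    rewrite Rmult_comm. apply Rmult_le_compat_r. apply Cmod_ge_0. lra. }
  (* The quarter is the square of q = 1/2: the product lemma asks for majorants in powers of q^2. *)
  exists (rho / 4), (fun k => conv b c k - c' k)%C. split. lra.
  intros h Hh. destruct (Hc' h ltac:(lra)) as [L [HL HL']].
  exists L; split; auto.
  assert (Hp : Cseries (conv (fun k => b k * h ^ k)%C (fun k => c k * h ^ k)%C)
    (eta_factor (s0 + h)%C * zeta (s0 + h)%C)%C).
  { apply Cseries_product with M' (1 / 2); auto; try lra.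
    - intros k. rewrite Cmod_mult. apply Rmult_le_compat; auto; try apply Cmod_ge_0.
      apply Cpow_le_pow. lra.
    - intros k. assert (Cmod (c k) * rho ^ k <= M).
      { specialize (HM k). cbv beta in HM. rewrite Cmod_mult, <- RtoC_pow, Cmod_RtoC_pos in HM. exact HM. apply pow_le; lra. }
      rewrite Cmod_mult.
      apply Rle_trans with (Cmod (c k) * (rho / 4) ^ k).
      apply Rmult_le_compat_l. apply Cmod_ge_0. apply Cpow_le_pow. lra.
      replace (rho / 4) with (rho * (1/2 * (1/2))) by field. rewrite Rpow_mult_distr, <- Rmult_assoc.
      apply Rmult_le_compat_r. apply pow_le; lra. lra.
    - unfold eta_factor. replace ((1 - (s0 + h)) * RtoC (ln 2))%C with ((1 - s0) * RtoC (ln 2) + h * RtoC (- ln 2))%C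
        by (rewrite RtoC_opp; ring).
      rewrite Cexp_plus. fold E0.
      assert (H1 := Cseries_finite (fun _ => RtoC 1) 0). rewrite Csum_O in H1.
      eapply Cseries_ext; [|apply (Cseries_minus _ _ _ _ H1 (Cseries_scal E0 _ _ (Cexp_series (h * RtoC (- ln 2))%C)))].
      intros k. cbv beta. unfold b. rewrite Cpow_mult_l. destruct k; cbn [Nat.leb]; [simpl; ring|ring].
    - apply Hc1. lra. }
  eapply Cseries_ext; [|apply (Cseries_minus _ _ _ _ Hp HL')].
  intros k. cbv beta. rewrite conv_pow. ring.
Qed.

(** The segment runs from 2 + i to sigma. It meets the real axis only at its end, which differs from
    1, so it avoids the pole even for sigma < 1. The two conditions on N are those at real parts
    sigma and 2; the real part being affine, they hold all along. *)
Lemma zeta_alternating zeta N (sigma : R) : is_Riemann_zeta zeta -> sigma <> 1 ->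
  1 - sigma - INR N <= -2 -> 1 - 2 - INR N <= -2 ->
  AltSum N (npow (RtoC sigma)) (eta_factor (RtoC sigma) * zeta (RtoC sigma))%C.
Proof.
  intros Hzeta Hsig HN1 HN2.
  set (Good := fun s => AltSum N (npow s) (eta_factor s * zeta s)%C).
  assert (HR : forall s, 1 < Re s -> Good s).
  { intros s Hs. apply AltSum_of_series, AltSum_npow_of_series.
    eapply Cseries_ext; [|apply (proj1 Hzeta s Hs)].
    intros m. cbv beta. rewrite Cpower_pos by (apply lt_0_INR; lia). rewrite S_INR. reflexivity. }
  set (v := (RtoC (sigma - 2) - Ci)%C).
  set (path := fun tau => (RtoC 2 + Ci + RtoC tau * v)%C).
  assert (Hv : v <> 0).
  { intros E. apply (f_equal Im) in E. unfold v in E. autorewrite with reim in E. lra. }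
  assert (Hpr : forall tau, Re (path tau) = 2 + tau * (sigma - 2)).
  { intros. unfold path, v. autorewrite with reim. ring. }
  assert (Hpi : forall tau, Im (path tau) = 1 - tau).
  { intros. unfold path, v. autorewrite with reim. ring. }
  assert (Hp1 : path 1 = RtoC sigma).
  { apply C_ext. rewrite Hpr. simpl. ring. rewrite Hpi. simpl. ring. }
  assert (Hne : forall tau, 0 <= tau <= 1 -> path tau <> 1).
  { intros tau Ht E. assert (E1 := f_equal Re E). assert (E2 := f_equal Im E).
    rewrite Hpr in E1. rewrite Hpi in E2. simpl in E1, E2. apply Hsig. replace tau with 1 in E1 by lra. lra. }
  assert (HNp : forall tau, 0 <= tau <= 1 -> 1 - Re (path tau) - INR N <= -2).
  { intros tau Ht. rewrite Hpr. nra. }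
  (* The parameters up to which the identity has been continued without gap; their supremum is shown
     to be 1 and to be attained. *)
  set (E := fun x => 0 <= x <= 1 /\ forall y, 0 <= y <= x -> Good (path y)).
  (* Below this parameter the real part of the path still exceeds 1, where the Dirichlet series
     converges. *)
  set (tau0 := / (1 + Rabs (sigma - 2))).
  assert (Ht0 : 0 < tau0 <= 1).
  { generalize (Rabs_pos (sigma - 2)); intros. split. apply Rinv_0_lt_compat; lra.
    unfold tau0. rewrite <- Rinv_1. apply Rinv_le_contravar; lra. }
  assert (HE0 : E (tau0 / 2)).
  { split. lra. intros y Hy. apply HR. rewrite Hpr.
    assert (tau0 * (1 + Rabs (sigma - 2)) = 1). { unfold tau0. field. generalize (Rabs_pos (sigma - 2)); lra. }
    generalize (Rle_abs (- (sigma - 2))) (Rabs_pos (sigma - 2)). rewrite Rabs_Ropp. nra. }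
  destruct (completeness E) as [m [Hm1 Hm2]].
  { exists 1. intros x [Hx _]. lra. }
  { now exists (tau0 / 2). }
  assert (Hm0 : tau0 / 2 <= m) by now apply Hm1.
  assert (Hm3 : m <= 1). { apply Hm2. intros x [Hx _]; lra. }
  destruct (zeta_local_expansion zeta N (path m) Hzeta (Hne m ltac:(lra)) (HNp m ltac:(lra))) as [r [d [Hr Hd]]].
  assert (Hbelow : forall y, 0 <= y < m -> Good (path y)).
  { intros y Hy. destruct (classic (exists x, E x /\ y <= x)) as [[x [[Hx1 Hx2] Hxy]]|Hno].
    - apply Hx2; lra.
    - exfalso. assert (m <= y). { apply Hm2. intros x Hx. destruct (Rle_dec x y); auto.
        exfalso; apply Hno; exists x; split; auto; lra. } lra. }
  assert (Hvp : 0 < Cmod v) by now apply Cmod_gt_0.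
  assert (Hpath : forall x y, path y = (path x + RtoC (y - x) * v)%C).
  { intros x y. unfold path. rewrite RtoC_minus. ring. }
  (* Just before the supremum the identity holds, so the difference vanishes on a segment leaving
     [path m] backwards, in the direction - v. *)
  assert (Hzero : forall n, d n = 0).
  { apply (power_series_zero d (- v)%C (Rmin m (r / Cmod v))).
    - apply Rmin_glb_lt. lra. now apply Rdiv_lt_0_compat.
    - intros Ev. apply Hv. replace v with (- - v)%C by ring. rewrite Ev. ring.
    - intros lam Hlam. assert (lam < m) by (eapply Rlt_le_trans; [apply Hlam|apply Rmin_l]).
      assert (lam < r / Cmod v) by (eapply Rlt_le_trans; [apply Hlam|apply Rmin_r]).
      destruct (Hd (RtoC lam * - v)%C) as [L [HL1 HL2]].
      { rewrite Cmod_mult, Cmod_opp, Cmod_RtoC_pos by lra.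
        apply (Rmult_lt_compat_r (Cmod v)) in H0; auto. unfold Rdiv in H0. rewrite Rmult_assoc, Rinv_l in H0; lra. }
      replace (path m + RtoC lam * - v)%C with (path (m - lam)) in HL1, HL2
        by (rewrite (Hpath m (m - lam)); replace (m - lam - m) with (- lam) by ring; rewrite RtoC_opp; ring).
      rewrite (AltSum_unique _ _ _ _ (Hbelow (m - lam) ltac:(lra)) HL1) in HL2.
      now replace (L - L)%C with (RtoC 0) in HL2 by ring. }
  (* With all coefficients 0 the identity holds on the whole disc, hence also at and beyond the
     supremum. *)
  assert (Hnear : forall y, Rabs (y - m) < r / Cmod v -> Good (path y)).
  { intros y Hy. rewrite (Hpath m y). destruct (Hd (RtoC (y - m) * v)%C) as [L [HL1 HL2]].
    - rewrite Cmod_mult, Cmod_R. apply (Rmult_lt_compat_r (Cmod v)) in Hy; auto.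
      unfold Rdiv in Hy. rewrite Rmult_assoc, Rinv_l in Hy; lra.
    - assert (H0 : Cseries (fun k => d k * (RtoC (y - m) * v) ^ k)%C 0).
      { eapply Cseries_ext; [|apply Cseries_zero]. intros k. cbv beta. rewrite Hzero. ring. }
      assert (E1 := Cseries_unique _ _ _ HL2 H0). apply Ceq_minus in E1. unfold Good. rewrite E1. exact HL1. }
  set (e := r / Cmod v / 2).
  assert (He : 0 < e). { unfold e. assert (0 < r / Cmod v) by now apply Rdiv_lt_0_compat. lra. }
  assert (HE1 : E (Rmin 1 (m + e))).
  { assert (0 < Rmin 1 (m + e)) by (apply Rmin_glb_lt; lra).
    assert (Rmin 1 (m + e) <= 1) by apply Rmin_l. assert (Rmin 1 (m + e) <= m + e) by apply Rmin_r.
    split. lra. intros y Hy. destruct (Rlt_le_dec y m). apply Hbelow; lra.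
    apply Hnear. rewrite Rabs_pos_eq by lra. unfold e in *. lra. }
  assert (Hm4 := Hm1 _ HE1).
  assert (m = 1). { unfold Rmin in Hm4; destruct Rle_dec; lra. }
  rewrite <- Hp1. apply HE1. split. lra. apply Rmin_glb; lra.
Qed.

(** In 3 + a, two powers are spent on summability and one on the logarithms of [log_weight]; 1 <= N
    is the same demand at the start of the path. The exponent -1 would call for the value of zeta at
    1, which is left free. *)
Lemma zeta_AltSum_Rpower zeta N a : is_Riemann_zeta zeta -> a <> -1 -> 3 + a <= INR N -> 1 <= INR N ->
  AltSum N (fun t => RtoC (Rpower t a)) (RtoC (1 - Rpower 2 (1 + a)) * zeta (RtoC (- a)))%C.
Proof.
  intros Hz Ha HN HN1.
  eapply AltSum_ext. intros t Ht. apply npow_RtoC.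
  replace (RtoC (1 - Rpower 2 (1 + a))) with (eta_factor (RtoC (- a))).
  apply zeta_alternating; auto; lra.
  rewrite eta_factor_npow, npow_RtoC, RtoC_minus, Rpower_plus, Rpower_1, RtoC_mult by lra. reflexivity.
Qed.

(** * Improper integrals *)

Lemma ball_Rabs (x y eps : R) : ball x eps y -> Rabs (y - x) < eps.
Proof. exact (fun H => H). Qed.

Lemma Rabs_ball (x y eps : R) : Rabs (y - x) < eps -> ball x eps y.
Proof. exact (fun H => H). Qed.

Definition Cimp (f : R -> C) (l : C) : Prop :=
  is_RInt_gen (V := C_R_NormedModule) f (at_point 0) (Rbar_locally p_infty) l.

Lemma Cder_continuous (f : R -> C) t l : Cder f t l -> continuous (U := C_R_NormedModule) f t.
Proof.
  intros [H1 H2].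
  assert (C1 : continuous (fun u => Re (f u)) t) by (apply (ex_derive_continuous (V := R_NormedModule)); now exists (Re l)).
  assert (C2 : continuous (fun u => Im (f u)) t) by (apply (ex_derive_continuous (V := R_NormedModule)); now exists (Im l)).
  apply (continuous_ext (fun u => (Re (f u), Im (f u)))).
  intros u. now destruct (f u).
  apply (filterlim_locally (U := C_R_NormedModule)). intros eps.
  assert (F1 := proj1 (filterlim_locally (U := R_UniformSpace) _ _) C1 eps).
  assert (F2 := proj1 (filterlim_locally (U := R_UniformSpace) _ _) C2 eps).
  generalize (filter_and _ _ F1 F2). apply filter_imp. intros u [A B]. split; assumption.
Qed.

Lemma Cder_RInt (F f : R -> C) a b :
  (forall t, Cder F t (f t)) -> (forall t, exists l, Cder f t l) ->
  is_RInt (V := C_R_NormedModule) f a b (F b - F a)%C.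
Proof.
  intros HF Hf.
  apply (is_RInt_fct_extend_pair (U := R_NormedModule) (V := R_NormedModule) f a b (Re (F b) - Re (F a)) (Im (F b) - Im (F a))).
  - apply (is_RInt_derive (V := R_CompleteNormedModule) (fun t => Re (F t)) (fun t => Re (f t))).
    + intros; apply HF.
    + intros x _. destruct (Hf x) as [l [H _]]. apply (ex_derive_continuous (V := R_NormedModule)). now exists (Re l).
  - apply (is_RInt_derive (V := R_CompleteNormedModule) (fun t => Im (F t)) (fun t => Im (f t))).
    + intros; apply HF.
    + intros x _. destruct (Hf x) as [l [_ H]]. apply (ex_derive_continuous (V := R_NormedModule)). now exists (Im l).
Qed.

Lemma Cimp_of_limit (f Phi : R -> C) l :
  (forall T, is_RInt (V := C_R_NormedModule) f 0 T (Phi T)) ->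
  filterlim (Phi : R -> C_R_NormedModule) (Rbar_locally p_infty) (locally l) -> Cimp f l.
Proof.
  intros HI HL P HP.
  apply (Filter_prod _ _ _ (fun a => a = 0) (fun T => P (Phi T))).
  - reflexivity.
  - apply HL. exact HP.
  - intros a T -> HT. exists (Phi T). split; [apply HI|exact HT].
Qed.

Lemma Cimp_unique f l l' : Cimp f l -> Cimp f l' -> l = l'.
Proof.
  intros H H'.
  rewrite <- (is_RInt_gen_unique (V := C_R_CompleteNormedModule) f l H).
  apply (is_RInt_gen_unique (V := C_R_CompleteNormedModule) f l' H').
Qed.

Lemma Cimp_ext f g l : (forall t, f t = g t) -> Cimp f l -> Cimp g l.
Proof.
  intros E H. refine (is_RInt_gen_ext (V := C_R_NormedModule) f g l _ H).
  apply filter_forall. intros ab x _. apply E.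
Qed.

Lemma Cimp_plus f g l l' : Cimp f l -> Cimp g l' -> Cimp (fun t => f t + g t)%C (l + l')%C.
Proof. intros H H'. exact (is_RInt_gen_plus (V := C_R_NormedModule) f g l l' H H'). Qed.

Lemma Cimp_minus f g l l' : Cimp f l -> Cimp g l' -> Cimp (fun t => f t - g t)%C (l - l')%C.
Proof. intros H H'. exact (is_RInt_gen_minus (V := C_R_NormedModule) f g l l' H H'). Qed.

Lemma Cimp_scal_R (k : R) f l : Cimp f l -> Cimp (fun t => RtoC k * f t)%C (RtoC k * l)%C.
Proof.
  intros H. rewrite <- scal_R_Cmult.
  eapply Cimp_ext; [|exact (is_RInt_gen_scal (V := C_R_NormedModule) f k l H)].
  intros t. apply scal_R_Cmult.
Qed.

Lemma Cimp_lim f l : (forall t, exists l, Cder f t l) -> Cimp f l ->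
  exists Phi : R -> C, (forall T, is_RInt (V := C_R_NormedModule) f 0 T (Phi T)) /\
   filterlim (Phi : R -> C_R_NormedModule) (Rbar_locally p_infty) (locally l).
Proof.
  intros Hf H. 
  assert (Hex : forall a b, ex_RInt (V := C_R_NormedModule) f a b).
  { intros. apply (ex_RInt_continuous (V := C_R_CompleteNormedModule)). intros z _.
    destruct (Hf z) as [d Hd]. now apply (Cder_continuous f z d). }
  exists (fun T => RInt (V := C_R_CompleteNormedModule) f 0 T). split.
  - intros T. apply (RInt_correct (V := C_R_CompleteNormedModule)), Hex.
  - intros P HP. destruct (H P HP) as [Q S HQ HS HQS].
    unfold filtermap. generalize HS. apply filter_imp. intros T HT.
    destruct (HQS 0 T HQ HT) as [y [Hy HPy]].
    now rewrite (is_RInt_unique (V := C_R_CompleteNormedModule) f 0 T y Hy).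
Qed.

(** The majorant is supplied with a primitive: the Cauchy criterion for the integral reduces to that
    for G, and the bound is read off from its limits. *)
Lemma Cimp_dominated (f : R -> C) (G G' : R -> R) (L : R) :
  (forall t, exists l, Cder f t l) ->
  (forall t, 0 <= t -> is_derive G t (G' t)) ->
  (forall t, 0 <= t -> continuous G' t) ->
  (forall t, 0 <= t -> Cmod (f t) <= G' t) ->
  filterlim G (Rbar_locally p_infty) (locally L) ->
  exists l, Cimp f l /\ Cmod l <= L - G 0.
Proof.
  intros Hf HG HG' Hle HL.
  assert (Hex : forall a b, ex_RInt (V := C_R_NormedModule) f a b).
  { intros. apply (ex_RInt_continuous (V := C_R_CompleteNormedModule)). intros z _.
    destruct (Hf z) as [d Hd]. now apply (Cder_continuous f z d). }
  set (Phi := fun T => RInt (V := C_R_CompleteNormedModule) f 0 T).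
  assert (HPhi : forall T, is_RInt (V := C_R_NormedModule) f 0 T (Phi T)).
  { intros T. apply (RInt_correct (V := C_R_CompleteNormedModule)), Hex. }
  assert (Hd : forall a b, 0 <= a <= b -> Cmod (Phi b - Phi a)%C <= G b - G a).
  { intros a b Hab.
    assert (HI : is_RInt (V := C_R_NormedModule) f a b (Phi b - Phi a)%C).
    { assert (H1 := is_RInt_Chasles _ _ _ _ _ _ (is_RInt_swap _ _ _ _ (HPhi a)) (HPhi b)).
      replace (Phi b - Phi a)%C with (plus (opp (Phi a : C_R_NormedModule)) (Phi b)); auto.
      change (- Phi a + Phi b = Phi b - Phi a)%C. ring. }
    rewrite Cmod_norm. refine (norm_RInt_le (V := C_R_NormedModule) f G' a b _ _ (proj2 Hab) _ HI _).
    - intros x Hx. rewrite <- Cmod_norm. apply Hle. lra.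
    - apply (is_RInt_derive (V := R_CompleteNormedModule) G G').
      intros x Hx; apply HG. rewrite Rmin_left in Hx by lra. lra.
      intros x Hx; apply HG'. rewrite Rmin_left in Hx by lra. lra. }
  destruct (proj1 (filterlim_locally_cauchy (U := C_R_CompleteNormedModule) (F := Rbar_locally p_infty) Phi)) as [l Hl].
  { intros eps. 
    assert (He : 0 < eps / 2) by (generalize (cond_pos eps); lra).
    destruct (proj1 (filterlim_locally (U := R_UniformSpace) _ _) HL (mkposreal _ He)) as [M HM].
    exists (fun T => Rmax 0 M < T). split. now exists (Rmax 0 M).
    assert (Hw : forall u v, Rmax 0 M < u -> u <= v -> Cmod (Phi v - Phi u)%C < eps).
    { intros u v Hu Hv.
      assert (0 < u) by (eapply Rle_lt_trans; [apply Rmax_l|apply Hu]).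
      assert (M < u) by (eapply Rle_lt_trans; [apply Rmax_r|apply Hu]).
      eapply Rle_lt_trans. apply Hd; lra.
      assert (B1 := HM u H0). assert (B2 := HM v ltac:(lra)).
      apply ball_Rabs in B1; simpl in B1. apply ball_Rabs in B2; simpl in B2.
      apply Rabs_def2 in B1. apply Rabs_def2 in B2. lra. }
    intros u v Hu Hv. apply C_NormedModule_mixin_compat1.
    destruct (Rle_lt_dec u v). now apply Hw.
    change (Cmod (Phi v - Phi u)%C < eps). rewrite Cmod_minus_sym. apply Hw; auto. lra. }
  exists l. split. now apply Cimp_of_limit with Phi.
  apply (filterlim_le (F := Rbar_locally p_infty) (fun T => Cmod (Phi T)) (fun T => G T - G 0) (Cmod l) (L - G 0)).
  - exists 0. intros T HT.
    assert (E : Phi 0 = RtoC 0). { unfold Phi. rewrite RInt_point. reflexivity. }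
    generalize (Hd 0 T ltac:(lra)). rewrite E. assert (E1 : (Phi T - RtoC 0)%C = Phi T) by (apply C_ext; autorewrite with reim; ring). now rewrite E1.
  - apply (filterlim_comp _ _ _ Phi Cmod _ (locally l)); [exact Hl|].
    exact (filterlim_norm (K := C_AbsRing) (V := C_NormedModule) l).
  - apply (filterlim_comp _ _ _ G (fun x => x - G 0) _ (locally L)); auto.
    apply (continuous_minus (V := R_NormedModule) (fun x => x) (fun _ => G 0)).
    apply continuous_id. apply continuous_const.
Qed.

(** From ln w <= w at w = y / (4 m). *)
Lemma Rpower_le_exp m y : 0 < m -> 0 < y -> Rpower y m <= Rpower (4 * m) m * exp (y / 4).
Proof.
  intros Hm Hy. unfold Rpower. rewrite <- exp_plus.
  assert (m * ln y <= m * ln (4 * m) + y / 4).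
  { assert (Hw : 0 < y / (4 * m)) by (apply Rdiv_lt_0_compat; lra).
    assert (H : ln (y / (4 * m)) <= y / (4 * m)).
    { generalize (exp_ineq1_le (ln (y / (4 * m)))). rewrite exp_ln by auto. lra. }
    unfold Rdiv in H at 1. rewrite ln_mult, ln_Rinv in H; try lra. 2: apply Rinv_0_lt_compat; lra.
    apply (Rmult_le_compat_l m) in H; [|lra].
    replace (m * (y / (4 * m))) with (y / 4) in H by (field; lra). lra. }
  destruct H. left; now apply exp_increasing. right; now f_equal.
Qed.

(** Chosen so that (1 + y^m)^2 <= [bessel_const m] exp (y/2): square the inequality 1 + y^m <= (1 +
    (4m)^m) exp (y/4). *)
Definition bessel_const (m : R) : R := (1 + Rpower (4 * m) m) ^ 2.

Lemma bessel_const_pos m : 0 < bessel_const m.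
Proof. apply pow_lt. generalize (Rpower_pos (4 * m) m). lra. Qed.

Lemma exp_half_majorant m y : 0 < m -> 0 < y -> exp (- (y / 2)) <= bessel_const m / (1 + Rpower y m) ^ 2.
Proof.
  intros Hm Hy. assert (H := Rpower_le_exp m y Hm Hy).
  assert (H1 := Rpower_pos y m). assert (H2 := Rpower_pos (4 * m) m).
  assert (H3 : 1 <= exp (y / 4)) by (rewrite <- exp_0; left; apply exp_increasing; lra).
  assert (H4 : (1 + Rpower y m) ^ 2 <= bessel_const m * exp (y / 2)).
  { replace (y / 2) with (y / 4 + y / 4) by field. rewrite exp_plus. unfold bessel_const.
    replace ((1 + Rpower (4 * m) m) ^ 2 * (exp (y / 4) * exp (y / 4))) with (((1 + Rpower (4 * m) m) * exp (y / 4)) ^ 2) by ring.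
    apply pow_incr. split. lra. nra. }
  rewrite exp_Ropp. apply Rmult_le_reg_r with ((1 + Rpower y m) ^ 2). apply pow_lt; lra.
  unfold Rdiv. rewrite Rmult_assoc, Rinv_l, Rmult_1_r. 2: apply pow_nonzero; lra.
  assert (H5 := exp_pos (y / 2)).
  apply Rmult_le_reg_l with (exp (y / 2)); auto. rewrite <- Rmult_assoc, Rinv_r by lra. lra.
Qed.

(* The majorant is an exact derivative: with [y = x e^t],
   [e^(mt) / (1 + y^m)^2] integrates to a multiple of [1 / (1 + y^m)]. *)
Lemma Cimp_exp_dominated (f : R -> C) A m x : 0 <= A -> 0 < m -> 0 < x ->
  (forall t, exists l, Cder f t l) ->
  (forall t, 0 <= t -> Cmod (f t) <= A * (exp (m * t) * exp (- (x * exp t / 2)))) ->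
  exists l, Cimp f l /\ Cmod l <= A * (bessel_const m / m) * Rpower x (- m).
Proof.
  intros HA Hm Hx Hf Hle. set (X := Rpower x m). assert (HX : 0 < X) by apply Rpower_pos.
  set (c := A * bessel_const m).
  assert (Hc : 0 <= c). { unfold c. generalize (bessel_const_pos m). nra. }
  assert (Hden : forall t, 0 < 1 + X * exp (m * t)). { intros t. generalize (exp_pos (m * t)). nra. }
  destruct (Cimp_dominated f (fun t => - (c / (m * X)) / (1 + X * exp (m * t)))
    (fun t => c * exp (m * t) / (1 + X * exp (m * t)) ^ 2) 0) as [l [Hl Hl']]; auto.
  - intros t Ht. specialize (Hden t). auto_derive. lra. field. split; lra.
  - intros t Ht. apply (ex_derive_continuous (V := R_NormedModule)). auto_derive.
    specialize (Hden t). apply Rgt_not_eq. rewrite Rmult_1_r. now apply Rmult_lt_0_compat.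
  - intros t Ht. eapply Rle_trans. apply Hle; auto. unfold c.
    replace (A * bessel_const m * exp (m * t) / (1 + X * exp (m * t)) ^ 2)
      with (A * (exp (m * t) * (bessel_const m / (1 + X * exp (m * t)) ^ 2))) by (unfold Rdiv; ring).
    apply Rmult_le_compat_l; auto. apply Rmult_le_compat_l. left; apply exp_pos.
    replace (X * exp (m * t)) with (Rpower (x * exp t) m).
    apply exp_half_majorant; auto. apply Rmult_lt_0_compat; auto. apply exp_pos.
    rewrite <- Rpower_mult_distr; auto. 2: apply exp_pos. unfold X. f_equal.
    unfold Rpower. now rewrite ln_exp.
  - assert (HL : is_lim (fun t => - (c / (m * X)) / (1 + X * exp (m * t))) p_infty 0).
    { apply is_lim_le_le_loc with (fun t => - (c / (m * X)) / X * exp (- (m * t))) (fun _ => 0).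
      - exists 0. intros t Ht. assert (HE := exp_pos (m * t)). specialize (Hden t).
        assert (Hc0 : 0 <= c / (m * X)). { apply Rmult_le_pos; auto. left; apply Rinv_0_lt_compat; nra. }
        rewrite exp_Ropp. set (a := c / (m * X)) in *.
        replace (- a / (1 + X * exp (m * t))) with (- (a * / (1 + X * exp (m * t)))) by (unfold Rdiv; ring).
        assert (0 < / (1 + X * exp (m * t))) by now apply Rinv_0_lt_compat.
        split; [|nra].
        replace (- a / X * / exp (m * t)) with (- (a * / (X * exp (m * t)))) by (field; lra).
        apply Ropp_le_contravar, Rmult_le_compat_l; auto. apply Rinv_le_contravar; nra.
      - evar_last. apply is_lim_scal_l. apply is_lim_comp with m_infty. apply is_lim_exp_m.
        evar_last. apply is_lim_opp. apply is_lim_scal_l. apply is_lim_id.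
        simpl. destruct Rle_dec; [|lra]. destruct Rle_lt_or_eq_dec; [|lra]. reflexivity.
        exists 0. intros; discriminate. simpl. f_equal. ring.
      - apply is_lim_const. }
    exact HL.
  - exists l. split; auto. eapply Rle_trans; [apply Hl'|].
    rewrite Rmult_0_r, exp_0, Rmult_1_r, Rpower_Ropp. fold X. unfold c.
    assert (H := bessel_const_pos m).
    replace (0 - - (A * bessel_const m / (m * X)) / (1 + X)) with (A * (bessel_const m / m) * / X * / (1 + X)) by (field; repeat split; lra).
    rewrite <- (Rmult_1_r (A * (bessel_const m / m) * / X)) at 2.
    apply Rmult_le_compat_l. apply Rmult_le_pos. apply Rmult_le_pos; auto. left; now apply Rdiv_lt_0_compat.
    left; now apply Rinv_0_lt_compat. rewrite <- Rinv_1. apply Rinv_le_contravar; lra.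
Qed.

(** * The Bessel function *)

Lemma Cder_epsilon (f : R -> C) t l :
  (forall eps, 0 < eps -> exists d, 0 < d /\ forall h, Rabs h < d ->
     Cmod (f (t + h)%R - f t - RtoC h * l)%C <= eps * Rabs h) -> Cder f t l.
Proof.
  intros H.
  assert (HH : forall (p : C -> R), (forall z, Rabs (p z) <= Cmod z) ->
    (forall z w, p (z - w)%C = p z - p w) -> (forall (x : R) z, p (RtoC x * z)%C = x * p z) ->
    is_derive (fun u => p (f u)) t (p l)).
  { intros p Hp Hs Hm. apply is_derive_Reals. intros eps Heps.
    destruct (H (eps / 2) ltac:(lra)) as [d [Hd Hd']]. exists (mkposreal d Hd).
    intros h Hh0 Hh. specialize (Hd' h Hh).
    assert (E : (p (f (t + h)) - p (f t)) / h - p l = p (f (t + h)%R - f t - RtoC h * l)%C / h).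
    { rewrite !Hs, Hm. field. auto. }
    rewrite E. unfold Rdiv. rewrite Rabs_mult, Rabs_inv.
    assert (0 < Rabs h) by now apply Rabs_pos_lt.
    apply Rmult_lt_reg_r with (Rabs h); auto. rewrite Rmult_assoc, Rinv_l, Rmult_1_r by lra.
    eapply Rle_lt_trans; [apply Hp|]. nra. }
  split.
  - apply HH. apply re_le_Cmod. reflexivity. apply re_scal_l.
  - apply HH. apply im_le_Cmod. reflexivity. apply im_scal_l.
Qed.

Lemma Cder_epsilon_inv (f : R -> C) t l : Cder f t l ->
  forall eps, 0 < eps -> exists d, 0 < d /\ forall h, Rabs h < d ->
     Cmod (f (t + h)%R - f t - RtoC h * l)%C <= eps * Rabs h.
Proof.
  intros [H1 H2] eps Heps. apply is_derive_Reals in H1. apply is_derive_Reals in H2.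
  destruct (H1 (eps / 2) ltac:(lra)) as [d1 Hd1]. destruct (H2 (eps / 2) ltac:(lra)) as [d2 Hd2].
  assert (Hd : 0 < Rmin d1 d2) by (apply Rmin_glb_lt; apply cond_pos).
  exists (Rmin d1 d2). split; auto. intros h Hh.
  destruct (Req_dec h 0) as [->|Hh0].
  - rewrite Rplus_0_r, Rabs_R0. replace (f t - f t - 0 * l)%C with (RtoC 0) by ring. rewrite Cmod_0. lra.
  - assert (Hp : 0 < Rabs h) by now apply Rabs_pos_lt.
    specialize (Hd1 h Hh0 ltac:(eapply Rlt_le_trans; [apply Hh|apply Rmin_l])).
    specialize (Hd2 h Hh0 ltac:(eapply Rlt_le_trans; [apply Hh|apply Rmin_r])).
    eapply Rle_trans; [apply Cmod_le_abs|]. rewrite !Re_minus, !Im_minus, re_scal_l, im_scal_l.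
    assert (HA : forall x y : R, Rabs ((x - y) / h - 0) = Rabs ((x - y) / h)) by (intros; f_equal; ring).
    assert (HB : forall a b c : R, Rabs ((a - b) / h - c) < eps / 2 -> Rabs (a - b - h * c) <= eps / 2 * Rabs h).
    { intros a b c Hab. replace (a - b - h * c) with (((a - b) / h - c) * h) by (field; auto).
      rewrite Rabs_mult. apply Rmult_le_compat_r; lra. }
    generalize (HB _ _ _ Hd1) (HB _ _ _ Hd2). lra.
Qed.

(** A chain rule in which complex differentiability of K appears as a first-order expansion with
    quadratic error. The increment of h is limited so that the point stays in the disc and each of
    the two error terms is at most half of eps |h|. *)
Lemma Cder_comp_quadratic (K : C -> C) (D : C) (z : R -> C) t z' Cq rho : 0 < rho -> 0 <= Cq ->
  (forall h, Cmod h <= rho -> Cmod (K (z t + h) - K (z t) - h * D)%C <= Cq * Cmod h ^ 2) ->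
  Cder z t z' -> Cder (fun u => K (z u)) t (z' * D)%C.
Proof.
  intros Hrho HCq HK Hz. apply Cder_epsilon. intros eps Heps.
  set (e1 := Rmin 1 (eps / (2 * (1 + Cmod D)))).
  assert (HD := Cmod_ge_0 D). assert (Hz' := Cmod_ge_0 z').
  assert (He1 : 0 < e1). { apply Rmin_glb_lt. lra. apply Rdiv_lt_0_compat; lra. }
  assert (He2 : e1 <= 1) by apply Rmin_l.
  assert (He3 : e1 * Cmod D <= eps / 2).
  { assert (e1 <= eps / (2 * (1 + Cmod D))) by apply Rmin_r.
    apply (Rmult_le_compat_r (1 + Cmod D)) in H; [|lra].
    replace (eps / (2 * (1 + Cmod D)) * (1 + Cmod D)) with (eps / 2) in H by (field; lra). nra. }
  destruct (Cder_epsilon_inv z t z' Hz e1 He1) as [d [Hd Hd']].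
  set (B := 1 + Cmod z').
  exists (Rmin d (Rmin (rho / B) (eps / (2 * (1 + Cq) * B ^ 2)))).
  assert (HB : 1 <= B) by (unfold B; lra).
  assert (HB2 : 1 <= B ^ 2) by nra.
  split.
  { repeat apply Rmin_glb_lt; auto; apply Rdiv_lt_0_compat; try lra. nra. }
  intros h Hh.
  assert (Hh1 : Rabs h < d) by (eapply Rlt_le_trans; [apply Hh|apply Rmin_l]).
  assert (Hh2 : Rabs h < rho / B) by (eapply Rlt_le_trans; [apply Hh|eapply Rle_trans; [apply Rmin_r|apply Rmin_l]]).
  assert (Hh3 : Rabs h < eps / (2 * (1 + Cq) * B ^ 2)) by (eapply Rlt_le_trans; [apply Hh|eapply Rle_trans; [apply Rmin_r|apply Rmin_r]]).
  specialize (Hd' h Hh1). assert (Hp := Rabs_pos h).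
  set (k := (z (t + h)%R - z t)%C) in *.
  assert (Hk : Cmod k <= B * Rabs h).
  { replace k with ((k - RtoC h * z') + RtoC h * z')%C by ring.
    eapply Rle_trans; [apply Cmod_triangle|]. rewrite Cmod_mult, Cmod_R. unfold B. nra. }
  assert (Hkr : Cmod k <= rho).
  { apply (Rmult_lt_compat_r B) in Hh2; [|lra]. unfold Rdiv in Hh2. rewrite Rmult_assoc, Rinv_l in Hh2; lra. }
  specialize (HK k Hkr).
  replace (z t + k)%C with (z (t + h)%R) in HK by (unfold k; ring).
  replace (K (z (t + h)%R) - K (z t) - RtoC h * (z' * D))%C with
    ((K (z (t + h)%R) - K (z t) - k * D) + (k - RtoC h * z') * D)%C by ring.
  eapply Rle_trans; [apply Cmod_triangle|]. rewrite (Cmod_mult _ D).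
  assert (Hsq : Cmod k ^ 2 <= B ^ 2 * Rabs h * Rabs h).
  { apply Rle_trans with ((B * Rabs h) ^ 2). apply pow_incr; split; auto; apply Cmod_ge_0. right; ring. }
  assert (H1 : Cq * Cmod k ^ 2 <= eps / 2 * Rabs h).
  { apply Rle_trans with (Cq * (B ^ 2 * Rabs h * Rabs h)). apply Rmult_le_compat_l; auto.
    assert (HY : 0 < 2 * (1 + Cq) * B ^ 2) by nra.
    apply (Rmult_lt_compat_r _ _ _ HY) in Hh3.
    replace (eps / (2 * (1 + Cq) * B ^ 2) * (2 * (1 + Cq) * B ^ 2)) with eps in Hh3 by (field; lra).
    replace (Cq * (B ^ 2 * Rabs h * Rabs h)) with ((Cq * (B ^ 2 * Rabs h)) * Rabs h) by ring.
    apply Rmult_le_compat_r; auto. nra. }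
  assert (Cmod (k - RtoC h * z')%C * Cmod D <= e1 * Rabs h * Cmod D) by (apply Rmult_le_compat_r; auto).
  assert (e1 * Rabs h * Cmod D <= eps / 2 * Rabs h).
  { replace (e1 * Rabs h * Cmod D) with (e1 * Cmod D * Rabs h) by ring. apply Rmult_le_compat_r; auto. }
  lra.
Qed.

(** The integral is that of C as a real vector space, so a complex factor has to be carried through
    the components and the limit. *)
Lemma Cimp_scal c f l : (forall t, exists l, Cder f t l) -> Cimp f l -> Cimp (fun t => c * f t)%C (c * l)%C.
Proof.
  intros Hf H. destruct (Cimp_lim f l Hf H) as [Phi [H1 H2]].
  apply Cimp_of_limit with (fun T => c * Phi T)%C.
  - intros T. specialize (H1 T).
    assert (HR : is_RInt (V := R_NormedModule) (fun t => Re (f t)) 0 T (Re (Phi T)))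
      by exact (is_RInt_fct_extend_fst (U := R_NormedModule) (V := R_NormedModule) f 0 T (Phi T) H1).
    assert (HI : is_RInt (V := R_NormedModule) (fun t => Im (f t)) 0 T (Im (Phi T)))
      by exact (is_RInt_fct_extend_snd (U := R_NormedModule) (V := R_NormedModule) f 0 T (Phi T) H1).
    apply (is_RInt_fct_extend_pair (U := R_NormedModule) (V := R_NormedModule) _ 0 T (Re (c * Phi T)%C) (Im (c * Phi T)%C)).
    + exact (is_RInt_minus _ _ _ _ _ _ (is_RInt_scal _ _ _ (Re c) _ HR) (is_RInt_scal _ _ _ (Im c) _ HI)).
    + exact (is_RInt_plus _ _ _ _ _ _ (is_RInt_scal _ _ _ (Re c) _ HI) (is_RInt_scal _ _ _ (Im c) _ HR)).
  - eapply filterlim_comp. apply H2. exact (filterlim_scal_r (V := C_NormedModule) c l).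
Qed.

Lemma exp_le_exp x y : x <= y -> exp x <= exp y.
Proof. intros [H| ->]. left; now apply exp_increasing. right; auto. Qed.

Lemma is_derive_cosh t : is_derive cosh t (sinh t).
Proof. unfold cosh, sinh. auto_derive; auto. field. Qed.

Lemma is_derive_cosh_scal nu t : is_derive (fun u => cosh (nu * u)) t (nu * sinh (nu * t)).
Proof. unfold cosh, sinh. auto_derive; auto. field. Qed.

Lemma is_derive_sinh_scal nu t : is_derive (fun u => sinh (nu * u)) t (nu * cosh (nu * t)).
Proof. unfold cosh, sinh. auto_derive; auto. field. Qed.

Lemma cosh_ge_half t : exp t / 2 <= cosh t.
Proof. unfold cosh. generalize (exp_pos (- t)). lra. Qed.

Lemma cosh_le_exp nu m t : Rabs nu <= m -> 0 <= t -> 0 <= cosh (nu * t) <= exp (m * t).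
Proof.
  intros Hm Ht. unfold cosh.
  assert (H : Rabs nu * t <= m * t) by now apply Rmult_le_compat_r.
  assert (nu * t <= m * t /\ - (nu * t) <= m * t).
  { generalize (Rle_abs nu) (Rle_abs (- nu)). rewrite Rabs_Ropp. nra. }
  generalize (exp_le_exp _ _ (proj1 H0)) (exp_le_exp _ _ (proj2 H0)) (exp_pos (nu * t)) (exp_pos (- (nu * t))). lra.
Qed.

Lemma sinh_le_exp nu m t : Rabs nu <= m -> 0 <= t -> Rabs (sinh (nu * t)) <= exp (m * t).
Proof.
  intros Hm Ht. unfold sinh.
  assert (H : Rabs nu * t <= m * t) by now apply Rmult_le_compat_r.
  assert (nu * t <= m * t /\ - (nu * t) <= m * t).
  { generalize (Rle_abs nu) (Rle_abs (- nu)). rewrite Rabs_Ropp. nra. }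
  generalize (exp_le_exp _ _ (proj1 H0)) (exp_le_exp _ _ (proj2 H0)) (exp_pos (nu * t)) (exp_pos (- (nu * t))).
  intros. apply Rabs_le. lra.
Qed.

Lemma cosh_pos t : 0 < cosh t.
Proof. unfold cosh. generalize (exp_pos t) (exp_pos (- t)). lra. Qed.

Definition bessel_integrand (nu : R) (z : C) (t : R) : C := (Cexp (- z * RtoC (cosh t)) * RtoC (cosh (nu * t)))%C.

Lemma Cder_exp_cosh z t :
  Cder (fun u => Cexp (- z * RtoC (cosh u))) t (- z * RtoC (sinh t) * Cexp (- z * RtoC (cosh t)))%C.
Proof. apply Cder_Cexp, Cder_scal, Cder_RtoC, is_derive_cosh. Qed.

Lemma bessel_integrand_smooth nu z t : exists l, Cder (bessel_integrand nu z) t l.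
Proof.
  eexists. apply Cder_mult. apply Cder_exp_cosh. apply Cder_RtoC, is_derive_cosh_scal.
Qed.

Lemma Cmod_exp_cosh z t : 0 < Re z -> Cmod (Cexp (- z * RtoC (cosh t))) <= exp (- (Re z * exp t / 2)).
Proof.
  intros Hz. rewrite Cmod_Cexp, re_scal_r, Re_opp. apply exp_le_exp.
  generalize (cosh_ge_half t). nra.
Qed.

(** The free exponent m gives the true order at the origin for m = |nu| (nonzero nu), and any
    prescribed polynomial decay at infinity for large m. *)
Lemma Cimp_BesselK nu z m : 0 < m -> Rabs nu <= m -> 0 < Re z ->
  Cimp (bessel_integrand nu z) (BesselK nu z) /\
  Cmod (BesselK nu z) <= (bessel_const m / m) * Rpower (Re z) (- m).
Proof.
  intros Hm Hnu Hz.
  destruct (Cimp_exp_dominated (bessel_integrand nu z) 1 m (Re z)) as [l [Hl Hl']]; auto; try lra.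
  - apply bessel_integrand_smooth.
  - intros t Ht. unfold bessel_integrand. rewrite Cmod_mult, Rmult_1_l, Rmult_comm.
    destruct (cosh_le_exp nu m t Hnu Ht). rewrite (Cmod_RtoC_pos (cosh (nu * t))) by auto.
    apply Rmult_le_compat; auto. apply Cmod_ge_0. now apply Cmod_exp_cosh.
  - assert (E : BesselK nu z = l) by exact (is_RInt_gen_unique (V := C_R_CompleteNormedModule) _ l Hl).
    rewrite E. split; auto. now rewrite Rmult_1_l in Hl'.
Qed.

Lemma BesselK_integral nu z : 0 < Re z -> Cimp (bessel_integrand nu z) (BesselK nu z).
Proof.
  intros Hz. apply (Cimp_BesselK nu z (Rabs nu + 1)); auto; generalize (Rabs_pos nu); lra.
Qed.

Lemma BesselK_bound nu z m : 0 < m -> Rabs nu <= m -> 0 < Re z ->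
  Cmod (BesselK nu z) <= (bessel_const m / m) * Rpower (Re z) (- m).
Proof. intros. now apply Cimp_BesselK. Qed.

Lemma BesselK_even nu z : 0 < Re z -> BesselK (- nu) z = BesselK nu z.
Proof.
  intros Hz. apply (Cimp_unique (bessel_integrand nu z)); [|now apply BesselK_integral].
  apply (Cimp_ext (bessel_integrand (- nu) z)); [|now apply BesselK_integral].
  intros t. unfold bessel_integrand. do 2 f_equal. unfold cosh.
  replace (- nu * t) with (- (nu * t)) by ring. rewrite Ropp_involutive. field.
Qed.

(** The classical formula for the derivative, written down before differentiability is known. *)
Definition dBesselK (nu : R) (z : C) : C := (- (RtoC (/ 2) * (BesselK (nu - 1) z + BesselK (nu + 1) z)))%C.

Lemma cosh_mul_cosh nu t : cosh t * cosh (nu * t) = / 2 * (cosh ((nu - 1) * t) + cosh ((nu + 1) * t)).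
Proof.
  unfold cosh. replace ((nu - 1) * t) with (nu * t + - t) by ring.
  replace ((nu + 1) * t) with (nu * t + t) by ring.
  replace (- (nu * t + - t)) with (- (nu * t) + t) by ring.
  replace (- (nu * t + t)) with (- (nu * t) + - t) by ring.
  rewrite !exp_plus. field.
Qed.

Lemma sinh_mul_sinh nu t : sinh t * sinh (nu * t) = / 2 * (cosh ((nu + 1) * t) - cosh ((nu - 1) * t)).
Proof.
  unfold cosh, sinh. replace ((nu - 1) * t) with (nu * t + - t) by ring.
  replace ((nu + 1) * t) with (nu * t + t) by ring.
  replace (- (nu * t + - t)) with (- (nu * t) + t) by ring.
  replace (- (nu * t + t)) with (- (nu * t) + - t) by ring.
  rewrite !exp_plus. field.
Qed.

Lemma dBesselK_integral nu z : 0 < Re z ->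
  Cimp (fun t => - (RtoC (cosh t) * bessel_integrand nu z t))%C (dBesselK nu z).
Proof.
  intros Hz. unfold dBesselK.
  replace (- (RtoC (/ 2) * (BesselK (nu - 1) z + BesselK (nu + 1) z)))%C
    with (RtoC (- / 2) * (BesselK (nu - 1) z + BesselK (nu + 1) z))%C by (rewrite RtoC_opp; ring).
  eapply Cimp_ext; [|apply Cimp_scal_R, Cimp_plus; apply BesselK_integral; auto].
  intros t. unfold bessel_integrand. cbv beta. rewrite RtoC_opp.
  transitivity (- ((RtoC (/ 2) * (RtoC (cosh ((nu - 1) * t)) + RtoC (cosh ((nu + 1) * t)))) * Cexp (- z * RtoC (cosh t))))%C.
  ring. rewrite <- RtoC_plus, <- RtoC_mult, <- cosh_mul_cosh, RtoC_mult. ring.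
Qed.

(** Differentiation under the integral: the second-order Taylor remainder of the exponential costs a
    factor cosh^2 t, hence m = |nu| + 2, and the growth exp (|h| cosh t) is absorbed by half of the
    decay when |h| <= Re z / 2. *)
Lemma BesselK_quadratic nu z : 0 < Re z -> exists Cq, 0 <= Cq /\ forall h, Cmod h <= Re z / 2 ->
  Cmod (BesselK nu (z + h) - BesselK nu z - h * dBesselK nu z)%C <= Cq * Cmod h ^ 2.
Proof.
  intros Hz. set (m := Rabs nu + 2). assert (Hm : 0 < m) by (unfold m; generalize (Rabs_pos nu); lra).
  exists ((bessel_const m / m) * Rpower (Re z / 2) (- m)). split.
  { apply Rmult_le_pos. left; apply Rdiv_lt_0_compat; auto; apply bessel_const_pos. left; apply Rpower_pos. }
  intros h Hh. assert (Hh' := re_le_Cmod h).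
  assert (Hzh : 0 < Re (z + h)%C). { rewrite Re_plus. unfold Rabs in Hh'; destruct Rcase_abs; lra. }
  assert (Hsm : forall t, exists l, Cder (fun t => - (RtoC (cosh t) * bessel_integrand nu z t))%C t l).
  { intros t. destruct (bessel_integrand_smooth nu z t) as [l Hl]. eexists.
    apply Cder_opp, Cder_mult. apply Cder_RtoC, is_derive_cosh. apply Hl. }
  assert (HI := Cimp_minus _ _ _ _ (Cimp_minus _ _ _ _ (BesselK_integral nu _ Hzh) (BesselK_integral nu _ Hz))
    (Cimp_scal h _ _ Hsm (dBesselK_integral nu z Hz))).
  cbv beta in HI.
  destruct (Cimp_exp_dominated (fun t => bessel_integrand nu (z + h) t - bessel_integrand nu z t
     - h * - (RtoC (cosh t) * bessel_integrand nu z t))%C (Cmod h ^ 2) m (Re z / 2)) as [l [Hl Hl']]; auto.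
  - apply pow2_ge_0.
  - lra.
  - intros t. destruct (bessel_integrand_smooth nu (z + h) t) as [l1 Hl1].
    destruct (bessel_integrand_smooth nu z t) as [l2 Hl2]. destruct (Hsm t) as [l3 Hl3].
    eexists. apply Cder_minus; [apply Cder_minus; eassumption|]. apply Cder_scal, Hl3.
  - intros t Ht. unfold bessel_integrand.
    set (c := cosh t). assert (Hc : 0 < c) by apply cosh_pos.
    replace (- (z + h) * RtoC c)%C with (- z * RtoC c + - h * RtoC c)%C by ring. rewrite Cexp_plus.
    replace (_ - _ - _)%C with (Cexp (- z * RtoC c) * (Cexp (- h * RtoC c) - 1 - (- h * RtoC c)) * RtoC (cosh (nu * t)))%C by ring.
    rewrite !Cmod_mult.
    destruct (cosh_le_exp nu (Rabs nu) t (Rle_refl _) Ht) as [Hn1 Hn2]. rewrite (Cmod_RtoC_pos (cosh (nu * t))) by auto.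
    assert (Q := Cexp_quadratic (- h * RtoC c)%C). rewrite Cmod_mult, Cmod_opp, Cmod_RtoC_pos in Q by lra.
    rewrite Cmod_Cexp, re_scal_r, Re_opp.
    assert (Hch : 0 <= Cmod h) by apply Cmod_ge_0.
    assert (Hc2 : c <= exp t). { unfold c. replace t with (1 * t) by ring. 
      eapply Rle_trans; [apply (cosh_le_exp 1 1); [rewrite Rabs_R1; lra|auto]|]. apply exp_le_exp; lra. }
    apply Rle_trans with (exp (- Re z * c) * ((Cmod h * c) ^ 2 * exp (Cmod h * c)) * exp (Rabs nu * t)).
    { apply Rmult_le_compat; auto. apply Rmult_le_pos. left; apply exp_pos. apply Cmod_ge_0.
      apply Rmult_le_compat_l. left; apply exp_pos. apply Q. }
    replace (exp (- Re z * c) * ((Cmod h * c) ^ 2 * exp (Cmod h * c)) * exp (Rabs nu * t))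
      with (Cmod h ^ 2 * (c ^ 2 * exp (Rabs nu * t) * (exp (- Re z * c) * exp (Cmod h * c)))) by ring.
    apply Rmult_le_compat_l. apply pow2_ge_0.
    apply Rmult_le_compat.
    + apply Rmult_le_pos. apply pow2_ge_0. left; apply exp_pos.
    + apply Rmult_le_pos; left; apply exp_pos.
    + replace (m * t) with (t + t + Rabs nu * t) by (unfold m; ring). rewrite !exp_plus.
      apply Rmult_le_compat_r. left; apply exp_pos. simpl. rewrite Rmult_1_r. apply Rmult_le_compat; lra.
    + rewrite <- exp_plus. apply exp_le_exp. generalize (cosh_ge_half t). fold c. nra.
  - rewrite (Cimp_unique _ _ _ HI Hl). eapply Rle_trans; [apply Hl'|]. right; ring.
Qed.

Lemma exp_half_le m y : 0 < m -> 0 < y -> exp (- (y / 2)) <= bessel_const m * Rpower y (- m).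
Proof.
  intros Hm Hy. eapply Rle_trans. apply (exp_half_majorant m y Hm Hy).
  rewrite Rpower_Ropp. unfold Rdiv. apply Rmult_le_compat_l. left; apply bessel_const_pos.
  assert (H := Rpower_pos y m). apply Rinv_le_contravar; nra.
Qed.

Lemma filterlim_C_zero (F : R -> C) (u : R -> R) :
  is_lim u p_infty 0 -> (forall T, 0 <= T -> Cmod (F T) <= u T) ->
  filterlim (F : R -> C_R_NormedModule) (Rbar_locally p_infty) (locally (RtoC 0)).
Proof.
  intros Hu HF. apply (filterlim_locally (U := C_R_NormedModule)). intros eps.
  apply is_lim_spec in Hu. destruct (Hu eps) as [M HM].
  exists (Rmax 0 M). intros T HT.
  assert (0 < T) by (eapply Rle_lt_trans; [apply Rmax_l|apply HT]).
  assert (M < T) by (eapply Rle_lt_trans; [apply Rmax_r|apply HT]).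
  apply C_NormedModule_mixin_compat1. change (Cmod (F T - RtoC 0)%C < eps).
  replace (F T - RtoC 0)%C with (F T) by ring.
  eapply Rle_lt_trans; [apply HF; lra|]. specialize (HM T H0). rewrite Rminus_0_r in HM.
  eapply Rle_lt_trans; [apply Rle_abs|apply HM].
Qed.

(** The integral over the half-line of the derivative of exp (- z cosh t) sinh (nu t) is 0: this
    function vanishes at 0 and tends to 0 at infinity. *)
Lemma BesselK_recurrence nu z : 0 < Re z ->
  (z * (BesselK (nu + 1) z - BesselK (nu - 1) z) = RtoC (2 * nu) * BesselK nu z)%C.
Proof.
  intros Hz.
  set (F := fun t => (Cexp (- z * RtoC (cosh t)) * RtoC (sinh (nu * t)))%C).
  set (f := fun t => ((- z * RtoC (/ 2)) * (bessel_integrand (nu + 1) z t - bessel_integrand (nu - 1) z t)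
     + RtoC nu * bessel_integrand nu z t)%C).
  assert (HF : forall t, Cder F t (f t)).
  { intros t. unfold F, f. eapply Cder_eq. apply Cder_mult. apply Cder_exp_cosh. apply Cder_RtoC, is_derive_sinh_scal.
    cbv beta. unfold bessel_integrand.
    transitivity (- z * (RtoC (sinh t) * RtoC (sinh (nu * t))) * Cexp (- z * RtoC (cosh t))
      + RtoC nu * (Cexp (- z * RtoC (cosh t)) * RtoC (cosh (nu * t))))%C.
    rewrite RtoC_mult. ring. rewrite <- RtoC_mult, sinh_mul_sinh, RtoC_mult, RtoC_minus. ring. }
  assert (Hsm : forall t, exists l, Cder (fun t => bessel_integrand (nu + 1) z t - bessel_integrand (nu - 1) z t)%C t l).
  { intros t. destruct (bessel_integrand_smooth (nu + 1) z t) as [l1 Hl1].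
    destruct (bessel_integrand_smooth (nu - 1) z t) as [l2 Hl2]. eexists. apply Cder_minus; eassumption. }
  assert (HI : Cimp f ((- z * RtoC (/ 2)) * (BesselK (nu + 1) z - BesselK (nu - 1) z) + RtoC nu * BesselK nu z)%C).
  { apply Cimp_plus. apply (Cimp_scal (- z * RtoC (/ 2))%C (fun t => bessel_integrand (nu + 1) z t - bessel_integrand (nu - 1) z t)%C); auto.
    apply Cimp_minus; now apply BesselK_integral. apply Cimp_scal_R. now apply BesselK_integral. }
  assert (H0 : Cimp f 0).
  { apply Cimp_of_limit with (fun T => F T - F 0)%C.
    - intros T. apply Cder_RInt; auto. intros t. unfold f. destruct (Hsm t) as [l1 Hl1].
      destruct (bessel_integrand_smooth nu z t) as [l2 Hl2]. eexists. apply Cder_plus; apply Cder_scal; eassumption.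
    (* Of the decay exp (- m T), the part |nu| cancels the growth of sinh (nu T) and the extra 1
       leaves exp (- T). *)
    - set (m := Rabs nu + 1). assert (Hm : 0 < m) by (unfold m; generalize (Rabs_pos nu); lra).
      apply filterlim_C_zero with (fun T => bessel_const m * Rpower (Re z) (- m) * exp (- T)).
      + evar_last. apply is_lim_scal_l. apply is_lim_comp with m_infty. apply is_lim_exp_m.
        evar_last. apply is_lim_opp. apply is_lim_id. reflexivity. exists 0. intros; discriminate.
        simpl. f_equal. ring.
      + intros T HT.
        assert (F 0 = 0) as ->. { unfold F. rewrite Rmult_0_r, sinh_0. ring. }
        replace (F T - 0)%C with (F T) by ring. unfold F. rewrite Cmod_mult, Cmod_R.
        assert (HS := sinh_le_exp nu (Rabs nu) T (Rle_refl _) HT).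
        assert (HE := Cmod_exp_cosh z T Hz).
        assert (HE2 := exp_half_le m (Re z * exp T) Hm ltac:(apply Rmult_lt_0_compat; auto; apply exp_pos)).
        rewrite <- Rpower_mult_distr in HE2; auto. 2: apply exp_pos.
        replace (Rpower (exp T) (- m)) with (exp (- T) * exp (- (Rabs nu * T))) in HE2
          by (unfold Rpower; rewrite ln_exp, <- exp_plus; f_equal; unfold m; ring).
        apply Rle_trans with ((bessel_const m * (Rpower (Re z) (- m) * (exp (- T) * exp (- (Rabs nu * T))))) * exp (Rabs nu * T)).
        apply Rmult_le_compat; auto. apply Cmod_ge_0. apply Rabs_pos. lra.
        right. rewrite (exp_Ropp (Rabs nu * T)). field. apply Rgt_not_eq, exp_pos. }
  assert (E := Cimp_unique _ _ _ HI H0).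
  transitivity (RtoC 2 * (RtoC nu * BesselK nu z - ((- z * RtoC (/ 2)) * (BesselK (nu + 1) z - BesselK (nu - 1) z) + RtoC nu * BesselK nu z)))%C.
  rewrite RtoC_inv by lra. field. rewrite E, RtoC_mult. ring.
Qed.

(** The recurrence eliminates the higher order nu + 1 from the derivative. *)
Lemma mul_dBesselK nu z : 0 < Re z ->
  (z * dBesselK nu z = - (RtoC nu * BesselK nu z) - z * BesselK (nu - 1) z)%C.
Proof.
  intros Hz. assert (E := BesselK_recurrence nu z Hz). unfold dBesselK.
  transitivity (- (RtoC (/ 2) * (z * (BesselK (nu + 1) z - BesselK (nu - 1) z))) - z * BesselK (nu - 1) z)%C.
  rewrite RtoC_inv by lra. field. rewrite E, RtoC_mult, RtoC_inv by lra. field.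
Qed.

Lemma Cder_BesselK nu (z : R -> C) t z' : 0 < Re (z t) -> Cder z t z' ->
  Cder (fun u => BesselK nu (z u)) t (z' * dBesselK nu (z t))%C.
Proof.
  intros Hz H. destruct (BesselK_quadratic nu (z t) Hz) as [Cq [HCq HQ]].
  apply Cder_comp_quadratic with Cq (Re (z t) / 2); auto. lra.
Qed.

(** * Argument and powers *)

Lemma Re_polar_ratio (z : C) : z <> 0 -> -1 <= Re z / Cmod z <= 1.
Proof.
  intros Hz. apply Cmod_gt_0 in Hz. assert (H := re_le_Cmod z).
  assert (Rabs (Re z / Cmod z) <= 1).
  { unfold Rdiv. rewrite Rabs_mult, Rabs_inv, (Rabs_pos_eq (Cmod z)) by lra.
    apply Rmult_le_reg_r with (Cmod z); auto. rewrite Rmult_assoc, Rinv_l by lra. lra. }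
  unfold Rabs in H0; destruct Rcase_abs; lra.
Qed.

Lemma cos_Arg (z : C) : z <> 0 -> Cmod z * cos (Arg z) = Re z.
Proof.
  intros Hz. assert (H := Re_polar_ratio z Hz). apply Cmod_gt_0 in Hz.
  unfold Arg. destruct Rle_dec; rewrite ?cos_neg, cos_acos by auto; field; lra.
Qed.

Lemma sin_Arg (z : C) : z <> 0 -> Cmod z * sin (Arg z) = Im z.
Proof.
  intros Hz. assert (H := Re_polar_ratio z Hz). apply Cmod_gt_0 in Hz.
  assert (HS : Cmod z * sin (acos (Re z / Cmod z)) = Rabs (Im z)).
  { rewrite sin_acos by auto.
    rewrite <- (sqrt_Rsqr (Cmod z)) at 1 by lra. rewrite <- sqrt_mult_alt by apply Rle_0_sqr.
    rewrite <- sqrt_Rsqr_abs. f_equal. unfold Rsqr.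
    replace (Cmod z * Cmod z * (1 - Re z / Cmod z * (Re z / Cmod z))) with (Cmod z * Cmod z - Re z * Re z) by (field; lra).
    rewrite Cmod_sqr. ring. }
  unfold Arg. destruct Rle_dec.
  - rewrite HS, Rabs_pos_eq; auto.
  - rewrite sin_neg. rewrite Ropp_mult_distr_r_reverse, HS, Rabs_left by lra. ring.
Qed.

Lemma Arg_unique (z : C) rho theta : 0 < rho -> - PI < theta <= PI ->
  Re z = rho * cos theta -> Im z = rho * sin theta -> Cmod z = rho /\ Arg z = theta.
Proof.
  intros Hr Ht HR HI.
  assert (HM : Cmod z = rho).
  { apply Rsqr_inj. apply Cmod_ge_0. lra. unfold Rsqr. rewrite Cmod_sqr, HR, HI.
    generalize (sin2_cos2 theta). unfold Rsqr. intros E.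
    transitivity (rho * rho * (sin theta * sin theta + cos theta * cos theta)). ring. rewrite E; ring. }
  split; auto. unfold Arg. rewrite HM, HR, HI.
  replace (rho * cos theta / rho) with (cos theta) by (field; lra).
  destruct Rle_dec as [H|H].
  - apply acos_cos. split; [|lra]. destruct (Rle_lt_dec 0 theta); auto.
    assert (0 < sin (- theta)) by (apply sin_gt_0; lra). rewrite sin_neg in H0. nra.
  - rewrite <- cos_neg. rewrite acos_cos. ring.
    destruct (Rle_lt_dec 0 theta); [|lra].
    exfalso. apply H. apply Rmult_le_pos. lra. apply sin_ge_0; lra.
Qed.

Lemma Cexp_Cln (z : C) : z <> 0 -> Cexp (Cln z) = z.
Proof.
  intros Hz. assert (H1 := cos_Arg z Hz). assert (H2 := sin_Arg z Hz). apply Cmod_gt_0 in Hz.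
  unfold Cexp, Cln. simpl. rewrite exp_ln by auto. apply C_ext; auto.
Qed.

Lemma Cpower_add a x y : Cpower a (RtoC (x + y)) = (Cpower a (RtoC x) * Cpower a (RtoC y))%C.
Proof. unfold Cpower. rewrite <- Cexp_plus. f_equal. rewrite RtoC_plus. ring. Qed.

Lemma Cpower_0 a : Cpower a (RtoC 0) = 1.
Proof. unfold Cpower. rewrite Cmult_0_l. apply Cexp_0. Qed.

Lemma Cpower_opp a x : Cpower a (RtoC (- x)) = (/ Cpower a (RtoC x))%C.
Proof. unfold Cpower. rewrite <- Cexp_opp. f_equal. rewrite RtoC_opp. ring. Qed.

Lemma Cpower_neq_0 a s : Cpower a s <> 0.
Proof. apply Cexp_neq_0. Qed.

Lemma Cmod_Cpower a x : Cmod (Cpower a (RtoC x)) = Rpower (Cmod a) x.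
Proof. unfold Cpower. rewrite Cmod_Cexp, re_scal_l. reflexivity. Qed.

Lemma Cpower_INR (a : C) n : a <> 0 -> Cpower a (RtoC (INR n)) = (a ^ n)%C.
Proof.
  intros Ha. induction n. simpl. apply Cpower_0.
  rewrite S_INR, Cpower_add, IHn, Cpow_S. unfold Cpower. rewrite Cmult_1_l, Cexp_Cln by auto. ring.
Qed.

Lemma Cpower_polar (a : C) x : a <> 0 ->
  Cpower a (RtoC x) = (RtoC (Rpower (Cmod a) x) * Cexp (RtoC (x * Arg a) * Ci))%C.
Proof.
  intros Ha. unfold Cpower, Rpower. rewrite <- Cexp_RtoC, <- Cexp_plus. f_equal.
  unfold Cln. apply C_ext; autorewrite with reim; simpl; ring.
Qed.

Lemma cos_Arg_pos (a : C) : 0 < Re a -> - (PI / 2) < Arg a < PI / 2.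
Proof.
  intros Ha. assert (Hz := Re_pos_neq a Ha). assert (HM : 0 < Cmod a) by now apply Cmod_gt_0.
  unfold Arg. assert (0 < Re a / Cmod a) by now apply Rdiv_lt_0_compat.
  assert (HA : acos (Re a / Cmod a) < PI / 2).
  { destruct (Re_polar_ratio a Hz) as [H1 H2]. destruct (Rlt_le_dec (acos (Re a / Cmod a)) (PI / 2)); auto.
    exfalso. assert (cos (acos (Re a / Cmod a)) <= cos (PI / 2)).
    { assert (HB := acos_bound (Re a / Cmod a)). assert (HP := PI_RGT_0). apply cos_decr_1; lra. }
    rewrite cos_acos, cos_PI2 in H0 by lra. lra. }
  generalize (acos_bound (Re a / Cmod a)) PI_RGT_0. destruct Rle_dec; lra.
Qed.

Lemma Re_pos_of_Arg (a : C) : a <> 0 -> Rabs (Arg a) < PI / 2 -> 0 < Re a.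
Proof.
  intros Ha H. rewrite <- cos_Arg by auto. apply Rmult_lt_0_compat. now apply Cmod_gt_0.
  apply cos_gt_0; apply Rabs_def2 in H; lra.
Qed.

(** wait *)
Lemma Re_ge_of_Arg (a : C) delta : a <> 0 -> 0 < delta < PI / 2 -> Rabs (Arg a) <= PI / 2 - delta ->
  sin delta * Cmod a <= Re a.
Proof.
  intros Ha Hd H. rewrite <- cos_Arg by auto. rewrite Rmult_comm.
  apply Rmult_le_compat_l. apply Cmod_ge_0.
  replace (sin delta) with (cos (PI / 2 - delta)) by apply cos_shift.
  assert (HP := PI_RGT_0).
  assert (cos (Arg a) = cos (Rabs (Arg a))) as ->.
  { unfold Rabs; destruct Rcase_abs; auto. now rewrite cos_neg. }
  assert (HB := Rabs_pos (Arg a)). apply cos_decr_1; lra.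
Qed.

Lemma Cln_sqr (a : C) : 0 < Re a -> Cln (a ^ 2)%C = (RtoC 2 * Cln a)%C.
Proof.
  intros Ha. assert (Hz := Re_pos_neq a Ha). assert (HA := cos_Arg_pos a Ha).
  assert (HM : 0 < Cmod a) by now apply Cmod_gt_0.
  assert (Hc := cos_Arg a Hz). assert (Hs := sin_Arg a Hz).
  destruct (Arg_unique (a ^ 2)%C (Cmod a * Cmod a) (2 * Arg a)) as [H1 H2].
  - nra.
  - lra.
  - replace (a ^ 2)%C with (a * a)%C by (simpl; ring). rewrite Re_mult, cos_2a, <- Hc, <- Hs. ring.
  - replace (a ^ 2)%C with (a * a)%C by (simpl; ring). rewrite Im_mult, sin_2a, <- Hc, <- Hs. ring.
  - unfold Cln. rewrite H1, H2, ln_mult by auto. apply C_ext; simpl; ring.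
Qed.

Lemma Cpower_sqr (a : C) x : 0 < Re a -> Cpower (a ^ 2)%C (RtoC x) = Cpower a (RtoC (2 * x)).
Proof.
  intros Ha. unfold Cpower. rewrite Cln_sqr by auto. f_equal. rewrite RtoC_mult. ring.
Qed.

Definition slit_plane (z : C) : Prop := 0 < Cmod z + Re z.

Lemma slit_plane_neq z : slit_plane z -> z <> 0.
Proof. unfold slit_plane. intros H ->. rewrite Cmod_0 in H. simpl in H. lra. Qed.

Lemma Arg_atan z : slit_plane z -> Arg z = 2 * atan (Im z / (Cmod z + Re z)).
Proof.
  intros H. assert (Hz := slit_plane_neq z H). unfold slit_plane in H. set (s := Cmod z) in *.
  assert (Hs : 0 < s) by now apply Cmod_gt_0.
  assert (Hsq : s * s = Re z * Re z + Im z * Im z) by apply Cmod_sqr.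
  set (T := Im z / (s + Re z)). assert (HB := atan_bound T).
  assert (Hc : 0 < cos (atan T)) by (apply cos_gt_0; lra).
  assert (Ht : sin (atan T) = T * cos (atan T)).
  { rewrite <- (tan_atan T) at 2. unfold tan. field. lra. }
  assert (Hcc : cos (atan T) * cos (atan T) * (1 + T * T) = 1).
  { assert (E := sin2_cos2 (atan T)). unfold Rsqr in E. rewrite Ht in E.
    transitivity (T * cos (atan T) * (T * cos (atan T)) + cos (atan T) * cos (atan T)); [ring|exact E]. }
  assert (HT : 1 + T * T = 2 * s / (s + Re z)).
  { unfold T. apply Rmult_eq_reg_r with ((s + Re z) * (s + Re z)). 2: nra.
    replace ((1 + Im z / (s + Re z) * (Im z / (s + Re z))) * ((s + Re z) * (s + Re z)))
      with ((s + Re z) * (s + Re z) + Im z * Im z) by (field; lra).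
    replace (2 * s / (s + Re z) * ((s + Re z) * (s + Re z))) with (2 * s * (s + Re z)) by (field; lra).
    nra. }
  assert (Hc2 : cos (atan T) * cos (atan T) = (s + Re z) / (2 * s)).
  { rewrite HT in Hcc. apply Rmult_eq_reg_r with (2 * s / (s + Re z)).
    rewrite Hcc. field. lra. apply Rgt_not_eq. apply Rdiv_lt_0_compat; lra. }
  apply (Arg_unique z s); auto.
  - lra.
  - rewrite cos_2a_cos. replace (2 * cos (atan T) * cos (atan T)) with (2 * (cos (atan T) * cos (atan T))) by ring.
    rewrite Hc2. field. lra.
  - rewrite sin_2a, Ht. replace (2 * (T * cos (atan T)) * cos (atan T)) with (2 * T * (cos (atan T) * cos (atan T))) by ring.
    rewrite Hc2. unfold T. field. lra.
Qed.

Lemma is_derive_arg_formula (x y s : R -> R) t x' y' : is_derive x t x' -> is_derive y t y' ->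
  0 < s t -> 0 < s t + x t -> s t * s t = x t * x t + y t * y t ->
  is_derive s t ((x t * x' + y t * y') / s t) ->
  is_derive (fun u => 2 * atan (y u / (s u + x u))) t ((x t * y' - y t * x') / (s t * s t)).
Proof.
  intros Hx Hy Hs Hsx Hsq Hds.
  assert (Ex : Derive (fun x0 => x x0) t = x') by (apply is_derive_unique; exact Hx).
  assert (Ey : Derive (fun x0 => y x0) t = y') by (apply is_derive_unique; exact Hy).
  assert (Es : Derive (fun x0 => s x0) t = (x t * x' + y t * y') / s t) by (apply is_derive_unique; exact Hds).
  auto_derive.
  - repeat split; auto; [now exists y'|now exists ((x t * x' + y t * y') / s t)|now exists x'|lra].
  - rewrite Ex, Ey, Es.
    set (X := x t) in *; set (Y := y t) in *; set (S := s t) in *. clearbody X Y S.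
    assert (HD : 0 < (S + X) * (S + X) + Y * Y) by nra.
    assert (E2 : (S + X) * (S + X) + Y * Y = 2 * S * (S + X)) by nra.
    apply Rmult_eq_reg_r with (S * S * ((S + X) * (S + X) + Y * Y)); [|nra].
    transitivity (2 * S * ((y' * S * (S + X)) - Y * ((X * x' + Y * y') + S * x'))).
    + field. repeat split; lra.
    + replace ((X * y' - Y * x') / (S * S) * (S * S * ((S + X) * (S + X) + Y * Y)))
        with ((X * y' - Y * x') * ((S + X) * (S + X) + Y * Y)) by (field; lra).
      rewrite E2.
      replace (2 * S * (y' * S * (S + X) - Y * (X * x' + Y * y' + S * x')))
        with (2 * S * (y' * (S * S) + y' * S * X - Y * (X * x' + Y * y' + S * x'))) by ring.
      rewrite Hsq. ring.
Qed.

Lemma Cder_Cln (z : R -> C) t z' : slit_plane (z t) -> Cder z t z' ->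
  Cder (fun u => Cln (z u)) t (z' / z t)%C.
Proof.
  intros Hsl [Hx Hy]. assert (Hz := slit_plane_neq _ Hsl).
  assert (HM : 0 < Cmod (z t)) by now apply Cmod_gt_0.
  assert (Hsq : Cmod (z t) * Cmod (z t) = Re (z t) * Re (z t) + Im (z t) * Im (z t)) by apply Cmod_sqr.
  assert (Hpos : 0 < Re (z t) * Re (z t) + Im (z t) * Im (z t)) by nra.
  assert (Hds : is_derive (fun u => Cmod (z u)) t ((Re (z t) * Re z' + Im (z t) * Im z') / Cmod (z t))).
  { apply is_derive_ext with (fun u => sqrt (Re (z u) * Re (z u) + Im (z u) * Im (z u))).
    { intros u. rewrite <- Cmod_sqr. apply sqrt_square, Cmod_ge_0. }
    assert (Hm : is_derive (fun u => Re (z u) * Re (z u) + Im (z u) * Im (z u)) t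
      ((Re z' * Re (z t) + Re (z t) * Re z') + (Im z' * Im (z t) + Im (z t) * Im z'))).
    { apply @is_derive_plus; apply @is_derive_mult; auto; intros; apply Rmult_comm. }
    evar_last. apply (is_derive_sqrt _ t _ Hm Hpos).
    rewrite <- Hsq, sqrt_square by lra. field. lra. }
  assert (Hex : exists d, 0 < d /\ forall u, Rabs (u - t) < d -> slit_plane (z u)).
  { assert (Hsum : continuous (fun u => Cmod (z u) + Re (z u)) t).
    { apply (ex_derive_continuous (V := R_NormedModule)). eexists. apply @is_derive_plus; [apply Hds|apply Hx]. }
    destruct (proj1 (filterlim_locally (U := R_UniformSpace) _ _) Hsum (mkposreal _ Hsl)) as [d Hd].
    exists d. split. apply cond_pos. intros u Hu. specialize (Hd u Hu).
    apply ball_Rabs in Hd; simpl in Hd.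
    apply Rabs_def2 in Hd. unfold slit_plane in *. lra. }
  destruct Hex as [d [Hd Hsd]].
  assert (Hq : (z' / z t)%C = (RtoC (/ (Cmod (z t) * Cmod (z t))) * (z' * Cconj (z t)))%C).
  { unfold Cdiv. rewrite Cinv_eq_conj by auto. ring. }
  assert (HcR : Re (Cconj (z t)) = Re (z t)) by reflexivity.
  assert (HcI : Im (Cconj (z t)) = - Im (z t)) by reflexivity.
  rewrite Hq. split.
  - replace (Re _) with (/ Cmod (z t) * ((Re (z t) * Re z' + Im (z t) * Im z') / Cmod (z t))).
    2: { rewrite re_scal_l, Re_mult, HcR, HcI. field. lra. }
    evar_last. apply (is_derive_comp ln (fun u => Cmod (z u))). apply is_derive_ln; auto. exact Hds.
    change scal with Rmult. Rring.
  - replace (Im _) with ((Re (z t) * Im z' - Im (z t) * Re z') / (Cmod (z t) * Cmod (z t))).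
    2: { rewrite im_scal_l, Im_mult, HcR, HcI. field. lra. }
    apply is_derive_ext_loc with (fun u => 2 * atan (Im (z u) / (Cmod (z u) + Re (z u)))).
    + exists (mkposreal d Hd). intros u Hu. symmetry. apply (Arg_atan (z u)). apply Hsd. exact Hu.
    + apply (is_derive_arg_formula (fun u => Re (z u)) (fun u => Im (z u)) (fun u => Cmod (z u))); auto.
Qed.

(** * Gamma as a leading coefficient *)

Definition tends0 (f : R -> C) (l : C) : Prop :=
  forall eps, 0 < eps -> exists r0, 0 < r0 /\ forall r, 0 < r < r0 -> Cmod (f r - l)%C < eps.

Lemma tends0_ext f g l : (forall r, 0 < r -> f r = g r) -> tends0 f l -> tends0 g l.
Proof.
  intros E H eps Heps. destruct (H eps Heps) as [r0 [Hr H']]. exists r0; split; auto.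
  intros r Hr'. rewrite <- E by lra. auto.
Qed.

Lemma tends0_plus f g l l' : tends0 f l -> tends0 g l' -> tends0 (fun r => f r + g r)%C (l + l')%C.
Proof.
  intros H H' eps Heps. destruct (H (eps / 2) ltac:(lra)) as [r0 [Hr HH]].
  destruct (H' (eps / 2) ltac:(lra)) as [r1 [Hr1 HH']].
  exists (Rmin r0 r1). split. now apply Rmin_glb_lt. intros r Hr'.
  assert (r < r0) by (eapply Rlt_le_trans; [apply Hr'|apply Rmin_l]).
  assert (r < r1) by (eapply Rlt_le_trans; [apply Hr'|apply Rmin_r]).
  replace (f r + g r - (l + l'))%C with ((f r - l) + (g r - l'))%C by ring.
  eapply Rle_lt_trans; [apply Cmod_triangle|].
  generalize (HH r ltac:(lra)) (HH' r ltac:(lra)). lra.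
Qed.

Lemma tends0_scal c f l : tends0 f l -> tends0 (fun r => c * f r)%C (c * l)%C.
Proof.
  intros H eps Heps. assert (Hc := Cmod_ge_0 c).
  destruct (H (eps / (Cmod c + 1)) ltac:(apply Rdiv_lt_0_compat; lra)) as [r0 [Hr HH]].
  exists r0; split; auto. intros r Hr'. specialize (HH r Hr').
  replace (c * f r - c * l)%C with (c * (f r - l))%C by ring. rewrite Cmod_mult.
  apply (Rmult_lt_compat_r (Cmod c + 1)) in HH; [|lra].
  replace (eps / (Cmod c + 1) * (Cmod c + 1)) with eps in HH by (field; lra).
  generalize (Cmod_ge_0 (f r - l)%C). nra.
Qed.

Lemma tends0_const l : tends0 (fun _ => l) l.
Proof. intros eps Heps. exists 1. split. lra. intros. replace (l - l)%C with (RtoC 0) by ring. rewrite Cmod_0. lra. Qed.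

Lemma tends0_unique f l l' : tends0 f l -> tends0 f l' -> l = l'.
Proof.
  intros H H'. apply Ceq_minus, Cmod_eq_0. apply Rle_antisym; [|apply Cmod_ge_0].
  apply le_epsilon. intros eps Heps. rewrite Rplus_0_l.
  destruct (H (eps / 2) ltac:(lra)) as [r0 [Hr HH]]. destruct (H' (eps / 2) ltac:(lra)) as [r1 [Hr1 HH']].
  assert (0 < Rmin r0 r1) by now apply Rmin_glb_lt.
  generalize (Rmin_l r0 r1) (Rmin_r r0 r1). set (r := Rmin r0 r1 / 2). intros.
  generalize (HH r ltac:(unfold r; lra)) (HH' r ltac:(unfold r; lra)). intros.
  replace (l - l')%C with ((f r - l') - (f r - l))%C by ring.
  eapply Rle_trans; [apply Cmod_minus_le|]. lra.
Qed.

Lemma Rpower_small p eps : 0 < p -> 0 < eps -> exists r0, 0 < r0 /\ forall r, 0 < r < r0 -> Rpower r p < eps.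
Proof.
  intros Hp He. exists (Rpower eps (/ p)). split. apply Rpower_pos. intros r Hr.
  replace eps with (Rpower (Rpower eps (/ p)) p).
  - unfold Rpower at 1. unfold Rpower at 1. apply exp_increasing. apply Rmult_lt_compat_l; auto.
    now apply ln_increasing.
  - rewrite Rpower_mult, Rinv_l, Rpower_1; lra.
Qed.

Lemma tends0_zero f c p : 0 <= c -> 0 < p ->
  (forall r, 0 < r -> Cmod (f r) <= c * Rpower r p) -> tends0 f 0.
Proof.
  intros Hc Hp Hf eps Heps.
  destruct (Rpower_small p (eps / (c + 1)) Hp ltac:(apply Rdiv_lt_0_compat; lra)) as [r0 [Hr HH]].
  exists r0; split; auto. intros r Hr'. specialize (HH r Hr').
  replace (f r - 0)%C with (f r) by ring. eapply Rle_lt_trans; [apply Hf; lra|].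
  apply (Rmult_lt_compat_r (c + 1)) in HH; [|lra].
  replace (eps / (c + 1) * (c + 1)) with eps in HH by (field; lra).
  generalize (Rpower_pos r p). nra.
Qed.

Definition gamma_integrand (nu u : R) : R := Rpower u (nu - 1) * exp (- u).

Definition gamma_primitive (nu x : R) : R := RInt (gamma_integrand nu) 1 x.

Lemma gamma_integrand_continuous nu u : 0 < u -> continuous (gamma_integrand nu) u.
Proof.
  intros Hu. apply (ex_derive_continuous (V := R_NormedModule)). unfold gamma_integrand, Rpower.
  auto_derive. auto.
Qed.

Lemma gamma_integrand_ex_RInt nu a b : 0 < a -> 0 < b -> ex_RInt (gamma_integrand nu) a b.
Proof.
  intros Ha Hb. apply (ex_RInt_continuous (V := R_CompleteNormedModule)). intros z Hz.
  apply gamma_integrand_continuous. eapply Rlt_le_trans; [|apply Hz]. now apply Rmin_glb_lt.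
Qed.

Lemma gamma_primitive_derive nu x : 0 < x -> is_derive (gamma_primitive nu) x (gamma_integrand nu x).
Proof.
  intros Hx. unfold gamma_primitive. apply (is_derive_RInt (gamma_integrand nu) _ 1 x).
  - refine (filter_imp _ _ _ (open_gt 0 x Hx)). intros y Hy.
    apply (RInt_correct (V := R_CompleteNormedModule)). apply gamma_integrand_ex_RInt; auto; lra.
  - now apply gamma_integrand_continuous.
Qed.

Lemma gamma_primitive_diff nu x y : 0 < nu -> 0 < x <= y ->
  Rabs (gamma_primitive nu y - gamma_primitive nu x)
  <= (bessel_const nu / nu) * (/ (1 + Rpower x nu) - / (1 + Rpower y nu)).
Proof.
  intros Hnu Hxy. set (c := bessel_const nu / nu).
  assert (Hc : 0 < c) by (apply Rdiv_lt_0_compat; auto; apply bessel_const_pos).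
  rewrite <- Cmod_R, RtoC_minus.
  replace (c * (/ (1 + Rpower x nu) - / (1 + Rpower y nu))) with
    (- c * / (1 + Rpower y nu) - - c * / (1 + Rpower x nu)) by ring.
  apply (Cder_mean_value (fun u => RtoC (gamma_primitive nu u)) (fun u => RtoC (gamma_integrand nu u))
    (fun u => - c * / (1 + Rpower u nu)) (fun u => bessel_const nu * Rpower u (nu - 1) / (1 + Rpower u nu) ^ 2)).
  - lra.
  - intros t Ht. apply Cder_RtoC, gamma_primitive_derive. lra.
  - intros t Ht. assert (HP := Rpower_pos t nu). 
    evar_last. apply is_derive_scal. apply is_derive_inv.
    apply @is_derive_plus. apply @is_derive_const. apply is_derive_Rpower; lra. lra.
    change plus with Rplus. change zero with 0. unfold Rminus. rewrite Rpower_plus, (Rpower_Ropp t 1), Rpower_1 by lra.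
    unfold c. field. repeat split; lra.
  - intros t Ht. unfold gamma_integrand. assert (HP := Rpower_pos t (nu - 1)).
    rewrite Cmod_RtoC_pos by (apply Rmult_le_pos; [lra|left; apply exp_pos]).
    replace (bessel_const nu * Rpower t (nu - 1) / (1 + Rpower t nu) ^ 2)
      with (Rpower t (nu - 1) * (bessel_const nu / (1 + Rpower t nu) ^ 2)) by (unfold Rdiv; ring).
    apply Rmult_le_compat_l. lra. eapply Rle_trans; [|apply exp_half_majorant; lra].
    apply exp_le_exp. lra.
Qed.

Lemma gamma_primitive_limits nu : 0 < nu -> exists L0 L1 : R,
  filterlim (gamma_primitive nu) (at_right 0) (locally L0) /\
  filterlim (gamma_primitive nu) (Rbar_locally p_infty) (locally L1) /\
  Euler_Gamma nu = L1 - L0.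
Proof.
  intros Hnu. set (c := bessel_const nu / nu).
  assert (Hc : 0 < c) by (apply Rdiv_lt_0_compat; auto; apply bessel_const_pos).
  assert (H0 : exists L0 : R, filterlim (gamma_primitive nu) (at_right 0) (locally L0)).
  { apply (filterlim_locally_cauchy (U := R_CompleteSpace)). intros eps.
    destruct (Rpower_small nu (eps / c) Hnu ltac:(apply Rdiv_lt_0_compat; auto; apply cond_pos)) as [r0 [Hr0 HH]].
    exists (fun r => 0 < r < r0). split.
    { exists (mkposreal r0 Hr0). intros y Hy Hy0. apply ball_Rabs in Hy; simpl in Hy. apply Rabs_def2 in Hy. lra. }
    assert (Hw : forall u v, 0 < u < r0 -> 0 < v < r0 -> u <= v -> Rabs (gamma_primitive nu v - gamma_primitive nu u) < eps).
    { intros u v Hu Hv Huv. eapply Rle_lt_trans; [apply gamma_primitive_diff; auto; lra|]. fold c.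
      assert (HPu := Rpower_pos u nu). assert (HPv := Rpower_pos v nu).
      apply Rle_lt_trans with (c * Rpower v nu).
      - apply Rmult_le_compat_l. lra.
        assert (/ (1 + Rpower u nu) <= 1) by (rewrite <- Rinv_1; apply Rinv_le_contravar; lra).
        assert (1 - / (1 + Rpower v nu) <= Rpower v nu).
        { replace (1 - / (1 + Rpower v nu)) with (Rpower v nu * / (1 + Rpower v nu)) by (field; lra).
          assert (/ (1 + Rpower v nu) <= 1) by (rewrite <- Rinv_1; apply Rinv_le_contravar; lra). nra. }
        lra.
      - specialize (HH v Hv). apply (Rmult_lt_compat_l c) in HH; auto.
        replace (c * (eps / c)) with (pos eps) in HH by (field; lra). exact HH. }
    intros u v Hu Hv. apply Rabs_ball. destruct (Rle_lt_dec u v). now apply Hw.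
    rewrite Rabs_minus_sym. apply Hw; auto; lra. }
  assert (H1 : exists L1 : R, filterlim (gamma_primitive nu) (Rbar_locally p_infty) (locally L1)).
  { apply (filterlim_locally_cauchy (U := R_CompleteSpace)). intros eps.
    set (M := Rpower (c / eps) (/ nu)).
    assert (Hce : 0 < c / eps) by (apply Rdiv_lt_0_compat; auto; apply cond_pos).
    assert (HM : 0 < M) by apply Rpower_pos.
    exists (fun T => M < T). split. now exists M.
    assert (Hw : forall u v, M < u -> u <= v -> Rabs (gamma_primitive nu v - gamma_primitive nu u) < eps).
    { intros u v Hu Huv. eapply Rle_lt_trans; [apply gamma_primitive_diff; auto; lra|]. fold c.
      assert (HPu : c / eps < Rpower u nu).
      { replace (c / eps) with (Rpower M nu) by (unfold M; rewrite Rpower_mult, Rinv_l, Rpower_1; lra).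
        unfold Rpower. apply exp_increasing. apply Rmult_lt_compat_l; auto. apply ln_increasing; lra. }
      assert (HPv := Rpower_pos v nu).
      assert (0 < / (1 + Rpower v nu)) by (apply Rinv_0_lt_compat; lra).
      apply Rle_lt_trans with (c * / (1 + Rpower u nu)). apply Rmult_le_compat_l; lra.
      assert (Heps := cond_pos eps).
      apply Rmult_lt_reg_r with (1 + Rpower u nu). lra. rewrite Rmult_assoc, Rinv_l, Rmult_1_r by lra.
      apply (Rmult_lt_compat_l eps) in HPu; auto. replace (eps * (c / eps)) with c in HPu by (field; lra). lra. }
    intros u v Hu Hv. apply Rabs_ball. destruct (Rle_lt_dec u v). now apply Hw.
    rewrite Rabs_minus_sym. apply Hw; auto; lra. }
  destruct H0 as [L0 H0], H1 as [L1 H1]. exists L0, L1. split; auto. split; auto.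
  unfold Euler_Gamma. apply (is_RInt_gen_unique (V := R_CompleteNormedModule)).
  apply (filterlimi_locally (U := R_UniformSpace)). intros eps.
  assert (He : 0 < eps / 2) by (generalize (cond_pos eps); lra).
  assert (F0 := proj1 (filterlim_locally (U := R_UniformSpace) _ _) H0 (mkposreal _ He)).
  assert (F1 := proj1 (filterlim_locally (U := R_UniformSpace) _ _) H1 (mkposreal _ He)).
  assert (Hpos : at_right 0 (fun x => 0 < x)) by (exists (mkposreal 1 Rlt_0_1); auto).
  apply (Filter_prod _ _ _ (fun x => 0 < x /\ ball L0 (mkposreal _ He) (gamma_primitive nu x))
    (fun y => 0 < y /\ ball L1 (mkposreal _ He) (gamma_primitive nu y))).
  - now apply filter_and.
  - apply filter_and; auto. now exists 0.
  - intros x y [Hx Bx] [Hy By]. exists (gamma_primitive nu y - gamma_primitive nu x). split.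
    + assert (E := is_RInt_Chasles _ _ _ _ _ _
        (is_RInt_swap _ _ _ _ (RInt_correct (V := R_CompleteNormedModule) (gamma_integrand nu) 1 x (gamma_integrand_ex_RInt nu 1 x Rlt_0_1 Hx)))
        (RInt_correct (V := R_CompleteNormedModule) (gamma_integrand nu) 1 y (gamma_integrand_ex_RInt nu 1 y Rlt_0_1 Hy))).
      replace (gamma_primitive nu y - gamma_primitive nu x) with
        (plus (opp (RInt (gamma_integrand nu) 1 x)) (RInt (gamma_integrand nu) 1 y)).
      exact E. unfold gamma_primitive. change plus with Rplus. change opp with Ropp. Rring.
    + apply Rabs_ball. apply ball_Rabs in Bx; simpl in Bx. apply ball_Rabs in By; simpl in By.
      apply Rabs_def2 in Bx. apply Rabs_def2 in By. apply Rabs_def1; lra.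
Qed.

Lemma filterlim_RtoC (f : R -> R) (L : R) (F : (R -> Prop) -> Prop) {FF : Filter F} :
  filterlim f F (locally L) ->
  filterlim ((fun x => RtoC (f x)) : R -> C_R_NormedModule) F (locally (RtoC L)).
Proof.
  intros H. apply (filterlim_locally (U := C_R_NormedModule)). intros eps.
  assert (F1 := proj1 (filterlim_locally (U := R_UniformSpace) _ _) H eps).
  revert F1. apply filter_imp. intros x Hx. split. exact Hx. apply ball_center.
Qed.

Definition exp_exp (nu r t : R) : R := exp (nu * t) * exp (- (r * exp t / 2)).

Lemma exp_exp_integral nu r (L1 : R) : 0 < nu -> 0 < r ->
  filterlim (gamma_primitive nu) (Rbar_locally p_infty) (locally L1) ->
  Cimp (fun t => RtoC (exp_exp nu r t)) (RtoC (Rpower (r / 2) (- nu) * (L1 - gamma_primitive nu (r / 2)))).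
Proof.
  intros Hnu Hr HL. set (P := gamma_primitive nu) in *. set (k := Rpower (r / 2) (- nu)).
  apply Cimp_of_limit with (fun T => RtoC (k * P (r / 2 * exp T)%R) - RtoC (k * P (r / 2 * exp 0)%R))%C.
  - intros T. apply (Cder_RInt (fun T => RtoC (k * P (r / 2 * exp T)))).
    + intros t. apply Cder_RtoC.
      assert (Hp : 0 < r / 2 * exp t) by (generalize (exp_pos t); nra).
      evar_last. apply is_derive_scal. apply (is_derive_comp P (fun u => r / 2 * exp u)).
      now apply gamma_primitive_derive. apply is_derive_scal, is_derive_exp.
      change scal with Rmult. unfold gamma_integrand, Rminus.
      rewrite Rpower_plus, (Rpower_Ropp _ 1), Rpower_1 by auto.
      rewrite <- Rpower_mult_distr; [|lra|apply exp_pos].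
      unfold exp_exp, k. rewrite Rpower_Ropp.
      replace (exp (nu * t)) with (Rpower (exp t) nu) by (unfold Rpower; now rewrite ln_exp).
      replace (r / 2 * exp t) with (r * exp t / 2) by field.
      assert (H1 := Rpower_pos (r / 2) nu). assert (H2 := exp_pos t).
      match goal with |- @eq _ ?a ?b => change (@eq R a b) end. field. repeat split; lra.
    + intros t. eexists. apply Cder_RtoC. unfold exp_exp. apply Derive_correct. auto_derive. auto.
  - assert (E : RtoC (k * (L1 - P (r / 2)%R)) = RtoC (k * L1 - k * P (r / 2 * exp 0))).
    { f_equal. rewrite exp_0, Rmult_1_r. ring. }
    rewrite E.
    apply (filterlim_ext (fun T => RtoC (k * P (r / 2 * exp T) - k * P (r / 2 * exp 0)))).
    { intros T. apply RtoC_minus. }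
    apply filterlim_RtoC. apply Rbar_locally_filter.
    apply (filterlim_comp _ _ _ (fun T => r / 2 * exp T) (fun y => k * P y - k * P (r / 2 * exp 0)) _ (Rbar_locally p_infty)).
    + assert (HI : is_lim (fun T => r / 2 * exp T) p_infty p_infty).
      { evar_last. apply is_lim_scal_l. apply is_lim_exp_p.
        simpl. destruct Rle_dec; [|lra]. destruct Rle_lt_or_eq_dec; [|lra]. reflexivity. }
      exact HI.
    + apply (filterlim_comp _ _ _ P (fun y => k * y - k * P (r / 2 * exp 0)) _ (locally L1)); auto.
      assert (HC : continuous (fun y => k * y - k * P (r / 2 * exp 0)) L1).
      { apply (ex_derive_continuous (V := R_NormedModule)). auto_derive. auto. }
      exact HC.
Qed.

Lemma bessel_integrand_real nu r t : bessel_integrand nu (RtoC r) t = RtoC (exp (- r * cosh t) * cosh (nu * t)).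
Proof.
  unfold bessel_integrand. rewrite RtoC_mult, <- Cexp_RtoC, RtoC_mult, RtoC_opp. reflexivity.
Qed.

Lemma BesselK_limit_real nu : 0 < nu ->
  tends0 (fun r => RtoC (Rpower r nu) * BesselK nu (RtoC r))%C (RtoC (Rpower 2 (nu - 1) * Euler_Gamma nu)).
Proof.
  intros Hnu. destruct (gamma_primitive_limits nu Hnu) as [L0 [L1 [H0 [H1 ->]]]].
  set (P := gamma_primitive nu) in *.
  set (d1 := fun r t => / 2 * (exp (nu * t) * (exp (- r * cosh t) - exp (- (r * exp t / 2))))).
  set (d2 := fun r t => / 2 * (exp (- nu * t) * exp (- r * cosh t))).
  assert (HD1 : forall r, 0 < r -> exists l, Cimp (fun t => RtoC (d1 r t)) l /\
    Cmod l <= r * (bessel_const nu / nu) * Rpower r (- nu)).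
  { intros r Hr. apply Cimp_exp_dominated; auto. lra.
    - intros t. eexists. apply Cder_RtoC. unfold d1, cosh. apply Derive_correct. auto_derive. auto.
    - intros t Ht. unfold d1. rewrite Cmod_R, !Rabs_mult.
      rewrite (Rabs_pos_eq (/ 2)), (Rabs_pos_eq (exp (nu * t))) by (try (left; apply exp_pos); lra).
      replace (exp (- r * cosh t)) with (exp (- (r * exp t / 2)) * exp (- (r * exp (- t) / 2)))
        by (rewrite <- exp_plus; f_equal; unfold cosh; field).
      assert (He : exp (- t) <= 1) by (rewrite <- exp_0; apply exp_le_exp; lra).
      assert (HE := exp_pos (- t)).
      assert (Hb : Rabs (exp (- (r * exp (- t) / 2)) - 1) <= r).
      { assert (exp (- (r * exp (- t) / 2)) <= 1) by (rewrite <- exp_0; apply exp_le_exp; nra).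
        generalize (exp_ineq1_le (- (r * exp (- t) / 2))). intros. apply Rabs_le. nra. }
      replace (exp (- (r * exp t / 2)) * exp (- (r * exp (- t) / 2)) - exp (- (r * exp t / 2)))
        with (exp (- (r * exp t / 2)) * (exp (- (r * exp (- t) / 2)) - 1)) by ring.
      rewrite Rabs_mult, Rabs_pos_eq by (left; apply exp_pos).
      assert (HA := exp_pos (nu * t)). assert (HB := exp_pos (- (r * exp t / 2))).
      replace (/ 2 * (exp (nu * t) * (exp (- (r * exp t / 2)) * Rabs (exp (- (r * exp (- t) / 2)) - 1))))
        with (/ 2 * Rabs (exp (- (r * exp (- t) / 2)) - 1) * (exp (nu * t) * exp (- (r * exp t / 2)))) by ring.
      apply Rmult_le_compat_r. apply Rmult_le_pos; lra.
      generalize (Rabs_pos (exp (- (r * exp (- t) / 2)) - 1)). lra. }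
  assert (HD2 : forall r, 0 < r -> exists l, Cimp (fun t => RtoC (d2 r t)) l /\
    Cmod l <= 1 * (bessel_const (nu / 2) / (nu / 2)) * Rpower r (- (nu / 2))).
  { intros r Hr. apply Cimp_exp_dominated; auto; try lra.
    - intros t. eexists. apply Cder_RtoC. unfold d2, cosh. apply Derive_correct. auto_derive. auto.
    - intros t Ht. unfold d2. rewrite Cmod_RtoC_pos.
      2: { apply Rmult_le_pos. lra. apply Rmult_le_pos; left; apply exp_pos. }
      rewrite Rmult_1_l.
      assert (HA := exp_pos (- nu * t)). assert (HB := exp_pos (- r * cosh t)).
      apply Rle_trans with (exp (- nu * t) * exp (- r * cosh t)). nra.
      apply Rmult_le_compat; try lra; apply exp_le_exp. nra.
      generalize (cosh_ge_half t). nra. }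
  apply tends0_ext with (fun r => RtoC (Rpower r nu) * (BesselK nu (RtoC r)
    - RtoC (/ 2) * RtoC (Rpower (r / 2) (- nu) * (L1 - P (r / 2)%R)))
    + RtoC (Rpower 2 (nu - 1)) * RtoC (L1 - P (r / 2)%R))%C.
  { intros r Hr. rewrite Cmult_comm. unfold Cminus. rewrite Cmult_plus_distr_r, <- Cplus_assoc.
    rewrite (Cmult_comm (BesselK nu (RtoC r))).
    replace (RtoC (Rpower 2 (nu - 1)) * RtoC (L1 - P (r / 2)%R))%C
      with (RtoC (/ 2) * RtoC (Rpower (r / 2) (- nu) * (L1 - P (r / 2)%R)) * RtoC (Rpower r nu))%C. ring.
    rewrite <- !RtoC_mult. f_equal.
    rewrite Rpower_div_l, Ropp_involutive, Rpower_Ropp by lra. unfold Rminus.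
    rewrite Rpower_plus, (Rpower_Ropp 2 1), Rpower_1 by lra.
    assert (H := Rpower_pos r nu). field. lra. }
  replace (RtoC (Rpower 2 (nu - 1) * (L1 - L0))) with (0 + RtoC (Rpower 2 (nu - 1)) * RtoC (L1 - L0))%C by (rewrite RtoC_mult; ring).
  apply tends0_plus.
  - apply tends0_ext with (fun r => RtoC (Rpower r nu) * RInt_gen (V := C_R_CompleteNormedModule) (fun t => RtoC (d1 r t)) (at_point 0) (Rbar_locally p_infty)
      + RtoC (Rpower r nu) * RInt_gen (V := C_R_CompleteNormedModule) (fun t => RtoC (d2 r t)) (at_point 0) (Rbar_locally p_infty))%C.
    { intros r Hr. destruct (HD1 r Hr) as [l1 [I1 _]]. destruct (HD2 r Hr) as [l2 [I2 _]].
      rewrite (is_RInt_gen_unique (V := C_R_CompleteNormedModule) _ _ I1).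
      rewrite (is_RInt_gen_unique (V := C_R_CompleteNormedModule) _ _ I2).
      rewrite <- Cmult_plus_distr_l. f_equal. change plus with Cplus.
      apply (Cimp_unique (fun t => RtoC (d1 r t) + RtoC (d2 r t))%C). now apply Cimp_plus.
      eapply Cimp_ext; [|apply Cimp_minus; [apply (BesselK_integral nu (RtoC r) Hr)|apply (Cimp_scal_R (/ 2)), (exp_exp_integral nu r L1 Hnu Hr H1)]].
      intros t. cbv beta. rewrite bessel_integrand_real, <- RtoC_plus, <- RtoC_mult, <- RtoC_minus. f_equal.
      unfold d1, d2, exp_exp. replace (cosh (nu * t)) with ((exp (nu * t) + exp (- nu * t)) / 2).
      field. unfold cosh. do 3 f_equal. ring. }
    replace (RtoC 0) with (0 + 0)%C by ring. apply tends0_plus.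
    + apply tends0_zero with (bessel_const nu / nu) 1. left; apply Rdiv_lt_0_compat; auto; apply bessel_const_pos. lra.
      intros r Hr. destruct (HD1 r Hr) as [l1 [I1 B1]].
      rewrite (is_RInt_gen_unique (V := C_R_CompleteNormedModule) _ _ I1).
      rewrite Cmod_mult, Cmod_RtoC_pos by (left; apply Rpower_pos).
      apply Rle_trans with (Rpower r nu * (r * (bessel_const nu / nu) * Rpower r (- nu))).
      apply Rmult_le_compat_l; auto. left; apply Rpower_pos.
      rewrite Rpower_Ropp, Rpower_1 by auto. assert (H := Rpower_pos r nu). right. field. lra.
    + set (c := 1 * (bessel_const (nu / 2) / (nu / 2))) in *.
      apply tends0_zero with c (nu / 2).
      unfold c. rewrite Rmult_1_l. left; apply Rdiv_lt_0_compat; [apply bessel_const_pos|lra]. lra.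
      intros r Hr. destruct (HD2 r Hr) as [l1 [I1 B1]].
      rewrite (is_RInt_gen_unique (V := C_R_CompleteNormedModule) _ _ I1).
      rewrite Cmod_mult, Cmod_RtoC_pos by (left; apply Rpower_pos).
      apply Rle_trans with (Rpower r nu * (c * Rpower r (- (nu / 2)))).
      apply Rmult_le_compat_l; auto. left; apply Rpower_pos.
      right. replace nu with (nu / 2 + nu / 2) at 1 by field. rewrite Rpower_plus, Rpower_Ropp.
      assert (H := Rpower_pos r (nu / 2)). field. lra.
  - apply tends0_scal. intros eps Heps.
    destruct (proj1 (filterlim_locally (U := R_UniformSpace) _ _) H0 (mkposreal _ Heps)) as [r0 Hr0].
    exists (2 * r0). split. generalize (cond_pos r0). lra. intros r Hr.
    rewrite <- RtoC_minus, Cmod_R.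
    assert (HB : ball L0 eps (P (r / 2)%R)).
    { apply Hr0; [|lra]. apply Rabs_ball; simpl.
      apply Rabs_def1; lra. }
    apply ball_Rabs in HB; simpl in HB.
    apply Rabs_def2 in HB. apply Rabs_def1; lra.
Qed.

Lemma tends0_BesselK_lower nu p : 0 < p -> Rabs nu < p ->
  tends0 (fun r => RtoC (Rpower r p) * BesselK nu (RtoC r))%C 0.
Proof.
  intros Hp Hnu. set (m := (Rabs nu + p) / 2).
  assert (Hm : 0 < m /\ Rabs nu <= m /\ m < p) by (unfold m; generalize (Rabs_pos nu); lra).
  apply tends0_zero with (bessel_const m / m) (p - m).
  left; apply Rdiv_lt_0_compat; [apply bessel_const_pos|lra]. lra.
  intros r Hr. rewrite Cmod_mult, Cmod_RtoC_pos by (left; apply Rpower_pos).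
  eapply Rle_trans. apply Rmult_le_compat_l. left; apply Rpower_pos. apply (BesselK_bound nu (RtoC r) m); try lra. exact Hr.
  right. rewrite re_RtoC. unfold Rminus. rewrite Rpower_plus. ring.
Qed.

(* The functional equation of Gamma is read off from the recurrence of [K]
   by comparing leading terms at the origin. *)
Lemma Euler_Gamma_succ x : 0 < x -> Euler_Gamma (x + 1) = x * Euler_Gamma x.
Proof.
  intros Hx.
  assert (H1 := BesselK_limit_real (x + 1) ltac:(lra)).
  assert (H2 := tends0_plus _ _ _ _ (tends0_BesselK_lower (x - 1) (x + 1) ltac:(lra) ltac:(apply Rabs_def1; lra))
    (tends0_scal (RtoC (2 * x)) _ _ (BesselK_limit_real x Hx))).
  assert (H3 : tends0 (fun r => RtoC (Rpower r (x + 1)) * BesselK (x + 1) (RtoC r))%C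
    (0 + RtoC (2 * x) * RtoC (Rpower 2 (x - 1) * Euler_Gamma x))%C).
  { eapply tends0_ext; [|apply H2]. intros r Hr. cbv beta.
    assert (E := BesselK_recurrence x (RtoC r) Hr).
    rewrite Rpower_plus, Rpower_1, RtoC_mult by auto.
    transitivity (RtoC (Rpower r x) * (RtoC r * BesselK (x - 1) (RtoC r) + RtoC (2 * x) * BesselK x (RtoC r)))%C. ring.
    rewrite <- E. ring. }
  assert (E := tends0_unique _ _ _ H1 H3). rewrite Cplus_0_l, <- RtoC_mult in E. apply RtoC_inj in E.
  replace (x + 1 - 1) with (x - 1 + 1) in E by ring. rewrite Rpower_plus, Rpower_1 in E by lra.
  assert (H := Rpower_pos 2 (x - 1)). nra.
Qed.

Lemma poch_shift x m : poch x (S m) = x * poch (x + 1) m.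
Proof.
  induction m. simpl. ring.
  change (poch x (S m) * (x + INR (S m)) = x * (poch (x + 1) m * (x + 1 + INR m))).
  rewrite IHm, S_INR. ring.
Qed.

Lemma poch_neq_0 x m : (forall j, (j < m)%nat -> x + INR j <> 0) -> poch x m <> 0.
Proof.
  induction m; intros H; simpl. lra.
  apply Rmult_integral_contrapositive_currified. apply IHm; intros; apply H; lia. apply H; lia.
Qed.

Lemma Gamma_shift x m : (forall j : nat, x + INR j <> 0) -> 0 < x + INR m ->
  Gamma x = Euler_Gamma (x + INR m) / poch x m.
Proof.
  intros Hx Hm.
  assert (H : forall m j, 0 < x + INR m -> Euler_Gamma (x + INR (m + j)) / poch x (m + j) = Euler_Gamma (x + INR m) / poch x m).
  { intros n j Hn. induction j. now rewrite Nat.add_0_r.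
    rewrite <- IHj. replace (n + S j)%nat with (S (n + j)) by lia. rewrite S_INR.
    assert (0 < x + INR (n + j)) by (rewrite plus_INR; generalize (pos_INR j); lra).
    rewrite <- Rplus_assoc, Euler_Gamma_succ by auto. simpl. field.
    split. now apply poch_neq_0. lra. }
  unfold Gamma. set (m0 := Z.to_nat (up (- x))).
  assert (Hm0 : 0 < x + INR m0).
  { destruct (archimed (- x)) as [A _]. unfold m0.
    assert (IZR (up (- x)) <= INR (Z.to_nat (up (- x)))).
    { rewrite INR_IZR_INZ. apply IZR_le. lia. } lra. }
  rewrite <- (H m0 m Hm0), <- (H m m0 Hm). now rewrite Nat.add_comm.
Qed.

Lemma Gamma_succ x : (forall j : nat, x + INR j <> 0) -> Gamma (x + 1) = x * Gamma x.
Proof.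
  intros Hx.
  assert (Hx0 : x <> 0) by (generalize (Hx 0%nat); simpl; lra).
  assert (Hx1 : forall j : nat, x + 1 + INR j <> 0) by (intros j; generalize (Hx (S j)); rewrite S_INR; lra).
  set (m := Z.to_nat (up (- x))).
  assert (Hm : 0 < x + INR m).
  { destruct (archimed (- x)) as [A _]. unfold m.
    assert (IZR (up (- x)) <= INR (Z.to_nat (up (- x)))).
    { rewrite INR_IZR_INZ. apply IZR_le. lia. } lra. }
  rewrite (Gamma_shift x (S m) Hx) by (rewrite S_INR; lra).
  rewrite (Gamma_shift (x + 1) m Hx1) by lra.
  rewrite poch_shift, S_INR. replace (x + (INR m + 1)) with (x + 1 + INR m) by ring. field.
  split; auto. now apply poch_neq_0.
Qed.

Lemma Gamma_pos_arg x : 0 < x -> Gamma x = Euler_Gamma x.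
Proof.
  intros Hx. rewrite (Gamma_shift x 0). simpl. rewrite Rplus_0_r. field.
  intros j. generalize (pos_INR j). lra. simpl. lra.
Qed.

Definition ray (r phi : R) : C := (RtoC r * Cexp (RtoC phi * Ci))%C.

Lemma Re_ray r phi : Re (ray r phi) = r * cos phi.
Proof.
  unfold ray. rewrite re_scal_l. f_equal. unfold Cexp. simpl.
  replace (phi * 0 - 0 * 1) with 0 by ring. replace (phi * 1 + 0 * 0) with phi by ring. rewrite exp_0. ring.
Qed.

Lemma BesselK_limit_ray nu phi : 0 < nu -> - (PI / 2) < phi < PI / 2 ->
  tends0 (fun r => RtoC (Rpower r nu) * (Cexp (RtoC (nu * phi) * Ci) * BesselK nu (ray r phi)))%C
    (RtoC (Rpower 2 (nu - 1) * Gamma nu)).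
Proof.
  intros Hnu Hphi. rewrite Gamma_pos_arg by auto.
  set (m := Rmax (Rabs (nu - 1)) nu).
  assert (Hm : 0 < m) by (eapply Rlt_le_trans; [apply Hnu|apply Rmax_r]).
  assert (Hm1 : m < nu + 1). { unfold m. apply Rmax_lub_lt; [|lra]. apply Rabs_def1; lra. }
  assert (Hcp : 0 < cos phi) by (apply cos_gt_0; lra).
  set (c := Rabs phi * ((bessel_const m / m) * Rpower (cos phi) (- m))).
  assert (Hc : 0 <= c). { unfold c. apply Rmult_le_pos. apply Rabs_pos. apply Rmult_le_pos.
    left; apply Rdiv_lt_0_compat; auto; apply bessel_const_pos. left; apply Rpower_pos. }
  assert (Hcs : forall s, 0 <= s <= 1 -> cos phi <= cos (s * phi)).
  { intros s Hs. assert (HP := PI_RGT_0).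
    assert (E : forall u, cos u = cos (Rabs u)) by (intros u; unfold Rabs; destruct Rcase_abs; auto; now rewrite cos_neg).
    rewrite (E phi), (E (s * phi)), Rabs_mult, (Rabs_pos_eq s) by lra.
    assert (Rabs phi < PI / 2) by (apply Rabs_def1; lra). assert (H1 := Rabs_pos phi).
    apply cos_decr_1; nra. }
  assert (Hd : forall r, 0 < r -> Cmod (Cexp (RtoC (nu * phi) * Ci) * BesselK nu (ray r phi) - BesselK nu (RtoC r))%C
    <= c * Rpower r (1 - m)).
  { intros r Hr.
    set (f := fun s => (Cexp (RtoC (nu * (s * phi)) * Ci) * BesselK nu (ray r (s * phi)))%C).
    set (f' := fun s => (- (RtoC phi * Ci) * (Cexp (RtoC (nu * (s * phi)) * Ci) * (ray r (s * phi) * BesselK (nu - 1) (ray r (s * phi)))))%C).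
    assert (HB := Cder_bounded_diff f f' (c * Rpower r (1 - m)) 0 1 Rle_0_1).
    assert (E1 : f 1 = (Cexp (RtoC (nu * phi) * Ci) * BesselK nu (ray r phi))%C) by (unfold f; now rewrite Rmult_1_l).
    assert (E0 : f 0 = BesselK nu (RtoC r)).
    { unfold f, ray. rewrite Rmult_0_l, Rmult_0_r, Cmult_0_l, Cexp_0, Cmult_1_l, Cmult_1_r. reflexivity. }
    rewrite E1, E0, Rminus_0_r, Rmult_1_r in HB. apply HB; clear HB.
    - intros s Hs. assert (HRe : 0 < Re (ray r (s * phi))).
      { rewrite Re_ray. apply Rmult_lt_0_compat; auto. generalize (Hcs s Hs). lra. }
      assert (Hlin : forall k : R, Cder (fun s => RtoC (k * (s * phi)) * Ci)%C s (RtoC (k * phi) * Ci)%C).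
      { intros k. eapply Cder_eq. apply (Cder_mult (fun s => RtoC (k * (s * phi))) (fun _ => Ci)).
        apply Cder_RtoC with (l := k * phi). auto_derive; auto. ring. apply Cder_const. cbv beta. ring. }
      assert (Hray : Cder (fun s => ray r (s * phi)) s (RtoC phi * Ci * ray r (s * phi))%C).
      { unfold ray. eapply Cder_eq. apply Cder_scal. apply Cder_Cexp.
        eapply Cder_ext. 2: apply (Hlin 1). intros u. cbv beta. now rewrite Rmult_1_l.
        rewrite Rmult_1_l. ring. }
      eapply Cder_eq. apply Cder_mult. apply Cder_Cexp, Hlin. apply (Cder_BesselK nu _ s _ HRe Hray).
      cbv beta. unfold f'.
      set (z := ray r (s * phi)) in *. set (e := Cexp (RtoC (nu * (s * phi)) * Ci)).
      transitivity (RtoC (nu * phi) * Ci * e * BesselK nu z + e * (RtoC phi * Ci * (z * dBesselK nu z)))%C. ring.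
      rewrite mul_dBesselK by auto. rewrite RtoC_mult. ring.
    - intros s Hs. assert (HRe : Re (ray r (s * phi)) = r * cos (s * phi)) by apply Re_ray.
      assert (Hcs' := Hcs s Hs).
      unfold f'. rewrite !Cmod_mult, Cmod_opp, Cmod_mult, Cmod_Ci, Cmod_R, Cmod_Cexp, Rmult_1_r.
      replace (Re (RtoC (nu * (s * phi)) * Ci)%C) with 0 by (rewrite re_scal_l, Re_Ci; ring).
      rewrite exp_0, Rmult_1_l.
      assert (HK : Cmod (BesselK (nu - 1) (ray r (s * phi))) <= (bessel_const m / m) * (Rpower r (- m) * Rpower (cos phi) (- m))).
      { eapply Rle_trans. apply (BesselK_bound (nu - 1) _ m); auto. apply Rmax_l. rewrite HRe; nra.
        apply Rmult_le_compat_l. left; apply Rdiv_lt_0_compat; auto; apply bessel_const_pos.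
        rewrite HRe, <- Rpower_mult_distr by lra. apply Rmult_le_compat_l. left; apply Rpower_pos.
        rewrite !Rpower_Ropp. apply Rinv_le_contravar. apply Rpower_pos. apply Rle_Rpower_l. lra. split; auto. }
      assert (Hmr : Cmod (ray r (s * phi)) = r).
      { unfold ray. rewrite Cmod_mult, Cmod_RtoC_pos, Cmod_Cexp by lra.
        replace (Re (RtoC (s * phi) * Ci)%C) with 0 by (rewrite re_scal_l, Re_Ci; ring). rewrite exp_0. ring. }
      rewrite Hmr. unfold c. replace (1 - m) with (1 + - m) by ring. rewrite (Rpower_plus 1 (- m) r), Rpower_1 by auto.
      apply Rle_trans with (Rabs phi * (r * (bessel_const m / m * (Rpower r (- m) * Rpower (cos phi) (- m))))).
      apply Rmult_le_compat_l. apply Rabs_pos. apply Rmult_le_compat_l; lra. right; ring. }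
  apply tends0_ext with (fun r => RtoC (Rpower r nu) * (Cexp (RtoC (nu * phi) * Ci) * BesselK nu (ray r phi) - BesselK nu (RtoC r))
     + RtoC (Rpower r nu) * BesselK nu (RtoC r))%C.
  { intros; ring. }
  replace (RtoC (Rpower 2 (nu - 1) * Euler_Gamma nu)) with (0 + RtoC (Rpower 2 (nu - 1) * Euler_Gamma nu))%C by ring.
  apply tends0_plus; [|now apply BesselK_limit_real].
  apply tends0_zero with c (nu + 1 - m); auto. lra.
  intros r Hr. rewrite Cmod_mult, Cmod_RtoC_pos by (left; apply Rpower_pos).
  eapply Rle_trans. apply Rmult_le_compat_l. left; apply Rpower_pos. now apply Hd.
  right. replace (nu + 1 - m) with (nu + (1 - m)) by ring. rewrite Rpower_plus. ring.
Qed.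

(** * Symbols on a sector *)

Definition sector (s : R) (a : C) : Prop := a <> 0 /\ s * Cmod a <= Re a.

Definition pw (A B : R) (a : C) (t : R) : R := Rpower (t / Cmod a) A + Rpower (t / Cmod a) B.

Lemma sector_Cmod s a : sector s a -> 0 < Cmod a.
Proof. intros [H _]. now apply Cmod_gt_0. Qed.

Lemma sector_ratio s a t : sector s a -> 0 < t -> 0 < t / Cmod a.
Proof. intros H Ht. apply Rdiv_lt_0_compat; auto. now apply (sector_Cmod s). Qed.

Lemma sector_Re s a : 0 < s -> sector s a -> 0 < Re a.
Proof. intros Hs H. assert (H1 := sector_Cmod s a H). destruct H. nra. Qed.

Lemma pw_pos A B a t : 0 < pw A B a t.
Proof. unfold pw. generalize (Rpower_pos (t / Cmod a) A) (Rpower_pos (t / Cmod a) B). lra. Qed.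

Lemma pw_ge A B e a t : A <= e <= B -> 0 < t / Cmod a -> Rpower (t / Cmod a) e <= pw A B a t.
Proof.
  intros He Ht. unfold pw.
  assert (H1 := Rpower_pos (t / Cmod a) A). assert (H2 := Rpower_pos (t / Cmod a) B).
  destruct (Rle_lt_dec (t / Cmod a) 1).
  - assert (Rpower (t / Cmod a) e <= Rpower (t / Cmod a) A) by (apply Rpower_exponent_le; intros; lra). lra.
  - assert (Rpower (t / Cmod a) e <= Rpower (t / Cmod a) B) by (apply Rpower_exponent_le; intros; lra). lra.
Qed.

Lemma pw_mono A B A' B' a t : A' <= A -> A <= B -> B <= B' -> 0 < t / Cmod a -> pw A B a t <= 2 * pw A' B' a t.
Proof.
  intros H1 H2 H3 Ht. unfold pw at 1.
  generalize (pw_ge A' B' A a t ltac:(lra) Ht) (pw_ge A' B' B a t ltac:(lra) Ht). lra.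
Qed.

Lemma pw_mult A B A' B' a t : A <= B -> A' <= B' -> 0 < t / Cmod a ->
  pw A B a t * pw A' B' a t <= 4 * pw (A + A') (B + B') a t.
Proof.
  intros H1 H2 Ht. unfold pw at 1 2.
  rewrite !Rmult_plus_distr_r, !Rmult_plus_distr_l, <- !Rpower_plus.
  generalize (pw_ge (A + A') (B + B') (A + A') a t ltac:(lra) Ht) (pw_ge (A + A') (B + B') (A + B') a t ltac:(lra) Ht)
   (pw_ge (A + A') (B + B') (B + A') a t ltac:(lra) Ht) (pw_ge (A + A') (B + B') (B + B') a t ltac:(lra) Ht). lra.
Qed.

Lemma pw_doubling A B s a t t' : sector s a -> 1 <= t -> t <= t' <= t + 1 ->
  pw A B a t' <= (Rpower 2 (Rabs A) + Rpower 2 (Rabs B)) * pw A B a t.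
Proof.
  intros Ha Ht Ht'. assert (HM := sector_Cmod s a Ha).
  assert (H0 : 0 < t / Cmod a) by (apply Rdiv_lt_0_compat; lra).
  assert (H1 : t / Cmod a <= t' / Cmod a <= 2 * (t / Cmod a)).
  { unfold Rdiv. assert (0 < / Cmod a) by now apply Rinv_0_lt_compat. nra. }
  unfold pw. generalize (Rpower_doubling A _ _ H0 H1) (Rpower_doubling B _ _ H0 H1).
  generalize (Rpower_pos 2 (Rabs A)) (Rpower_pos 2 (Rabs B)) (Rpower_pos (t / Cmod a) A) (Rpower_pos (t / Cmod a) B).
  nra.
Qed.

Lemma Sym_pw_mono s A B A' B' N g : A' <= A -> A <= B -> B <= B' ->
  Sym (sector s) (pw A B) N g -> Sym (sector s) (pw A' B') N g.
Proof.
  intros H1 H2 H3. apply Sym_weight with 2. lra. intros p t Hp Ht. apply pw_mono; auto. now apply (sector_ratio s).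
Qed.

Lemma Sym_pw_mult s A B A' B' N g h : A <= B -> A' <= B' ->
  Sym (sector s) (pw A B) N g -> Sym (sector s) (pw A' B') N h ->
  Sym (sector s) (pw (A + A') (B + B')) N (fun p t => g p t * h p t)%C.
Proof.
  intros H1 H2. apply Sym_mult with 4. lra. intros; left; apply pw_pos.
  intros p t Hp Ht. apply pw_mult; auto. now apply (sector_ratio s).
Qed.

Definition xp (al : R) (a : C) (t : R) : C := (RtoC (Rpower t al) * Cpower a (RtoC (- al)))%C.

Lemma Cmod_xp al a t : 0 < Cmod a -> 0 < t -> Cmod (xp al a t) = Rpower (t / Cmod a) al.
Proof.
  intros Ha Ht. unfold xp. rewrite Cmod_mult, Cmod_RtoC_pos by (left; apply Rpower_pos).
  rewrite Cmod_Cpower, Rpower_div_l; auto.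
Qed.

Lemma xp_mult al be a t : (xp al a t * xp be a t)%C = xp (al + be) a t.
Proof.
  unfold xp. rewrite Rpower_plus, RtoC_mult, Ropp_plus_distr, Cpower_add. ring.
Qed.

Lemma xp_0 a t : 0 < t -> xp 0 a t = 1.
Proof. intros Ht. unfold xp. rewrite Rpower_O, Ropp_0, Cpower_0 by auto. ring. Qed.

Lemma Cder_xp al a t : 0 < t -> Cder (xp al a) t (RtoC (/ t) * (RtoC al * xp al a t))%C.
Proof.
  intros Ht. unfold xp. eapply Cder_eq. apply Cder_mult. apply Cder_RtoC. now apply is_derive_Rpower.
  apply Cder_const. cbv beta. rewrite !RtoC_mult. ring.
Qed.

Lemma Sym_xp s al A B N : A <= al <= B -> Sym (sector s) (pw A B) N (xp al).
Proof.
  intros H. assert (Hb : dominated (sector s) (pw A B) (xp al)).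
  { exists 1. split. lra. intros p t Hp Ht. rewrite Cmod_xp, Rmult_1_l; auto. 2: now apply (sector_Cmod s).
    apply pw_ge; auto. now apply (sector_ratio s). }
  induction N. now apply Sym_0.
  apply Sym_S with (fun p t => RtoC al * xp al p t)%C; auto.
  intros; now apply Cder_xp. now apply Sym_scal.
Qed.

Lemma tends0_xp al a : 0 < Cmod a -> 0 < al -> tends0 (xp al a) 0.
Proof.
  intros Ha Hal. apply tends0_zero with (Rpower (Cmod a) (- al)) al; auto. left; apply Rpower_pos.
  intros r Hr. rewrite Cmod_xp by auto. right. rewrite Rpower_div_l by auto. ring.
Qed.

(* First-order equation [(t d/dt + kap) g = h]: the integrating factor [xp kap]
   transfers the bound of [h] to [g] when the product vanishes at the origin. *)
Lemma ode_bound s A B kap g h : A <= B -> 0 < A + kap ->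
  (forall a t, sector s a -> 0 < t -> Cder (g a) t (RtoC (/ t) * (h a t - RtoC kap * g a t))%C) ->
  dominated (sector s) (pw A B) h ->
  (forall a, sector s a -> tends0 (fun t => xp kap a t * g a t)%C 0) ->
  dominated (sector s) (pw A B) g.
Proof.
  intros HAB HA Hder [c [Hc Hh]] H0.
  exists (c / (A + kap)). split. apply Rmult_le_pos; auto. left; now apply Rinv_0_lt_compat.
  intros a t Ha Ht. assert (HM := sector_Cmod s a Ha).
  set (phi := fun u => c * (Rpower (u / Cmod a) (A + kap) / (A + kap) + Rpower (u / Cmod a) (B + kap) / (B + kap))).
  set (phi' := fun u => c * (/ u * (Rpower (u / Cmod a) (A + kap) + Rpower (u / Cmod a) (B + kap)))).
  assert (Hphi : forall u, 0 < u -> is_derive phi u (phi' u)).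
  { intros u Hu. unfold phi, phi'.
    assert (Hd : forall e, is_derive (fun u => Rpower (u / Cmod a) e) u (/ u * (e * Rpower (u / Cmod a) e))).
    { intros e. evar_last. apply (is_derive_comp (fun y => Rpower y e) (fun u => u / Cmod a)).
      apply is_derive_Rpower. now apply Rdiv_lt_0_compat.
      instantiate (1 := / Cmod a). auto_derive; auto. field. lra.
      change scal with Rmult. match goal with |- @eq _ ?a ?b => change (@eq R a b) end. field. lra. }
    evar_last. apply is_derive_scal. apply @is_derive_plus.
    apply (is_derive_ext (fun v => / (A + kap) * Rpower (v / Cmod a) (A + kap))). intros; unfold Rdiv; Rring.
    apply is_derive_scal, Hd.
    apply (is_derive_ext (fun v => / (B + kap) * Rpower (v / Cmod a) (B + kap))). intros; unfold Rdiv; Rring.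
    apply is_derive_scal, Hd.
    change plus with Rplus. match goal with |- @eq _ ?a ?b => change (@eq R a b) end. field. repeat split; lra. }
  assert (Hphi0 : forall u, 0 < u -> 0 <= phi u).
  { intros u Hu. unfold phi. apply Rmult_le_pos; auto. apply Rplus_le_le_0_compat;
    (apply Rmult_le_pos; [left; apply Rpower_pos|left; apply Rinv_0_lt_compat; lra]). }
  set (G := fun u => (xp kap a u * g a u)%C).
  assert (HG : forall e, 0 < e <= t -> Cmod (G t - G e)%C <= phi t).
  { intros e He. apply Rle_trans with (phi t - phi e). 2: generalize (Hphi0 e ltac:(lra)); lra.
    apply (Cder_mean_value G (fun u => RtoC (/ u) * (xp kap a u * h a u))%C phi phi'). lra.
    - intros u Hu. unfold G. eapply Cder_eq. apply Cder_mult. apply Cder_xp; lra. apply Hder; auto; lra. ring.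
    - intros u Hu. apply Hphi. lra.
    - intros u Hu. rewrite !Cmod_mult, Cmod_RtoC_pos by (left; apply Rinv_0_lt_compat; lra).
      rewrite Cmod_xp by lra. unfold phi'.
      assert (HU := Hh a u Ha ltac:(lra)). unfold pw in HU. rewrite !Rpower_plus.
      replace (c * (/ u * (Rpower (u / Cmod a) A * Rpower (u / Cmod a) kap + Rpower (u / Cmod a) B * Rpower (u / Cmod a) kap)))
        with (/ u * (Rpower (u / Cmod a) kap * (c * (Rpower (u / Cmod a) A + Rpower (u / Cmod a) B)))) by ring.
      apply Rmult_le_compat_l. left; apply Rinv_0_lt_compat; lra.
      apply Rmult_le_compat_l; auto. left; apply Rpower_pos. }
  assert (HGt : Cmod (G t) <= phi t).
  { apply le_epsilon. intros eps Heps. destruct (H0 a Ha eps Heps) as [r0 [Hr0 Hr]].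
    set (e := Rmin t (r0 / 2)). assert (He : 0 < e) by (apply Rmin_glb_lt; lra).
    assert (He1 : e <= t) by apply Rmin_l. assert (He2 : e <= r0 / 2) by apply Rmin_r.
    specialize (HG e (conj He He1)). specialize (Hr e ltac:(lra)). cbv beta in Hr. fold (G e) in Hr.
    replace (G t) with ((G t - G e) + (G e - 0))%C by ring.
    eapply Rle_trans; [apply Cmod_triangle|]. lra. }
  unfold G in HGt. rewrite Cmod_mult, Cmod_xp in HGt by auto.
  assert (HP := Rpower_pos (t / Cmod a) kap).
  apply Rmult_le_reg_l with (Rpower (t / Cmod a) kap); auto.
  eapply Rle_trans; [apply HGt|]. unfold phi, pw. rewrite !Rpower_plus.
  set (X := Rpower (t / Cmod a) kap) in *. set (Y := Rpower (t / Cmod a) A). set (Z := Rpower (t / Cmod a) B).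
  replace (X * (c / (A + kap) * (Y + Z))) with (c * (Y * X / (A + kap) + Z * X / (A + kap))) by (field; lra).
  apply Rmult_le_compat_l; auto. apply Rplus_le_compat_l. unfold Rdiv. apply Rmult_le_compat_l.
  apply Rmult_le_pos; [left; apply Rpower_pos|lra]. apply Rinv_le_contravar; lra.
Qed.

Lemma Sym_ode s A B kap g h : A <= B -> 0 < A + kap ->
  (forall a t, sector s a -> 0 < t -> Cder (g a) t (RtoC (/ t) * (h a t - RtoC kap * g a t))%C) ->
  (forall N, Sym (sector s) (pw A B) N h) ->
  (forall a, sector s a -> tends0 (fun t => xp kap a t * g a t)%C 0) ->
  forall N, Sym (sector s) (pw A B) N g.
Proof.
  intros HAB HA Hder Hh H0.
  assert (Hb := ode_bound s A B kap g h HAB HA Hder (Sym_bound _ _ _ _ (Hh O)) H0).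
  induction N. now apply Sym_0.
  apply Sym_S with (fun a t => h a t - RtoC kap * g a t)%C; auto.
  apply Sym_minus; auto. now apply Sym_scal.
Qed.

Lemma Csum_lt_S (f : nat -> C) K : Csum_lt f (S K) = (Csum_lt f K + f K)%C.
Proof.
  destruct K; simpl. rewrite Csum_O. Cring. apply Csum_Sn.
Qed.

Lemma Csum_lt_shift (f : nat -> C) K : Csum_lt f (S K) = (f 0%nat + Csum_lt (fun k => f (S k)) K)%C.
Proof.
  induction K. rewrite Csum_lt_S. simpl. ring. rewrite Csum_lt_S, IHK, Csum_lt_S. ring.
Qed.

Lemma Csum_lt_ext (f g : nat -> C) K : (forall k, (k < K)%nat -> f k = g k) -> Csum_lt f K = Csum_lt g K.
Proof.
  induction K; intros H. reflexivity. rewrite !Csum_lt_S, IHK, H; auto.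
Qed.

Lemma Csum_lt_scal c (f : nat -> C) K : Csum_lt (fun k => c * f k)%C K = (c * Csum_lt f K)%C.
Proof.
  induction K. simpl. ring. rewrite !Csum_lt_S, IHK. ring.
Qed.

Lemma Csum_lt_plus (f g : nat -> C) K : Csum_lt (fun k => f k + g k)%C K = (Csum_lt f K + Csum_lt g K)%C.
Proof.
  induction K. simpl. ring. rewrite !Csum_lt_S, IHK. ring.
Qed.

Lemma Cder_Csum_lt (f : nat -> R -> C) (f' : nat -> C) c t K :
  (forall k, (k < K)%nat -> Cder (f k) t (c * f' k)%C) ->
  Cder (fun u => Csum_lt (fun k => f k u) K) t (c * Csum_lt f' K)%C.
Proof.
  induction K; intros H.
  - apply (Cder_eq (fun _ => RtoC 0) t 0). apply Cder_const. simpl. ring.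
  - eapply Cder_ext. intros u. symmetry. apply Csum_lt_S.
    eapply Cder_eq. apply Cder_plus. apply IHK; auto. apply (H K); lia. rewrite Csum_lt_S. ring.
Qed.

Lemma Sym_Csum_lt {P} (dom : P -> Prop) W N (f : nat -> P -> R -> C) K :
  (forall p t, dom p -> 0 < t -> 0 <= W p t) ->
  (forall k, (k < K)%nat -> Sym dom W N (f k)) -> Sym dom W N (fun p t => Csum_lt (fun k => f k p t) K).
Proof.
  intros HW. induction K; intros H.
  - now apply Sym_zero.
  - apply Sym_ext with (fun p t => Csum_lt (fun k => f k p t) K + f K p t)%C.
    intros; symmetry; apply Csum_lt_S. apply Sym_plus; auto.
Qed.

Lemma tends0_Csum_lt (f : nat -> R -> C) K :
  (forall k, (k < K)%nat -> tends0 (f k) 0) -> tends0 (fun t => Csum_lt (fun k => f k t) K) 0.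
Proof.
  induction K; intros H. exact (tends0_const 0).
  apply tends0_ext with (fun t => Csum_lt (fun k => f k t) K + f K t)%C.
  intros; symmetry; apply Csum_lt_S. replace (RtoC 0) with (0 + 0)%C by ring. apply tends0_plus; auto.
Qed.

(** * Expansion of the algebraic factor *)

Definition radicand (a : C) (t : R) : C := (RtoC t ^ 2 + a ^ 2)%C.

Lemma radicand_slit a t : 0 < Re a -> slit_plane (radicand a t).
Proof.
  intros Ha. unfold slit_plane. destruct (Rlt_le_dec 0 (Cmod (radicand a t) + Re (radicand a t))) as [|H]; auto.
  exfalso. assert (HM := Cmod_ge_0 (radicand a t)). assert (Hsq := Cmod_sqr (radicand a t)).
  assert (HR : Re (radicand a t) = t * t + Re a * Re a - Im a * Im a).
  { unfold radicand, Re, Im. simpl. ring. }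
  assert (HI : Im (radicand a t) = 2 * Re a * Im a).
  { unfold radicand, Re, Im. simpl. ring. }
  assert (Im (radicand a t) * Im (radicand a t) <= 0) by nra.
  assert (HI0 : Im (radicand a t) = 0) by nra.
  assert (Im a = 0) by nra. rewrite H1 in HR. nra.
Qed.

Lemma radicand_Cmod_ge s a t : 0 < s -> sector s a -> s ^ 2 * Cmod a ^ 2 <= Cmod (radicand a t).
Proof.
  intros Hs Ha. assert (HM := sector_Cmod s a Ha). assert (HR := sector_Re s a Hs Ha). destruct Ha as [_ Ha].
  replace (radicand a t) with ((a + RtoC t * Ci) * (a - RtoC t * Ci))%C.
  2: { unfold radicand. assert (HC : (Ci * Ci = - RtoC 1)%C) by (apply C_ext; simpl; ring).
       transitivity (a * a - RtoC t * RtoC t * (Ci * Ci))%C. ring. rewrite HC. simpl. ring. }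
  rewrite Cmod_mult.
  assert (H1 : s * Cmod a <= Cmod (a + RtoC t * Ci)%C).
  { eapply Rle_trans; [apply Ha|]. replace (Re a) with (Re (a + RtoC t * Ci)%C). apply Re_le_Cmod.
    rewrite Re_plus, re_scal_l, Re_Ci. ring. }
  assert (H2 : s * Cmod a <= Cmod (a - RtoC t * Ci)%C).
  { eapply Rle_trans; [apply Ha|]. replace (Re a) with (Re (a - RtoC t * Ci)%C). apply Re_le_Cmod.
    rewrite Re_minus, re_scal_l, Re_Ci. ring. }
  replace (s ^ 2 * Cmod a ^ 2) with ((s * Cmod a) * (s * Cmod a)) by ring.
  apply Rmult_le_compat; auto; apply Rmult_le_pos; lra.
Qed.

Lemma Cder_radicand a t : Cder (radicand a) t (RtoC (2 * t)).
Proof.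
  unfold radicand. eapply Cder_eq. apply Cder_plus.
  apply (Cder_ext (fun u => RtoC u * RtoC u)%C). intros; simpl; ring.
  apply Cder_mult; apply Cder_id. apply Cder_const. cbv beta. rewrite RtoC_mult.
  rewrite RtoC_two. ring.
Qed.

Definition vfac (a : C) (t : R) : C := (a ^ 2 * Cexp (- Cln (radicand a t)))%C.

Definition qfac (mu : R) (a : C) (t : R) : C :=
  (Cpower a (RtoC (2 * mu)) * Cexp (- RtoC mu * Cln (radicand a t)))%C.

Lemma radicand_neq_0 a t : 0 < Re a -> radicand a t <> 0.
Proof. intros. now apply slit_plane_neq, radicand_slit. Qed.

Lemma vfac_eq a t : 0 < Re a -> vfac a t = (a ^ 2 / radicand a t)%C.
Proof.
  intros Ha. unfold vfac. rewrite Cexp_opp, Cexp_Cln. reflexivity. now apply radicand_neq_0.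
Qed.

Lemma qfac_eq mu a t : qfac mu a t = (Cpower a (RtoC (2 * mu)) / Cpower (radicand a t) (RtoC mu))%C.
Proof.
  unfold qfac, Cpower, Cdiv. f_equal. rewrite <- Cexp_opp. f_equal. ring.
Qed.

Lemma xp_two_vfac a t : 0 < Re a -> 0 < t -> (xp 2 a t * vfac a t = 1 - vfac a t)%C.
Proof.
  intros Ha Ht. assert (Hz := radicand_neq_0 a t Ha). assert (Ha0 := Re_pos_neq a Ha).
  rewrite vfac_eq by auto. unfold xp. rewrite Cpower_opp.
  change 2 with (INR 2). rewrite Cpower_INR, Rpower_pow, RtoC_pow by auto.
  unfold radicand in *. field. auto.
Qed.

Lemma Cder_vfac a t : 0 < Re a -> 0 < t ->
  Cder (vfac a) t (RtoC (/ t) * (RtoC (- 2) * ((1 - vfac a t) * vfac a t)))%C.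
Proof.
  intros Ha Ht. assert (Hz := radicand_neq_0 a t Ha). assert (Ha0 := Re_pos_neq a Ha).
  eapply Cder_eq. unfold vfac. apply Cder_scal, Cder_Cexp, Cder_opp.
  apply (Cder_Cln (radicand a) t). now apply radicand_slit. apply Cder_radicand.
  fold (vfac a t). replace (RtoC (- 2)) with (- RtoC 2)%C by (apply C_ext; simpl; ring).
  transitivity (- (RtoC (2 * t) / radicand a t) * vfac a t)%C. unfold vfac. ring.
  rewrite vfac_eq by auto. rewrite RtoC_mult, RtoC_inv by lra. unfold radicand in *.
  assert (RtoC t <> 0) by (apply RtoC_neq; lra). field. auto.
Qed.

Lemma Cder_qfac mu a t : 0 < Re a ->
  Cder (qfac mu a) t (- RtoC mu * (RtoC (2 * t) / radicand a t) * qfac mu a t)%C.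
Proof.
  intros Ha. eapply Cder_eq. unfold qfac. apply Cder_scal, Cder_Cexp, Cder_scal.
  apply (Cder_Cln (radicand a) t). now apply radicand_slit. apply Cder_radicand.
  unfold qfac. ring.
Qed.

Lemma Cder_qfac_pos mu a t : 0 < Re a -> 0 < t ->
  Cder (qfac mu a) t (RtoC (/ t) * (RtoC (- 2 * mu) * ((1 - vfac a t) * qfac mu a t)))%C.
Proof.
  intros Ha Ht. assert (Hz := radicand_neq_0 a t Ha). assert (Ha0 := Re_pos_neq a Ha).
  eapply Cder_eq. now apply Cder_qfac. rewrite vfac_eq by auto.
  replace (RtoC (- 2 * mu)) with (- (RtoC 2 * RtoC mu))%C by (apply C_ext; simpl; ring).
  rewrite !RtoC_mult, RtoC_inv by lra. unfold radicand in *.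
  assert (RtoC t <> 0) by (apply RtoC_neq; lra). field. auto.
Qed.

Lemma Sym_vfac s N : 0 < s -> Sym (sector s) (pw 0 0) N vfac.
Proof.
  intros Hs. assert (Hb : dominated (sector s) (pw 0 0) vfac).
  { exists (/ s ^ 2). assert (Hs2 : 0 < s ^ 2) by (apply pow_lt; auto). split. left; now apply Rinv_0_lt_compat.
    intros a t Ha Ht. assert (HR := sector_Re s a Hs Ha). assert (HM := sector_Cmod s a Ha).
    rewrite vfac_eq, Cmod_div by (auto; now apply radicand_neq_0).
    unfold pw. rewrite Rpower_O by now apply (sector_ratio s).
    assert (HZ := radicand_Cmod_ge s a t Hs Ha). rewrite Cmod_pow.
    assert (HM2 : 0 < Cmod a ^ 2) by (apply pow_lt; auto).
    assert (Hr : 0 < Cmod (radicand a t)) by nra.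
    apply Rle_trans with (/ s ^ 2).
    - apply Rle_div_l; auto. apply Rle_trans with (/ s ^ 2 * (s ^ 2 * Cmod a ^ 2)).
      right. field. lra. apply Rmult_le_compat_l; auto. left; now apply Rinv_0_lt_compat.
    - assert (0 < / s ^ 2) by now apply Rinv_0_lt_compat. lra. }
  induction N. now apply Sym_0.
  apply Sym_S with (fun a t => RtoC (- 2) * ((1 - vfac a t) * vfac a t))%C; auto.
  - intros a t Ha Ht. apply Cder_vfac; auto. now apply (sector_Re s).
  - apply Sym_scal. replace (pw 0 0) with (pw (0 + 0) (0 + 0)) by now rewrite Rplus_0_r.
    apply Sym_pw_mult; try lra; auto. apply Sym_minus; auto.
    apply Sym_ext with (xp 0). intros; now apply xp_0. apply Sym_xp. lra.
Qed.

Lemma Sym_one_minus_vfac s N : 0 < s -> Sym (sector s) (pw 2 2) N (fun a t => 1 - vfac a t)%C.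
Proof.
  intros Hs. apply Sym_ext with (fun a t => xp 2 a t * vfac a t)%C.
  intros a t Ha Ht. apply xp_two_vfac; auto. now apply (sector_Re s).
  replace (pw 2 2) with (pw (2 + 0) (2 + 0)) by now rewrite Rplus_0_r.
  apply Sym_pw_mult; try lra. apply Sym_xp; lra. now apply Sym_vfac.
Qed.

Lemma Sym_qfac mu s N : 0 < mu -> 0 < s -> Sym (sector s) (pw 0 0) N (qfac mu).
Proof.
  intros Hmu Hs. assert (Hb : dominated (sector s) (pw 0 0) (qfac mu)).
  { exists (Rpower (s ^ 2) (- mu)). assert (Hs2 : 0 < s ^ 2) by (apply pow_lt; auto). split. left; apply Rpower_pos.
    intros a t Ha Ht. assert (HR := sector_Re s a Hs Ha). assert (HM := sector_Cmod s a Ha).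
    rewrite qfac_eq, Cmod_div, !Cmod_Cpower by apply Cpower_neq_0.
    unfold pw. rewrite Rpower_O by now apply (sector_ratio s).
    assert (HZ := radicand_Cmod_ge s a t Hs Ha).
    assert (HM2 : 0 < Cmod a ^ 2) by (apply pow_lt; auto).
    assert (Hr : 0 < Cmod (radicand a t)) by nra.
    apply Rle_trans with (Rpower (s ^ 2) (- mu)). 2: generalize (Rpower_pos (s ^ 2) (- mu)); lra.
    assert (E : Rpower (Cmod a) (2 * mu) = Rpower (Cmod a ^ 2) mu).
    { rewrite <- Rpower_mult. f_equal. change 2 with (INR 2). now rewrite Rpower_pow. }
    rewrite E, Rpower_Ropp. assert (HP := Rpower_pos (Cmod (radicand a t)) mu).
    assert (HP2 := Rpower_pos (s ^ 2) mu).
    apply Rmult_le_reg_r with (Rpower (Cmod (radicand a t)) mu); auto.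
    unfold Rdiv. rewrite Rmult_assoc, Rinv_l, Rmult_1_r by lra.
    apply Rmult_le_reg_l with (Rpower (s ^ 2) mu); auto. rewrite <- Rmult_assoc, Rinv_r, Rmult_1_l by lra.
    rewrite Rpower_mult_distr by auto. apply Rle_Rpower_l. lra. split; auto. apply Rmult_lt_0_compat; auto. }
  induction N. now apply Sym_0.
  apply Sym_S with (fun a t => RtoC (- 2 * mu) * ((1 - vfac a t) * qfac mu a t))%C; auto.
  - intros a t Ha Ht. apply Cder_qfac_pos; auto. now apply (sector_Re s).
  - apply Sym_scal. replace (pw 0 0) with (pw (0 + 0) (0 + 0)) by now rewrite Rplus_0_r.
    apply Sym_pw_mult; try lra; auto. apply Sym_minus; [|now apply Sym_vfac].
    apply Sym_ext with (xp 0). intros; now apply xp_0. apply Sym_xp. lra.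
Qed.

Lemma tends0_of_Cder f l : Cder f 0 l -> tends0 f (f 0).
Proof.
  intros H eps Heps. destruct (Cder_epsilon_inv f 0 l H 1 Rlt_0_1) as [d [Hd HH]].
  assert (Hl := Cmod_ge_0 l).
  exists (Rmin d (eps / (2 + Cmod l))). split. apply Rmin_glb_lt; auto. apply Rdiv_lt_0_compat; lra.
  intros r Hr. assert (r < d) by (eapply Rlt_le_trans; [apply Hr|apply Rmin_l]).
  assert (Hr2 : r < eps / (2 + Cmod l)) by (eapply Rlt_le_trans; [apply Hr|apply Rmin_r]).
  specialize (HH r ltac:(rewrite Rabs_pos_eq; lra)). rewrite Rplus_0_l, Rabs_pos_eq in HH by lra.
  replace (f r - f 0)%C with ((f r - f 0%R - RtoC r * l) + RtoC r * l)%C by ring.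
  eapply Rle_lt_trans; [apply Cmod_triangle|]. rewrite Cmod_mult, Cmod_RtoC_pos by lra.
  apply (Rmult_lt_compat_r (2 + Cmod l)) in Hr2; [|lra].
  replace (eps / (2 + Cmod l) * (2 + Cmod l)) with eps in Hr2 by (field; lra). nra.
Qed.

Lemma qfac_at_0 mu a : 0 < Re a -> qfac mu a 0 = 1.
Proof.
  intros Ha. rewrite qfac_eq. unfold radicand. replace (RtoC 0 ^ 2 + a ^ 2)%C with (a ^ 2)%C by (simpl; ring).
  rewrite Cpower_sqr by auto. field. apply Cpower_neq_0.
Qed.

Definition qcoef (mu : R) (k : nat) : R := (-1) ^ k * poch mu k / INR (fact k).

Definition qrem (mu : R) (K : nat) (a : C) (t : R) : C :=
  (qfac mu a t - Csum_lt (fun k => RtoC (qcoef mu k) * xp (2 * INR k) a t) K)%C.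

Lemma qcoef_S mu k : 2 * INR (S k) * qcoef mu (S k) = - (2 * (mu + INR k) * qcoef mu k).
Proof.
  unfold qcoef. rewrite fact_simpl, mult_INR. simpl pow. simpl poch.
  assert (H := INR_fact_pos k). assert (0 < INR (S k)) by (apply lt_0_INR; lia). field. lra.
Qed.

Lemma qrem_S mu K a t : qrem mu (S K) a t = (qrem mu K a t - RtoC (qcoef mu K) * xp (2 * INR K) a t)%C.
Proof. unfold qrem. rewrite Csum_lt_S. ring. Qed.

Lemma Cder_qrem mu K a t : 0 < Re a -> 0 < t ->
  Cder (qrem mu K a) t (RtoC (/ t) * (RtoC (- 2 * mu) * ((1 - vfac a t) * qrem mu K a t)
    + RtoC (2 * INR K * qcoef mu K) * (vfac a t * xp (2 * INR K) a t)))%C.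
Proof.
  intros Ha Ht. induction K.
  - eapply Cder_ext. 2: eapply Cder_eq. 2: apply (Cder_qfac_pos mu a t Ha Ht).
    intros u. unfold qrem. simpl. ring. unfold qrem. simpl. rewrite Rmult_0_r, Rmult_0_l. ring.
  - eapply Cder_ext. intros u. symmetry. apply qrem_S.
    eapply Cder_eq. apply Cder_minus. apply IHK. apply Cder_scal. now apply Cder_xp.
    rewrite qrem_S, qcoef_S. 
    assert (E : (vfac a t * xp (2 * INR (S K)) a t = (1 - vfac a t) * xp (2 * INR K) a t)%C).
    { rewrite S_INR. replace (2 * (INR K + 1)) with (2 + 2 * INR K) by ring. rewrite <- xp_mult, <- xp_two_vfac by auto. ring. }
    rewrite E. 
    replace (RtoC (- (2 * (mu + INR K) * qcoef mu K))) with ((RtoC (- 2 * mu) - RtoC (2 * INR K)) * RtoC (qcoef mu K))%C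
      by (rewrite <- RtoC_minus, <- RtoC_mult; f_equal; ring).
    rewrite (RtoC_mult (2 * INR K) (qcoef mu K)). ring.
Qed.

Lemma Sym_qrem mu s K : 0 < mu -> 0 < s -> forall N, Sym (sector s) (pw (2 * INR K) (2 * INR K)) N (qrem mu K).
Proof.
  intros Hmu Hs. induction K; intros N.
  - simpl INR. rewrite Rmult_0_r. apply Sym_ext with (qfac mu). intros; unfold qrem; simpl; ring. now apply Sym_qfac.
  - revert N.
    assert (HK := pos_INR K).
    assert (HS : forall N, Sym (sector s) (pw (2 * INR K) (2 * INR K)) N (qrem mu (S K))).
    { intros N. apply Sym_ext with (fun a t => qrem mu K a t - RtoC (qcoef mu K) * xp (2 * INR K) a t)%C.
      intros; symmetry; apply qrem_S. apply Sym_minus; auto. apply Sym_scal. apply Sym_xp; lra. }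
    apply Sym_ode with 0 (fun a t => RtoC (- 2 * mu) * ((1 - vfac a t) * qrem mu (S K) a t)
      + RtoC (2 * INR (S K) * qcoef mu (S K)) * (vfac a t * xp (2 * INR (S K)) a t))%C.
    + lra.
    + rewrite S_INR. lra.
    + intros a t Ha Ht. eapply Cder_eq. apply Cder_qrem; auto. now apply (sector_Re s). ring.
    + intros N. apply Sym_plus; apply Sym_scal.
      * replace (2 * INR (S K)) with (2 + 2 * INR K) by (rewrite S_INR; ring).
        apply Sym_pw_mult; auto; try lra. now apply Sym_one_minus_vfac.
      * replace (pw (2 * INR (S K)) (2 * INR (S K))) with (pw (0 + 2 * INR (S K)) (0 + 2 * INR (S K))) by now rewrite Rplus_0_l.
        apply Sym_pw_mult; try lra. now apply Sym_vfac. apply Sym_xp; lra.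
    + intros a Ha. assert (HM := sector_Cmod s a Ha). assert (HR := sector_Re s a Hs Ha).
      apply tends0_ext with (qrem mu (S K) a). intros r Hr. rewrite xp_0 by auto. ring.
      destruct K.
      * apply tends0_ext with (fun t => qfac mu a t + - RtoC 1)%C.
        { intros r Hr. rewrite qrem_S. unfold qrem. simpl INR. rewrite Rmult_0_r, xp_0 by auto.
          unfold qcoef. simpl. replace (1 * 1 / 1) with 1 by field. ring. }
        replace (RtoC 0) with (qfac mu a 0 + - RtoC 1)%C by (rewrite qfac_at_0 by auto; ring).
        apply tends0_plus. 2: apply tends0_const. eapply tends0_of_Cder. now apply Cder_qfac.
      * destruct (Sym_bound _ _ _ _ (HS O)) as [c [Hc HB]].
        assert (HK1 : 0 < 2 * INR (S K)) by (assert (0 < INR (S K)) by (apply lt_0_INR; lia); lra).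
        apply tends0_zero with (c * (2 * Rpower (Cmod a) (- (2 * INR (S K))))) (2 * INR (S K)); auto.
        { apply Rmult_le_pos; auto. generalize (Rpower_pos (Cmod a) (- (2 * INR (S K)))). lra. }
        intros r Hr. eapply Rle_trans. apply HB; auto. unfold pw. rewrite Rpower_div_l by auto. right; ring.
Qed.

(** * Expansion of the Bessel function *)

Definition bz (b : R) (a : C) (t : R) : C := (RtoC (t * b) / a)%C.

Lemma Re_bz b s a t : 0 < b -> 0 < s -> sector s a -> 0 < t -> s * b * (t / Cmod a) <= Re (bz b a t).
Proof.
  intros Hb Hs Ha Ht. assert (HM := sector_Cmod s a Ha). destruct Ha as [Hz Ha].
  unfold bz. replace (RtoC (t * b) / a)%C with (RtoC (t * b / (Cmod a * Cmod a)) * Cconj a)%C.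
  - rewrite re_scal_l. replace (Re (Cconj a)) with (Re a) by reflexivity.
    replace (s * b * (t / Cmod a)) with (t * b / (Cmod a * Cmod a) * (s * Cmod a)) by (field; lra).
    apply Rmult_le_compat_l; auto. left. apply Rdiv_lt_0_compat; nra.
  - unfold Cdiv, Rdiv. rewrite (Cinv_eq_conj a), (RtoC_mult (t * b)) by auto. ring.
Qed.

Lemma Re_bz_pos b s a t : 0 < b -> 0 < s -> sector s a -> 0 < t -> 0 < Re (bz b a t).
Proof.
  intros Hb Hs Ha Ht. eapply Rlt_le_trans; [|apply (Re_bz b s); auto].
  assert (H := sector_ratio s a t Ha Ht). apply Rmult_lt_0_compat; auto. now apply Rmult_lt_0_compat.
Qed.

Lemma bz_xp b (a : C) t : a <> RtoC 0 -> 0 < t -> bz b a t = (RtoC b * xp 1 a t)%C.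
Proof.
  intros Ha Ht. unfold bz, xp. rewrite Cpower_opp, Rpower_1 by auto.
  replace (Cpower a (RtoC 1)) with (a ^ 1)%C by (rewrite <- (Cpower_INR a 1) by auto; reflexivity).
  rewrite RtoC_mult. field. auto.
Qed.

Lemma Cder_bz b a t : 0 < t -> Cder (bz b a) t (RtoC (/ t) * bz b a t)%C.
Proof.
  intros Ht. unfold bz. eapply Cder_eq. apply Cder_mult. apply Cder_RtoC with (l := b). auto_derive; auto. ring.
  apply Cder_const. cbv beta. unfold Cdiv. rewrite RtoC_mult, RtoC_inv by lra.
  assert (RtoC t <> 0) by (apply RtoC_neq; lra). generalize (/ a)%C. intros w. field. auto.
Qed.

Lemma Cder_BesselK_bz b nu s a t : 0 < b -> 0 < s -> sector s a -> 0 < t ->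
  Cder (fun u => BesselK nu (bz b a u)) t
    (RtoC (/ t) * (- (RtoC b * (xp 1 a t * BesselK (nu - 1) (bz b a t))) - RtoC nu * BesselK nu (bz b a t)))%C.
Proof.
  intros Hb Hs Ha Ht. assert (HR := Re_bz_pos b s a t Hb Hs Ha Ht).
  eapply Cder_eq. apply (Cder_BesselK nu (bz b a) t (RtoC (/ t) * bz b a t)%C HR). now apply Cder_bz.
  rewrite <- Cmult_assoc. rewrite mul_dBesselK by auto. rewrite (bz_xp b a t) at 2. ring. apply Ha. auto.
Qed.

Lemma Sym_BesselK b s N : 0 < b -> 0 < s -> forall nu m, 0 < m -> Rabs nu <= m ->
  Sym (sector s) (pw (- m) (- m)) N (fun a t => BesselK nu (bz b a t)).
Proof.
  intros Hb Hs.
  assert (Hbd : forall nu m, 0 < m -> Rabs nu <= m ->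
    dominated (sector s) (pw (- m) (- m)) (fun a t => BesselK nu (bz b a t))).
  { intros nu m Hm Hnu. exists (bessel_const m / m * Rpower (s * b) (- m)). split.
    { apply Rmult_le_pos. left; apply Rdiv_lt_0_compat; auto; apply bessel_const_pos. left; apply Rpower_pos. }
    intros a t Ha Ht. assert (HR := Re_bz_pos b s a t Hb Hs Ha Ht). assert (HR2 := Re_bz b s a t Hb Hs Ha Ht).
    assert (Hr := sector_ratio s a t Ha Ht).
    eapply Rle_trans. apply (BesselK_bound nu _ m); auto. rewrite Rmult_assoc. apply Rmult_le_compat_l.
    left; apply Rdiv_lt_0_compat; auto; apply bessel_const_pos.
    assert (Hsb : 0 < s * b) by now apply Rmult_lt_0_compat.
    apply Rle_trans with (Rpower (s * b) (- m) * Rpower (t / Cmod a) (- m)).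
    - rewrite Rpower_mult_distr by auto. rewrite !Rpower_Ropp. apply Rinv_le_contravar. apply Rpower_pos.
      apply Rle_Rpower_l. lra. split; auto. now apply Rmult_lt_0_compat.
    - apply Rmult_le_compat_l. left; apply Rpower_pos. apply pw_ge; auto. lra. }
  induction N; intros nu m Hm Hnu. now apply Sym_0, Hbd.
  apply Sym_S with (fun a t => - (RtoC b * (xp 1 a t * BesselK (nu - 1) (bz b a t))) - RtoC nu * BesselK nu (bz b a t))%C; auto.
  - intros a t Ha Ht. now apply (Cder_BesselK_bz b nu s).
  - apply Sym_minus; [apply Sym_opp|]; apply Sym_scal; auto.
    replace (- m) with (1 + - (m + 1)) by ring. apply Sym_pw_mult; try lra. apply Sym_xp; lra.
    apply IHN. lra. eapply Rle_trans; [apply Rabs_triang|]. rewrite Rabs_Ropp, Rabs_R1. lra.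
Qed.

Definition bcoef (b kap : R) (k : nat) : R :=
  / 2 * Gamma (- kap) * Rpower (b / 2) kap * ((b ^ 2 / 4) ^ k / (INR (fact k) * poch (1 + kap) k)).

Definition non_integer (nu : R) : Prop := forall m : Z, nu <> IZR m.

Lemma non_integer_add_INR nu (j : nat) : non_integer nu -> nu + INR j <> 0.
Proof. intros H E. apply (H (- Z.of_nat j)%Z). rewrite opp_IZR, <- INR_IZR_INZ. lra. Qed.

Lemma non_integer_opp nu : non_integer nu -> non_integer (- nu).
Proof. intros H m E. apply (H (- m)%Z). rewrite opp_IZR. lra. Qed.

Lemma non_integer_add1 nu : non_integer nu -> non_integer (1 + nu).
Proof. intros H m E. apply (H (m - 1)%Z). rewrite minus_IZR. lra. Qed.

Lemma non_integer_sub1 nu : non_integer nu -> non_integer (nu - 1).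
Proof. intros H m E. apply (H (m + 1)%Z). rewrite plus_IZR. lra. Qed.

Lemma poch_non_integer x m : non_integer x -> poch x m <> 0.
Proof. intros H. apply poch_neq_0. intros; now apply non_integer_add_INR. Qed.

Lemma Gamma_succ_ni x : non_integer x -> Gamma (x + 1) = x * Gamma x.
Proof. intros H. apply Gamma_succ. intros; now apply non_integer_add_INR. Qed.

Lemma Rpower_add1 x y : 0 < x -> Rpower x (y + 1) = Rpower x y * x.
Proof. intros H. now rewrite Rpower_plus, Rpower_1. Qed.

Lemma bcoef_plus b nu k : 0 < b -> non_integer nu ->
  bcoef b nu k * (2 * INR k + 2 * nu) = - (b * bcoef b (nu - 1) k).
Proof.
  intros Hb Hnu. unfold bcoef.
  replace (- (nu - 1)) with (- nu + 1) by ring. rewrite Gamma_succ_ni by now apply non_integer_opp.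
  replace (Rpower (b / 2) nu) with (Rpower (b / 2) (nu - 1) * (b / 2))
    by (rewrite <- Rpower_add1 by lra; f_equal; ring).
  assert (E : poch nu k * (nu + INR k) = nu * poch (1 + nu) k).
  { change (poch nu (S k) = nu * poch (1 + nu) k). now rewrite poch_shift, Rplus_comm. }
  replace (1 + (nu - 1)) with nu by ring.
  assert (H1 := poch_non_integer nu k Hnu). assert (H2 := poch_non_integer (1 + nu) k (non_integer_add1 nu Hnu)).
  assert (H3 := INR_fact_pos k). assert (H4 := non_integer_add_INR nu 0 Hnu). simpl in H4. rewrite Rplus_0_r in H4.
  replace (poch (1 + nu) k) with (poch nu k * (nu + INR k) / nu) by (rewrite E; field; auto).
  assert (H5 := non_integer_add_INR nu k Hnu).
  field. repeat split; auto. lra.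
Qed.

Lemma bcoef_minus b nu k : 0 < b -> non_integer nu ->
  bcoef b (- nu) (S k) * (2 * INR (S k)) = - (b * bcoef b (1 - nu) k).
Proof.
  intros Hb Hnu. unfold bcoef.
  replace (- - nu) with ((nu - 1) + 1) by ring. rewrite Gamma_succ_ni by now apply non_integer_sub1.
  replace (- (1 - nu)) with (nu - 1) by ring.
  replace (Rpower (b / 2) (1 - nu)) with (Rpower (b / 2) (- nu) * (b / 2))
    by (rewrite <- Rpower_add1 by lra; f_equal; ring).
  rewrite poch_shift, fact_simpl, mult_INR.
  replace (1 + - nu + 1) with (1 + (1 - nu)) by ring.
  assert (H2 : poch (1 + (1 - nu)) k <> 0).
  { apply poch_non_integer. do 2 apply non_integer_add1. now apply non_integer_opp. }
  assert (H3 := INR_fact_pos k). assert (H4 : 0 < INR (S k)) by (apply lt_0_INR; lia).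
  assert (H5 : 1 + - nu <> 0). { intros E. apply (Hnu 1%Z). lra. }
  simpl pow. field. repeat split; auto; lra.
Qed.

Definition brem (b nu : R) (p q : nat) (a : C) (t : R) : C :=
  (BesselK nu (bz b a t)
   - Csum_lt (fun k => RtoC (bcoef b (- nu) k) * xp (2 * INR k - nu) a t) p
   - Csum_lt (fun k => RtoC (bcoef b nu k) * xp (2 * INR k + nu) a t) q)%C.

Lemma brem_even b s nu p q a t : 0 < b -> 0 < s -> sector s a -> 0 < t ->
  brem b (- nu) q p a t = brem b nu p q a t.
Proof.
  intros Hb Hs Ha Ht. unfold brem. rewrite BesselK_even by now apply (Re_bz_pos b s).
  rewrite Ropp_involutive.
  rewrite (Csum_lt_ext (fun k => RtoC (bcoef b nu k) * xp (2 * INR k - - nu) a t)%C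
    (fun k => RtoC (bcoef b nu k) * xp (2 * INR k + nu) a t)%C q).
  2: { intros k _. do 2 f_equal. ring. }
  unfold Rminus. ring.
Qed.

Lemma BesselK_limit_bz b nu s a : 0 < b -> 0 < nu -> 0 < s -> sector s a ->
  tends0 (fun t => xp nu a t * BesselK nu (bz b a t))%C (RtoC (bcoef b (- nu) 0)).
Proof.
  intros Hb Hnu Hs Ha. assert (HM := sector_Cmod s a Ha). assert (HR := sector_Re s a Hs Ha).
  assert (HA := cos_Arg_pos a HR). assert (Ha0 := Re_pos_neq a HR).
  assert (H := BesselK_limit_ray nu (- Arg a) Hnu ltac:(lra)).
  apply (tends0_scal (RtoC (Rpower b (- nu)))) in H.
  replace (RtoC (bcoef b (- nu) 0)) with (RtoC (Rpower b (- nu)) * RtoC (Rpower 2 (nu - 1) * Gamma nu))%C.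
  2: { rewrite <- RtoC_mult. f_equal. unfold bcoef. simpl. rewrite Ropp_involutive, Rpower_div_l, Ropp_involutive by lra.
       unfold Rminus. rewrite Rpower_plus, (Rpower_Ropp 2 1), Rpower_1 by lra. field. }
  intros eps Heps. destruct (H eps Heps) as [r0 [Hr0 HH]].
  assert (Hk : 0 < b / Cmod a) by now apply Rdiv_lt_0_compat.
  exists (r0 / (b / Cmod a)). split. now apply Rdiv_lt_0_compat.
  intros t Ht. set (r := t * (b / Cmod a)).
  assert (Hr : 0 < r < r0).
  { unfold r. split. apply Rmult_lt_0_compat; lra. destruct Ht as [_ Ht].
    apply (Rmult_lt_compat_r (b / Cmod a)) in Ht; auto.
    replace (r0 / (b / Cmod a) * (b / Cmod a)) with r0 in Ht by (field; lra). exact Ht. }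
  specialize (HH r Hr). cbv beta in HH.
  replace (xp nu a t * BesselK nu (bz b a t))%C with (RtoC (Rpower b (- nu)) *
      (RtoC (Rpower r nu) * (Cexp (RtoC (nu * - Arg a) * Ci) * BesselK nu (ray r (- Arg a)))))%C. exact HH.
  replace (ray r (- Arg a)) with (bz b a t).
  - unfold xp. rewrite Cpower_polar by auto. unfold r.
    rewrite <- Rpower_mult_distr by lra. rewrite Rpower_div_l by lra.
    replace (nu * - Arg a) with (- nu * Arg a) by ring.
    assert (E : (RtoC (Rpower b (- nu)) * RtoC (Rpower b nu) = 1)%C).
    { rewrite <- RtoC_mult, <- Rpower_plus. replace (- nu + nu) with 0 by ring. now rewrite Rpower_O. }
    set (e := Cexp (RtoC (- nu * Arg a) * Ci)). rewrite !RtoC_mult.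
    transitivity ((RtoC (Rpower b (- nu)) * RtoC (Rpower b nu)) * (RtoC (Rpower t nu) * (RtoC (Rpower (Cmod a) (- nu)) * e) * BesselK nu (bz b a t)))%C.
    ring. rewrite E. ring.
  - unfold bz, ray, r.
    assert (E : a = (RtoC (Cmod a) * Cexp (RtoC (Arg a) * Ci))%C).
    { rewrite <- (Cexp_Cln a) at 1 by auto. unfold Cln.
      rewrite <- (exp_ln (Cmod a)) at 2 by auto. rewrite <- Cexp_RtoC, <- Cexp_plus. f_equal.
      apply C_ext; autorewrite with reim; simpl; ring. }
    set (e := Cexp (RtoC (Arg a) * Ci)) in *.
    replace (Cexp (RtoC (- Arg a) * Ci)) with (/ e)%C.
    2: { unfold e. rewrite <- Cexp_opp. f_equal. rewrite RtoC_opp. ring. }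
    assert (He : e <> 0) by apply Cexp_neq_0. assert (HM0 : RtoC (Cmod a) <> 0) by (apply RtoC_neq; lra).
    rewrite E at 1. rewrite !RtoC_mult, RtoC_div by lra. field. auto.
Qed.

Lemma brem_step b s nu p q A B : 0 < b -> 0 < s -> 0 < nu -> non_integer nu ->
  A = Rmin (2 * INR (S p) - nu) (2 * INR q + nu) -> A <= B ->
  (forall N, Sym (sector s) (pw (A - 1) B) N (brem b (nu - 1) p q)) ->
  forall N, Sym (sector s) (pw A (B + 1)) N (brem b nu (S p) q).
Proof.
  intros Hb Hs Hnu Hni HA HAB HSym.
  assert (HAp : 0 < A + nu).
  { rewrite HA, S_INR. generalize (pos_INR p) (pos_INR q). unfold Rmin; destruct Rle_dec; lra. }
  apply Sym_ode with nu (fun a t => - (RtoC b * (xp 1 a t * brem b (nu - 1) p q a t)))%C.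
  - lra.
  - exact HAp.
  - intros a t Ha Ht. unfold brem at 1. eapply Cder_eq.
    { apply Cder_minus; [apply Cder_minus|].
      - now apply (Cder_BesselK_bz b nu s).
      - apply (Cder_Csum_lt (fun k t => RtoC (bcoef b (- nu) k) * xp (2 * INR k - nu) a t)%C
          (fun k => RtoC (bcoef b (- nu) k) * (RtoC (2 * INR k - nu) * xp (2 * INR k - nu) a t))%C (RtoC (/ t))).
        intros k _. eapply Cder_eq. apply Cder_scal. now apply Cder_xp. ring.
      - apply (Cder_Csum_lt (fun k t => RtoC (bcoef b nu k) * xp (2 * INR k + nu) a t)%C
          (fun k => RtoC (bcoef b nu k) * (RtoC (2 * INR k + nu) * xp (2 * INR k + nu) a t))%C (RtoC (/ t))).
        intros k _. eapply Cder_eq. apply Cder_scal. now apply Cder_xp. ring. }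
    unfold brem.
    assert (E1 : (Csum_lt (fun k => RtoC (bcoef b (- nu) k) * (RtoC (2 * INR k - nu) * xp (2 * INR k - nu) a t)) (S p)
       = - (RtoC nu * Csum_lt (fun k => RtoC (bcoef b (- nu) k) * xp (2 * INR k - nu) a t) (S p))
         - RtoC b * (xp 1 a t * Csum_lt (fun k => RtoC (bcoef b (- (nu - 1)) k) * xp (2 * INR k - (nu - 1)) a t) p))%C).
    { transitivity (- RtoC nu * Csum_lt (fun k => RtoC (bcoef b (- nu) k) * xp (2 * INR k - nu) a t) (S p)
        + Csum_lt (fun k => RtoC (bcoef b (- nu) k * (2 * INR k)) * xp (2 * INR k - nu) a t) (S p))%C.
      - rewrite <- Csum_lt_scal, <- Csum_lt_plus. apply Csum_lt_ext. intros k _. rewrite RtoC_minus, !RtoC_mult. ring.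
      - rewrite (Csum_lt_shift (fun k => RtoC (bcoef b (- nu) k * (2 * INR k)) * xp (2 * INR k - nu) a t)%C).
        simpl (INR 0). rewrite !Rmult_0_r, Cmult_0_l, Cplus_0_l.
        rewrite (Csum_lt_ext _ (fun k => - (RtoC b * xp 1 a t) * (RtoC (bcoef b (- (nu - 1)) k) * xp (2 * INR k - (nu - 1)) a t))%C p).
        rewrite Csum_lt_scal. ring.
        intros k _. rewrite bcoef_minus by auto. replace (- (nu - 1)) with (1 - nu) by ring.
        replace (2 * INR (S k) - nu) with (1 + (2 * INR k - (nu - 1))) by (rewrite S_INR; ring).
        rewrite <- xp_mult, RtoC_opp, RtoC_mult. ring. }
    assert (E2 : (Csum_lt (fun k => RtoC (bcoef b nu k) * (RtoC (2 * INR k + nu) * xp (2 * INR k + nu) a t)) q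
       = - (RtoC nu * Csum_lt (fun k => RtoC (bcoef b nu k) * xp (2 * INR k + nu) a t) q)
         - RtoC b * (xp 1 a t * Csum_lt (fun k => RtoC (bcoef b (nu - 1) k) * xp (2 * INR k + (nu - 1)) a t) q))%C).
    { transitivity (- RtoC nu * Csum_lt (fun k => RtoC (bcoef b nu k) * xp (2 * INR k + nu) a t) q
        + - (RtoC b * xp 1 a t) * Csum_lt (fun k => RtoC (bcoef b (nu - 1) k) * xp (2 * INR k + (nu - 1)) a t) q)%C; [|ring].
      rewrite <- !Csum_lt_scal, <- Csum_lt_plus. apply Csum_lt_ext. intros k _.
      replace (2 * INR k + nu) with (1 + (2 * INR k + (nu - 1))) at 2 3 by ring. rewrite <- xp_mult.
      transitivity (- RtoC nu * (RtoC (bcoef b nu k) * (xp 1 a t * xp (2 * INR k + (nu - 1)) a t))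
        + RtoC (bcoef b nu k * (2 * INR k + 2 * nu)) * (xp 1 a t * xp (2 * INR k + (nu - 1)) a t))%C.
      rewrite !RtoC_mult, !RtoC_plus, !RtoC_mult. rewrite RtoC_two. ring.
      rewrite bcoef_plus by auto. rewrite RtoC_opp, RtoC_mult. ring. }
    rewrite E1, E2. ring.
  - intros N. apply Sym_opp, Sym_scal.
    replace A with (1 + (A - 1)) by ring. replace (B + 1) with (1 + B) by ring.
    apply Sym_pw_mult; try lra; auto. apply Sym_xp; lra.
  - intros a Ha. assert (HM := sector_Cmod s a Ha).
    apply tends0_ext with (fun t => (xp nu a t * BesselK nu (bz b a t) + - RtoC (bcoef b (- nu) 0))
      + (Csum_lt (fun k => - RtoC (bcoef b (- nu) (S k)) * xp (2 * INR (S k)) a t) p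
       + Csum_lt (fun k => - RtoC (bcoef b nu k) * xp (2 * INR k + 2 * nu) a t) q))%C.
    { intros t Ht. unfold brem. rewrite (Csum_lt_shift _ p).
      rewrite (Csum_lt_ext _ (fun k => - xp nu a t * (RtoC (bcoef b (- nu) (S k)) * xp (2 * INR (S k) - nu) a t))%C p).
      2: { intros k _. replace (2 * INR (S k)) with (nu + (2 * INR (S k) - nu)) at 1 by ring. rewrite <- xp_mult. ring. }
      rewrite (Csum_lt_ext (fun k => - RtoC (bcoef b nu k) * xp (2 * INR k + 2 * nu) a t)%C (fun k => - xp nu a t * (RtoC (bcoef b nu k) * xp (2 * INR k + nu) a t))%C q).
      2: { intros k _. replace (2 * INR k + 2 * nu) with (nu + (2 * INR k + nu)) by ring. rewrite <- xp_mult. ring. }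
      rewrite !Csum_lt_scal. simpl (INR 0). rewrite Rmult_0_r.
      transitivity (xp nu a t * BesselK nu (bz b a t) - RtoC (bcoef b (- nu) 0) * (xp nu a t * xp (0 - nu) a t)
        - xp nu a t * Csum_lt (fun k => RtoC (bcoef b (- nu) (S k)) * xp (2 * INR (S k) - nu) a t) p
        - xp nu a t * Csum_lt (fun k => RtoC (bcoef b nu k) * xp (2 * INR k + nu) a t) q)%C; [|ring].
      rewrite xp_mult. replace (nu + (0 - nu)) with 0 by ring. rewrite xp_0 by auto. ring. }
    replace (RtoC 0) with ((RtoC (bcoef b (- nu) 0) + - RtoC (bcoef b (- nu) 0)) + (0 + 0))%C by ring.
    apply tends0_plus; [apply tends0_plus|apply tends0_plus].
    + now apply (BesselK_limit_bz b nu s).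
    + apply tends0_const.
    + apply tends0_Csum_lt. intros k _. rewrite <- (Cmult_0_r (- RtoC (bcoef b (- nu) (S k)))%C).
      apply tends0_scal, tends0_xp; auto. assert (0 < INR (S k)) by (apply lt_0_INR; lia). lra.
    + apply tends0_Csum_lt. intros k _. rewrite <- (Cmult_0_r (- RtoC (bcoef b nu k))%C).
      apply tends0_scal, tends0_xp; auto. generalize (pos_INR k); lra.
Qed.

(* The number of subtracted terms of one of the two families drops by one when
   [nu] is lowered by 1, so induct on the total number. For [nu < 0] the two
   families exchange their roles. *)
Lemma Sym_brem b s : 0 < b -> 0 < s -> forall n p q nu, (p + q = n)%nat -> non_integer nu ->
  exists B, Rmin (2 * INR p - nu) (2 * INR q + nu) <= B /\
    forall N, Sym (sector s) (pw (Rmin (2 * INR p - nu) (2 * INR q + nu)) B) N (brem b nu p q).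
Proof.
  intros Hb Hs n. induction n as [n IH] using lt_wf_ind.
  assert (Hpos : forall p q nu, (p + q = n)%nat -> non_integer nu -> 0 < nu ->
    exists B, Rmin (2 * INR p - nu) (2 * INR q + nu) <= B /\
    forall N, Sym (sector s) (pw (Rmin (2 * INR p - nu) (2 * INR q + nu)) B) N (brem b nu p q)).
  { intros p q nu Hn Hni Hnu. destruct p as [|p].
    - simpl INR. rewrite Rmult_0_r. assert (Hq := pos_INR q). 
      replace (Rmin (0 - nu) (2 * INR q + nu)) with (- nu) by (rewrite Rmin_left by lra; ring).
      exists (2 * INR q + nu). split. lra. intros N.
      apply Sym_ext with (fun a t => BesselK nu (bz b a t) - Csum_lt (fun k => RtoC (bcoef b nu k) * xp (2 * INR k + nu) a t) q)%C.
      { intros; unfold brem; simpl; ring. }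
      apply Sym_minus.
      + apply Sym_pw_mono with (- nu) (- nu); try lra. apply Sym_BesselK; auto. rewrite Rabs_pos_eq; lra.
      + apply (Sym_Csum_lt _ _ N (fun k a t => RtoC (bcoef b nu k) * xp (2 * INR k + nu) a t)%C).
        intros; left; apply pw_pos. intros k Hk. apply Sym_scal, Sym_xp.
        assert (INR k <= INR q) by (apply le_INR; lia). generalize (pos_INR k). lra.
    - destruct (IH (p + q)%nat ltac:(lia) p q (nu - 1) eq_refl (non_integer_sub1 nu Hni)) as [B [HB HS]].
      set (A := Rmin (2 * INR (S p) - nu) (2 * INR q + nu)).
      assert (EA : Rmin (2 * INR p - (nu - 1)) (2 * INR q + (nu - 1)) = A - 1).
      { unfold A. rewrite S_INR. unfold Rmin; repeat destruct Rle_dec; lra. }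
      rewrite EA in *. exists (Rmax A B + 1). assert (HX := Rmax_l A B). assert (HY := Rmax_r A B). split. lra.
      apply brem_step; auto. intros N. apply Sym_pw_mono with (A - 1) B; auto; lra. }
  intros p q nu Hn Hni. destruct (Rlt_le_dec 0 nu) as [Hnu|Hnu]. now apply Hpos.
  assert (Hnu' : 0 < - nu). { assert (nu <> 0) by (apply (Hni 0%Z)). lra. }
  destruct (Hpos q p (- nu) ltac:(lia) (non_integer_opp nu Hni) Hnu') as [B [HB HS]].
  replace (Rmin (2 * INR q - - nu) (2 * INR p + - nu)) with (Rmin (2 * INR p - nu) (2 * INR q + nu)) in HB, HS
    by (rewrite Rmin_comm; f_equal; ring).
  exists B. split; auto. intros N. apply Sym_ext with (brem b (- nu) q p); auto.
  intros a t Ha Ht. now apply (brem_even b s).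
Qed.

(** * The asymptotic expansion *)

Lemma pw_growth A B s a t : A <= B -> sector s a -> 1 <= t ->
  pw A B a t <= (Rpower (Cmod a) (- A) + Rpower (Cmod a) (- B)) * Rpower t B.
Proof.
  intros HAB Ha Ht. assert (HM := sector_Cmod s a Ha). unfold pw.
  rewrite !Rpower_div_l by lra. generalize (Rle_Rpower t A B Ht HAB) (Rpower_pos (Cmod a) (- A)). nra.
Qed.

Lemma Sym_pw_AltSum s A B N sig g : A <= B -> B - sig - INR N <= -2 -> Sym (sector s) (pw A B) N g ->
  exists c, 0 <= c /\ forall a, sector s a ->
    exists l, AltSum N (fun u => RtoC (Rpower u (- sig)) * g a u)%C l /\
      Cmod l <= c * (Rpower (Cmod a) (- A) + Rpower (Cmod a) (- B)).
Proof.
  intros HAB HN Hg.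
  apply (Sym_AltSum (sector s) (pw A B) (Rpower 2 (Rabs A) + Rpower 2 (Rabs B))
    (fun a => Rpower (Cmod a) (- A) + Rpower (Cmod a) (- B)) B); auto.
  - generalize (Rpower_pos 2 (Rabs A)) (Rpower_pos 2 (Rabs B)). lra.
  - intros; left; apply pw_pos.
  - intros p t t' Hp Ht Ht'. now apply (pw_doubling A B s).
  - intros p _. generalize (Rpower_pos (Cmod p) (- A)) (Rpower_pos (Cmod p) (- B)). lra.
  - intros p t Hp Ht. now apply (pw_growth A B s).
Qed.

Lemma AltSum_zero N : AltSum N (fun _ => RtoC 0) 0.
Proof.
  apply AltSum_of_series. eapply Cseries_ext; [|apply Cseries_zero]. intros n; cbv beta. ring.
Qed.

Lemma AltSum_Csum_lt N (f : nat -> R -> C) (l : nat -> C) K :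
  (forall k, (k < K)%nat -> AltSum N (f k) (l k)) ->
  AltSum N (fun t => Csum_lt (fun k => f k t) K) (Csum_lt l K).
Proof.
  induction K; intros H. exact (AltSum_zero N).
  rewrite Csum_lt_S. apply (AltSum_ext N (fun t => Csum_lt (fun k => f k t) K + f K t)%C).
  intros; symmetry; apply Csum_lt_S. apply AltSum_plus; auto.
Qed.

Lemma Csum_lt_triangle (f : nat -> nat -> C) K :
  Csum_lt (fun k => Csum_lt (fun i => f k i) (K - k)) K = Csum_lt (fun m => Csum_lt (fun r => f r (m - r)%nat) (S m)) K.
Proof.
  induction K. reflexivity.
  rewrite (Csum_lt_S (fun m => Csum_lt (fun r => f r (m - r)%nat) (S m)) K), <- IHK.
  rewrite (Csum_lt_S (fun r => f r (K - r)%nat) K), (Csum_lt_S (fun k => Csum_lt (fun i => f k i) (S K - k)) K).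
  rewrite (Csum_lt_ext (fun k => Csum_lt (fun i => f k i) (S K - k)) (fun k => Csum_lt (fun i => f k i) (K - k) + f k (K - k)%nat)%C K).
  2: { intros k Hk. replace (S K - k)%nat with (S (K - k)) by lia. apply Csum_lt_S. }
  rewrite Csum_lt_plus. replace (S K - K)%nat with 1%nat by lia. rewrite Nat.sub_diag.
  change (Csum_lt (fun i => f K i) 1) with (sum_n (fun i => f K i) 0). rewrite Csum_O. ring.
Qed.

Lemma RtoC_sum_f_R0 (g : nat -> R) m : RtoC (sum_f_R0 g m) = Csum_lt (fun r => RtoC (g r)) (S m).
Proof.
  induction m. now rewrite Csum_lt_S; simpl; rewrite Cplus_0_l.
  rewrite Csum_lt_S, <- IHm. simpl. apply RtoC_plus.
Qed.

Lemma poch_opp_INR m r : (r <= m)%nat -> poch (- INR m) r * INR (fact (m - r)) = (-1) ^ r * INR (fact m).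
Proof.
  induction r; intros Hr. rewrite Nat.sub_0_r. simpl. ring.
  simpl poch. simpl pow.
  specialize (IHr ltac:(lia)). replace (m - r)%nat with (S (m - S r)) in IHr by lia.
  rewrite fact_simpl, mult_INR in IHr.
  replace (INR (S (m - S r))) with (INR m - INR r) in IHr by (rewrite <- minus_INR by lia; f_equal; lia).
  replace (poch (- INR m) r * (- INR m + INR r) * INR (fact (m - S r)))
    with (- (poch (- INR m) r * ((INR m - INR r) * INR (fact (m - S r))))) by ring.
  rewrite IHr. ring.
Qed.

Lemma poch_reflect mu m r : (r <= m)%nat -> poch (1 - mu - INR m) r * poch mu (m - r) = (-1) ^ r * poch mu m.
Proof.
  induction r; intros Hr. rewrite Nat.sub_0_r. simpl. ring.
  specialize (IHr ltac:(lia)). replace (m - r)%nat with (S (m - S r)) in IHr by lia.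
  simpl poch in IHr. simpl poch. simpl pow.
  replace (INR (m - S r)) with (INR m - INR r - 1) in IHr by (rewrite minus_INR, S_INR by lia; ring).
  replace (poch (1 - mu - INR m) r * (1 - mu - INR m + INR r) * poch mu (m - S r))
    with (- (poch (1 - mu - INR m) r * (poch mu (m - S r) * (mu + (INR m - INR r - 1))))) by ring.
  rewrite IHr. ring.
Qed.

Lemma poch_pos x m : 0 < x -> 0 < poch x m.
Proof.
  intros Hx. induction m; simpl. lra. apply Rmult_lt_0_compat; auto. generalize (pos_INR m); lra.
Qed.

Definition kcoef (mu b kap : R) (m : nat) : R := sum_f_R0 (fun r => bcoef b kap r * qcoef mu (m - r)) m.

Lemma Rpower_half_square b kap : 0 < b -> Rpower (b ^ 2 / 4) (kap / 2) = Rpower (b / 2) kap.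
Proof.
  intros Hb. replace (b ^ 2 / 4) with ((b / 2) ^ 2) by field.
  rewrite <- Rpower_pow, Rpower_mult by lra. f_equal. simpl. field.
Qed.

Lemma kcoef_F mu b kap m : 0 < mu -> 0 < b -> non_integer kap ->
  kcoef mu b kap m = / 2 * Rpower (b ^ 2 / 4) (kap / 2) * Gamma (- kap) * (qcoef mu m * F mu kap (b ^ 2 / 4) m).
Proof.
  intros Hmu Hb Hk. unfold kcoef, F. rewrite Rpower_half_square by auto.
  rewrite <- (Rmult_assoc _ (qcoef mu m)), scal_sum. apply sum_eq. intros r Hr.
  assert (H1 := poch_opp_INR m r Hr). assert (H2 := poch_reflect mu m r Hr).
  assert (P1 := poch_pos mu (m - r) Hmu). assert (P2 := poch_pos mu m Hmu).
  assert (F1 := INR_fact_pos (m - r)). assert (F2 := INR_fact_pos m). assert (F3 := INR_fact_pos r).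
  assert (P3 : poch (1 + kap) r <> 0) by (apply poch_non_integer; now apply non_integer_add1).
  assert (Hs : (-1) ^ r * (-1) ^ r = 1) by (rewrite <- Rpow_mult_distr; replace (-1 * -1) with 1 by ring; apply pow1).
  assert (Hs0 : (-1) ^ r <> 0) by (apply pow_nonzero; lra).
  assert (P4 : poch (1 - mu - INR m) r <> 0).
  { intros E. rewrite E, Rmult_0_l in H2. symmetry in H2. apply Rmult_integral in H2. destruct H2; [auto|lra]. }
  unfold qcoef, bcoef. set (chi := b ^ 2 / 4).
  replace ((- chi) ^ r) with ((-1) ^ r * chi ^ r) by (rewrite <- Rpow_mult_distr; f_equal; ring).
  replace ((-1) ^ m) with ((-1) ^ r * (-1) ^ (m - r)) by (rewrite <- pow_add; f_equal; lia).
  replace (poch (- INR m) r) with ((-1) ^ r * INR (fact m) / INR (fact (m - r))) by (rewrite <- H1; field; lra).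
  replace (poch mu m) with ((-1) ^ r * (poch (1 - mu - INR m) r * poch mu (m - r)))
    by (rewrite H2, <- Rmult_assoc, Hs; ring).
  set (sg := (-1) ^ r) in *.
  transitivity ((sg * sg) * (sg * sg) * (/ 2 * Gamma (- kap) * Rpower (b / 2) kap * (chi ^ r / (INR (fact r) * poch (1 + kap) r)) *
     ((-1) ^ (m - r) * poch mu (m - r) / INR (fact (m - r))))).
  - rewrite Hs. ring.
  - field. repeat split; auto; lra.
Qed.

Definition expansion_main (mu b kap : R) (K : nat) (a : C) (t : R) : C :=
  Csum_lt (fun m => RtoC (kcoef mu b kap m) * xp (2 * INR m + kap) a t)%C K.

Definition expansion_tail (mu b kap : R) (K : nat) (a : C) (t : R) : C :=
  Csum_lt (fun k => RtoC (bcoef b kap k) * (xp (2 * INR k + kap) a t * qrem mu (K - k) a t))%C K.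

Lemma expansion_split mu b kap K a t :
  (Csum_lt (fun k => RtoC (bcoef b kap k) * xp (2 * INR k + kap) a t) K * qfac mu a t
   = expansion_main mu b kap K a t + expansion_tail mu b kap K a t)%C.
Proof.
  unfold expansion_main, expansion_tail.
  rewrite (Csum_lt_ext (fun m => RtoC (kcoef mu b kap m) * xp (2 * INR m + kap) a t)%C
    (fun m => Csum_lt (fun r => RtoC (bcoef b kap r * qcoef mu (m - r)) * (xp (2 * INR r + kap) a t * xp (2 * INR (m - r)) a t)) (S m))%C K).
  2: { intros m _. unfold kcoef. rewrite RtoC_sum_f_R0, Cmult_comm, <- Csum_lt_scal. apply Csum_lt_ext. intros r Hr.
       rewrite xp_mult. replace (2 * INR r + kap + 2 * INR (m - r)) with (2 * INR m + kap).
       ring. rewrite minus_INR by lia. ring. }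
  rewrite <- (Csum_lt_triangle (fun r i => RtoC (bcoef b kap r * qcoef mu i) * (xp (2 * INR r + kap) a t * xp (2 * INR i) a t))%C).
  rewrite <- Csum_lt_plus, Cmult_comm, <- Csum_lt_scal. apply Csum_lt_ext. intros k _.
  replace (qfac mu a t) with (qrem mu (K - k) a t + Csum_lt (fun i => RtoC (qcoef mu i) * xp (2 * INR i) a t) (K - k))%C
    by (unfold qrem; ring).
  rewrite (Csum_lt_ext (fun i => RtoC (bcoef b kap k * qcoef mu i) * (xp (2 * INR k + kap) a t * xp (2 * INR i) a t))%C
    (fun i => (RtoC (bcoef b kap k) * xp (2 * INR k + kap) a t) * (RtoC (qcoef mu i) * xp (2 * INR i) a t))%C (K - k)).
  rewrite Csum_lt_scal. ring. intros i _. rewrite RtoC_mult. ring.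
Qed.

Lemma Sym_expansion_tail mu b kap nu s K N : 0 < mu -> 0 < s -> - nu <= kap <= nu ->
  Sym (sector s) (pw (2 * INR K - nu) (2 * INR K + nu)) N (expansion_tail mu b kap K).
Proof.
  intros Hmu Hs Hk. unfold expansion_tail.
  apply (Sym_Csum_lt _ _ N (fun k a t => RtoC (bcoef b kap k) * (xp (2 * INR k + kap) a t * qrem mu (K - k) a t))%C).
  intros; left; apply pw_pos. intros k Hk'. apply Sym_scal.
  apply Sym_pw_mono with (2 * INR K + kap) (2 * INR K + kap); try lra.
  replace (2 * INR K + kap) with ((2 * INR k + kap) + 2 * INR (K - k)) by (rewrite minus_INR by lia; ring).
  apply Sym_pw_mult; try lra. apply Sym_xp; lra. now apply Sym_qrem.
Qed.

Definition expansion_remainder (mu b nu : R) (K : nat) (a : C) (t : R) : C :=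
  (brem b nu K K a t * qfac mu a t + (expansion_tail mu b nu K a t + expansion_tail mu b (- nu) K a t))%C.

Lemma expansion_eq mu b nu K a t :
  (qfac mu a t * BesselK nu (bz b a t) =
   expansion_remainder mu b nu K a t + (expansion_main mu b nu K a t + expansion_main mu b (- nu) K a t))%C.
Proof.
  assert (H1 := expansion_split mu b nu K a t). assert (H2 := expansion_split mu b (- nu) K a t).
  unfold expansion_remainder, brem.
  transitivity ((BesselK nu (bz b a t)
   - Csum_lt (fun k => RtoC (bcoef b (- nu) k) * xp (2 * INR k - nu) a t) K
   - Csum_lt (fun k => RtoC (bcoef b nu k) * xp (2 * INR k + nu) a t) K) * qfac mu a t
   + (Csum_lt (fun k => RtoC (bcoef b nu k) * xp (2 * INR k + nu) a t) K * qfac mu a t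
   + Csum_lt (fun k => RtoC (bcoef b (- nu) k) * xp (2 * INR k + - nu) a t) K * qfac mu a t))%C.
  - unfold Rminus. ring.
  - rewrite H1, H2. ring.
Qed.

Lemma Sym_expansion_remainder mu b nu s K : 0 < mu -> 0 < b -> 0 < nu -> 0 < s -> non_integer nu ->
  exists B, 2 * INR K - nu <= B /\
    forall N, Sym (sector s) (pw (2 * INR K - nu) B) N (expansion_remainder mu b nu K).
Proof.
  intros Hmu Hb Hnu Hs Hni. destruct (Sym_brem b s Hb Hs (K + K) K K nu eq_refl Hni) as [B [HB HS]].
  rewrite Rmin_left in HB, HS by lra.
  exists (Rmax B (2 * INR K + nu)). assert (HX := Rmax_l B (2 * INR K + nu)). assert (HY := Rmax_r B (2 * INR K + nu)).
  split. lra. intros N. apply Sym_plus; [|apply Sym_plus].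
  - replace (pw (2 * INR K - nu)) with (pw (2 * INR K - nu + 0)) by now rewrite Rplus_0_r.
    apply Sym_pw_mono with (2 * INR K - nu + 0) (B + 0); try lra. apply Sym_pw_mult; try lra; auto. now apply Sym_qfac.
  - apply Sym_pw_mono with (2 * INR K - nu) (2 * INR K + nu); try lra. apply Sym_expansion_tail; auto. lra.
  - apply Sym_pw_mono with (2 * INR K - nu) (2 * INR K + nu); try lra. apply Sym_expansion_tail; auto. lra.
Qed.

Lemma exists_nat_ge (x : R) : exists N, x <= INR N.
Proof.
  exists (Z.to_nat (up x)). destruct (archimed x) as [A _].
  assert (IZR (up x) <= INR (Z.to_nat (up x))) by (rewrite INR_IZR_INZ; apply IZR_le; lia). lra.
Qed.

Lemma summand_eq mu b gamma nu a m : 0 < Re a ->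
  summand mu b gamma nu a (m + 1) = (Cpower a (RtoC (- (2 * mu))) *
   (alt_sign m * (RtoC (Rpower (INR m + 1) gamma) * (qfac mu a (INR m + 1) * BesselK nu (bz b a (INR m + 1))))))%C.
Proof.
  intros Ha. unfold summand, alt_sign. replace (m + 1 - 1)%nat with m by lia.
  rewrite plus_INR. simpl (INR 1). rewrite qfac_eq, Cpower_opp. unfold bz.
  fold (radicand a (INR m + 1)). rewrite RtoC_mult. field.
  split; apply Cpower_neq_0.
Qed.

Lemma summand_series mu b gamma nu a : 0 < mu -> 0 < b -> 0 < nu -> 0 < Re a ->
  exists l, AltSum 0 (fun t => RtoC (Rpower t gamma) * (qfac mu a t * BesselK nu (bz b a t)))%C l.
Proof.
  intros Hmu Hb Hnu Ha. assert (Ha0 := Re_pos_neq a Ha). assert (HM : 0 < Cmod a) by now apply Cmod_gt_0.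
  set (s := Re a / Cmod a). assert (Hs : 0 < s) by now apply Rdiv_lt_0_compat.
  assert (Hsec : sector s a). { split; auto. unfold s. right. field. lra. }
  set (m := Rmax nu (gamma + 2)).
  assert (Hm1 : nu <= m) by apply Rmax_l. assert (Hm2 : gamma + 2 <= m) by apply Rmax_r.
  assert (HS : Sym (sector s) (pw (0 + - m) (0 + - m)) 0 (fun a t => qfac mu a t * BesselK nu (bz b a t))%C).
  { apply Sym_pw_mult; try lra. now apply Sym_qfac. apply Sym_BesselK; auto. lra. rewrite Rabs_pos_eq; lra. }
  destruct (Sym_pw_AltSum s (0 + - m) (0 + - m) 0 (- gamma) _ ltac:(lra) ltac:(simpl; lra) HS) as [c [_ H]].
  destruct (H a Hsec) as [l [Hl _]]. exists l. rewrite Ropp_involutive in Hl. exact Hl.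
Qed.

Definition zeta_value (zeta : C -> C) (gamma kap : R) (m : nat) : C :=
  (RtoC (1 - Rpower 2 (1 + omega gamma kap m)) * zeta (RtoC (- omega gamma kap m)))%C.

Lemma AltSum_expansion_main zeta mu b gamma kap K N a : is_Riemann_zeta zeta ->
  (forall j : nat, gamma + kap <> - (2 * INR j + 1)) -> 3 + (gamma + kap + 2 * INR K) <= INR N -> 1 <= INR N ->
  AltSum N (fun t => RtoC (Rpower t gamma) * expansion_main mu b kap K a t)%C
    (Csum_lt (fun m => RtoC (kcoef mu b kap m) * (Cpower a (RtoC (- (2 * INR m + kap))) * zeta_value zeta gamma kap m)) K)%C.
Proof.
  intros Hz Hne HN HN1.
  apply (AltSum_ext N (fun t => Csum_lt (fun m => (RtoC (kcoef mu b kap m) * Cpower a (RtoC (- (2 * INR m + kap))))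
    * RtoC (Rpower t (omega gamma kap m))) K)%C).
  { intros t Ht. unfold expansion_main. rewrite <- Csum_lt_scal. apply Csum_lt_ext. intros m _. unfold xp, omega.
    replace (gamma + kap + 2 * INR m) with (gamma + (2 * INR m + kap)) by ring.
    rewrite (Rpower_plus gamma), RtoC_mult. ring. }
  apply (AltSum_Csum_lt N (fun m t => (RtoC (kcoef mu b kap m) * Cpower a (RtoC (- (2 * INR m + kap))))
    * RtoC (Rpower t (omega gamma kap m)))%C).
  intros m Hm. rewrite Cmult_assoc. apply AltSum_scal. apply zeta_AltSum_Rpower; auto.
  - unfold omega. intros E. apply (Hne m). lra.
  - unfold omega. assert (INR m <= INR K) by (apply le_INR; lia). lra.
Qed.

Lemma Rtilde_eq zeta mu b gamma kap K a : 0 < mu -> 0 < b -> non_integer kap -> a <> RtoC 0 ->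
  Rtilde zeta mu b gamma K a kap = (Cpower a (RtoC (- (2 * mu))) *
    Csum_lt (fun m => RtoC (kcoef mu b kap m) * (Cpower a (RtoC (- (2 * INR m + kap))) * zeta_value zeta gamma kap m)) K)%C.
Proof.
  intros Hmu Hb Hk Ha. unfold Rtilde. cbv zeta. rewrite <- !Csum_lt_scal. apply Csum_lt_ext. intros m _.
  rewrite kcoef_F by auto. unfold zeta_value, qcoef. rewrite !RtoC_mult.
  replace (- kap - 2 * mu) with (- (2 * mu) + - kap) by ring. rewrite Cpower_add.
  replace (- (2 * INR m + kap)) with (- kap + - INR (2 * m)) by (rewrite mult_INR; simpl; ring).
  rewrite Cpower_add, (Cpower_opp a (INR (2 * m))), Cpower_INR by auto. ring.
Qed.

Theorem mainTheorem7 :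
  forall (zeta : C -> C) (mu b gamma nu : R),
    is_Riemann_zeta zeta ->
    0 < mu -> 0 < b -> 0 < nu ->
    (forall m : Z, nu <> IZR m) ->
    (forall j : nat, gamma + nu <> - (2 * INR j + 1)) ->
    (forall j : nat, gamma - nu <> - (2 * INR j + 1)) ->
    exists L : C -> C,
      (forall a : C, a <> RtoC 0 -> Rabs (Arg a) < PI / 2 ->
         is_series (fun m : nat => summand mu b gamma nu a (m + 1)) (L a)) /\
      (forall (K : nat) (delta : R), 0 < delta < PI / 2 ->
         exists M A : R, 0 < A /\
           forall a : C, A <= Cmod a -> Rabs (Arg a) <= PI / 2 - delta ->
             Cmod (L a - (Rtilde zeta mu b gamma K a nu
                          + Rtilde zeta mu b gamma K a (- nu)))%C
             <= M * Rpower (Cmod a) (nu - 2 * mu - 2 * INR K)).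
Proof.
  intros zeta mu b gamma nu Hz Hmu Hb Hnu Hni Hp1 Hp2.
  set (f := fun a t => (RtoC (Rpower t gamma) * (qfac mu a t * BesselK nu (bz b a t)))%C).
  assert (HL : forall a : C, exists l, 0 < Re a -> AltSum 0 (f a) l).
  { intros a. destruct (Rlt_dec 0 (Re a)) as [Ha|Ha]; [|exists (RtoC 0); tauto].
    destruct (summand_series mu b gamma nu a Hmu Hb Hnu Ha) as [l Hl]. exists l; auto. }
  apply functional_choice in HL. destruct HL as [S HS].
  exists (fun a => Cpower a (RtoC (- (2 * mu))) * S a)%C. split.
  - intros a Ha HA. assert (HR := Re_pos_of_Arg a Ha HA).
    apply (Cseries_ext (fun m => Cpower a (RtoC (- (2 * mu))) * (alt_sign m * f a (INR m + 1)%R))%C).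
    { intros m. symmetry. now apply summand_eq. }
    apply Cseries_scal. exact (HS a HR).
  - intros K delta Hd. assert (HPI := PI_RGT_0).
    set (s := sin delta). assert (Hs : 0 < s) by (apply sin_gt_0; lra).
    destruct (Sym_expansion_remainder mu b nu s K Hmu Hb Hnu Hs Hni) as [B [HB HSym]].
    assert (HK := pos_INR K).
    destruct (exists_nat_ge (Rmax (B + gamma + 2) (Rmax 1 (3 + (gamma + nu + 2 * INR K))))) as [N HN].
    assert (HN1 := Rle_trans _ _ _ (Rmax_l _ _) HN). assert (HN2 := Rle_trans _ _ _ (Rmax_r _ _) HN).
    assert (HN3 := Rle_trans _ _ _ (Rmax_l _ _) HN2). assert (HN4 := Rle_trans _ _ _ (Rmax_r _ _) HN2).
    destruct (Sym_pw_AltSum s (2 * INR K - nu) B N (- gamma) _ HB ltac:(lra) (HSym N)) as [c [Hc Hrem]].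
    exists (c * 2), 1. split. lra. intros a Ha HA.
    assert (Ha0 : a <> RtoC 0) by (apply Cmod_gt_0; lra).
    assert (Hsec : sector s a). { split; auto. now apply Re_ge_of_Arg. }
    assert (HR := sector_Re s a Hs Hsec).
    destruct (Hrem a Hsec) as [l [Hl Hl']]. rewrite Ropp_involutive in Hl.
    assert (HX : S a = (l + (Csum_lt (fun m => RtoC (kcoef mu b nu m) * (Cpower a (RtoC (- (2 * INR m + nu))) * zeta_value zeta gamma nu m)) K
       + Csum_lt (fun m => RtoC (kcoef mu b (- nu) m) * (Cpower a (RtoC (- (2 * INR m + - nu))) * zeta_value zeta gamma (- nu) m)) K))%C).
    { apply (AltSum_unique N (f a)). now apply AltSum_of_series, HS.
      eapply AltSum_ext; [|apply AltSum_plus; [apply Hl|apply AltSum_plus; apply (AltSum_expansion_main zeta mu b gamma _ K N a Hz)]]; auto.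
      - intros t Ht. cbv beta. unfold f. rewrite (expansion_eq mu b nu K a t). ring.
      - lra. }
    rewrite HX, (Rtilde_eq zeta mu b gamma nu), (Rtilde_eq zeta mu b gamma (- nu)); auto. 2: now apply non_integer_opp.
    replace (Cpower a (RtoC (- (2 * mu))) * (l + _) - _)%C with (Cpower a (RtoC (- (2 * mu))) * l)%C by ring.
    rewrite Cmod_mult, Cmod_Cpower.
    replace (nu - 2 * mu - 2 * INR K) with (- (2 * mu) + - (2 * INR K - nu)) by ring. rewrite Rpower_plus.
    assert (Rpower (Cmod a) (- B) <= Rpower (Cmod a) (- (2 * INR K - nu))) by (apply Rle_Rpower; lra).
    assert (HP := Rpower_pos (Cmod a) (- (2 * mu))).
    replace (c * 2 * (Rpower (Cmod a) (- (2 * mu)) * Rpower (Cmod a) (- (2 * INR K - nu))))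
      with (Rpower (Cmod a) (- (2 * mu)) * (c * (2 * Rpower (Cmod a) (- (2 * INR K - nu))))) by ring.
    apply Rmult_le_compat_l. lra. eapply Rle_trans; [apply Hl'|]. apply Rmult_le_compat_l; lra.
Qed.
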